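(* Let $\mu$ be a complex number with $-2\mu\neq0,1,2,\ldots$ and let $x>0$. Then $$\left.\frac{\partial \mathrm{W}_{\kappa,\mu}(x)}{\partial\mu}\right|_{\kappa=1/2-\mu}=x^{1/2-\mu}e^{-x/2}\left\{\frac{x}{2\mu}\,{}_2F_2\left(\left.\begin{array}{c}1,1\\ 2,1+2\mu\end{array}\right|-x\right)+e^{-2\pi i\mu}\,\Gamma(1-2\mu,x)\,\gamma(2\mu,-x)+\psi(2\mu)-\ln x\right\},$$ where the partial derivative with respect to $\mu$ is taken with $\kappa$ fixed, and $\kappa$ is then set equal to $1/2-\mu$.
   Context: For $x>0$ and complex $\kappa,\mu$, the Whittaker function is $\mathrm{W}_{\kappa,\mu}(x)=e^{-x/2}x^{\mu+1/2}\,\mathrm{U}\left(\frac12+\mu-\kappa,1+2\mu,x\right)$, where $\mathrm{U}$ is the Tricomi confluent hypergeometric function. The generalized hypergeometric function is ${}_pF_q\left(\left.\begin{array}{c}a_1,\ldots,a_p\\ b_1,\ldots,b_q\end{array}\right|x\right)=\sum_{n\ge0}\frac{(a_1)_n\cdots(a_p)_n}{(b_1)_n\cdots(b_q)_n}\frac{x^n}{n!}$ with $(\alpha)_n=\Gamma(\alpha+n)/\Gamma(\alpha)$. $\psi=\Gamma'/\Gamma$ is the digamma function. The upper incomplete gamma function is $\Gamma(\nu,z)=\int_z^\infty t^{\nu-1}e^{-t}\,dt$. The lower incomplete gamma function is $\gamma(\nu,z)=\int_0^z t^{\nu-1}e^{-t}\,dt$ for $\mathrm{Re}\,\nu>0$,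 continued analytically in $\nu\neq0,-1,-2,\ldots$ by $\gamma(\nu,z)=\sum_{n\ge0}\frac{(-1)^n z^{\nu+n}}{n!(\nu+n)}$; powers are principal, with $(-x)^{\nu}=e^{i\pi\nu}x^{\nu}$ for $x>0$. *)

(* Defs.v *)
From Stdlib Require Import Reals ZArith List.
From Coquelicot Require Import Coquelicot.

Local Open Scope R_scope.
Local Open Scope C_scope.

Definition Cexp (z : C) : C :=
  RtoC (exp (Re z)) * (cos (Im z), sin (Im z)).

(* Principal argument, in (-PI, PI] for z <> 0. *)
Definition Carg (z : C) : R :=
  if Rle_dec 0 (Im z) then acos (Re z / Cmod z) else (- acos (Re z / Cmod z))%R.

Definition Clog (z : C) : C := (ln (Cmod z), Carg z).

(* Principal power z^s, for z <> 0. *)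
Definition Cpower (z s : C) : C := Cexp (s * Clog z).

(* Sum of a complex series; meaningful only when the series converges. *)
Definition CSeries (a : nat -> C) : C :=
  iota (T := C_CompleteNormedModule) (fun l : C => is_series a l).

(* Improper integral of a complex-valued function of a real variable. *)
Definition CInt_gen (f : R -> C) (Fa Fb : (R -> Prop) -> Prop) : C :=
  RInt_gen (V := C_R_CompleteNormedModule) f Fa Fb.

(* The least n such that 0 < Re z + n. *)
Definition right_shift (z : C) : nat := Z.to_nat (up (- Re z)).

Definition Gamma_int (z : C) : C :=
  CInt_gen (fun t : R => Cpower (RtoC t) (z - 1) * RtoC (exp (- t)))
    (at_right 0) (Rbar_locally p_infty).

(* Euler's integral for Re z > 0, continued to Re z > - n by
   Gamma z = Gamma (z + 1) / z. *)
Fixpoint Gamma_cont (n : nat) (z : C) : C :=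
  match n with
  | O => Gamma_int z
  | S m => Gamma_cont m (z + 1) / z
  end.

(* At the poles 0, -1, -2, ... the value is 0, because / 0 = 0 in C. *)
Definition Gamma (z : C) : C := Gamma_cont (right_shift z) z.

Definition digamma (z : C) : C := C_derive Gamma z / Gamma z.

Definition poch (alpha : C) (n : nat) : C :=
  Gamma (alpha + RtoC (INR n)) / Gamma alpha.

Definition Cprod (l : list C) : C := fold_right Cmult (RtoC 1) l.

Definition pFq (a b : list C) (z : C) : C :=
  CSeries (fun n : nat =>
    Cprod (map (fun c => poch c n) a) / Cprod (map (fun c => poch c n) b)
    * (z ^ n / RtoC (INR (fact n)))).

Definition Gamma_upper (nu : C) (x : R) : C :=
  CInt_gen (fun t : R => Cpower (RtoC t) (nu - 1) * RtoC (exp (- t)))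
    (at_point x) (Rbar_locally p_infty).

(* For Re nu > 0 the integral is taken along the segment t = s z, 0 < s < 1. *)
Definition gamma_lower (nu z : C) : C :=
  if Rlt_dec 0 (Re nu) then
    CInt_gen
      (fun s : R => Cpower (RtoC s * z) (nu - 1) * Cexp (- (RtoC s * z)) * z)
      (at_right 0) (at_point 1)
  else
    CSeries (fun n : nat =>
      (RtoC (-1)) ^ n * Cpower z (nu + RtoC (INR n))
      / (RtoC (INR (fact n)) * (nu + RtoC (INR n)))).

Definition tricomi_int (a b : C) (x : R) : C :=
  / Gamma a *
  CInt_gen (fun t : R => RtoC (exp (- (x * t))) * Cpower (RtoC t) (a - 1)
                         * Cpower (RtoC (1 + t)) (b - a - 1))
    (at_right 0) (Rbar_locally p_infty).

(* The Laplace integral defines U (a, b, x) for Re a > 0, x > 0. Integrating it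
   by parts gives the contiguous relation
     U (a, b, x) = x U (a + 1, b + 1, x) + (a + 1 - b) U (a + 1, b, x),
   by which U is continued to Re a > - n. *)
Fixpoint tricomi_cont (n : nat) (a b : C) (x : R) : C :=
  match n with
  | O => tricomi_int a b x
  | S m => RtoC x * tricomi_cont m (a + 1) (b + 1) x
           + (a + 1 - b) * tricomi_cont m (a + 1) b x
  end.

Definition tricomiU (a b : C) (x : R) : C :=
  tricomi_cont (right_shift a) a b x.

Definition whittakerW (kappa mu : C) (x : R) : C :=
  RtoC (exp (- x / 2)) * Cpower (RtoC x) (mu + RtoC (1 / 2))
  * tricomiU (RtoC (1 / 2) + mu - kappa) (1 + 2 * mu) x.

(* Main.v *)
(* Put [a = 2 mu]. Along [kappa = 1/2 - mu] the Tricomi function is [U (a + h, a + 1 + 2 h, x)], equal to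
   [x^(-a)] at [h = 0], and the claim is that its derivative [K a] at [h = 0] satisfies
   [x^a K a + ln x = B a], where [B a] is the expression in braces. By the contiguous relation that
   continues [U], [K a = x K (a + 1) - U (a + 1, a + 1, x)] with [U (a + 1, a + 1, x) = e^x Gamma (- a, x)];
   the recurrences of the four special functions give [B] the same behaviour, so that
   [E a = x^a K a + ln x - B a] satisfies [E a = E (a + 1)]. For large [Re a],
     [E a = x^a / Gamma a * int_0^oo e^(-xt) t^(a-1) (ln (1 + t) - ln t) dt
            - x / a 2F2 (- x) - x^a Gamma (1 - a, x) sum_n x^n / (n! (a + n))],
   and [|ln (1 + t) - ln t| <= 1 / t] makes this [O (1 / Re a)] along [a, a + 1, a + 2, ...]; hence [E = 0]. *)

Require Import Defs.
From Stdlib Require Import Reals List Lra Lia Psatz ZArith.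
From Coquelicot Require Import Coquelicot.
Import ListNotations.
Local Open Scope R_scope.
Local Open Scope C_scope.

(** * The complex exponential *)

(** The integral in K a carries ln t + ln (1 + t), and x^a K a grows like psi a with Re a, so it
    cannot be estimated directly. Writing the logarithms as (ln (1 + t) - ln t) + 2 ln t isolates
    the growing part: the integral of ln t is the derivative of Gamma (a) x^(-a) and contributes 2
    (psi a - ln x), while 1 / Gamma (a) contributes - psi a. The sum psi a - 2 ln x is cancelled
    exactly by the other terms of E a. What remains is divided by Gamma (a) off the real axis, so a
    lower bound on its modulus is required. It comes from moments of t^(X-1) e^(-t), in the region 4
    (Im a)^2 <= Re a - 1, which every sequence a + n finally enters; the same bound excludes zeros
    of Gamma. Analytic continuation is replaced throughout by recurrences with unit step: an
    identity is proved in a right half-plane and carried to the left past every nonpole. In the same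
    spirit, uniqueness of bounded solutions of a first-order recurrence identifies the series of the
    lower incomplete Gamma function with its integral and yields Kummer's transformation. *)

Lemma Cexp_plus (z w : C) : Cexp (z + w) = Cexp z * Cexp w.
Proof.
  unfold Cexp; destruct z as [a b], w as [c d]; simpl.
  rewrite exp_plus, cos_plus, sin_plus.
  apply injective_projections; simpl; ring.
Qed.

Lemma Cexp_R (r : R) : Cexp (RtoC r) = RtoC (exp r).
Proof.
  unfold Cexp; simpl; rewrite cos_0, sin_0.
  apply injective_projections; simpl; ring.
Qed.

Lemma Cexp_0 : Cexp 0 = 1.
Proof. now rewrite Cexp_R, exp_0. Qed.

Lemma Cmod_minus_le (z w : C) : (Cmod (z - w) <= Cmod z + Cmod w)%R.
Proof. rewrite <- (Cmod_opp w); apply Cmod_triangle. Qed.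

Lemma Cmod_Cexp (z : C) : Cmod (Cexp z) = exp (Re z).
Proof.
  unfold Cexp; rewrite Cmod_mult, Cmod_R, Rabs_pos_eq by (left; apply exp_pos).
  unfold Cmod; cbn [fst snd].
  replace (cos (Im z) ^ 2 + sin (Im z) ^ 2)%R with 1%R.
  - rewrite sqrt_1; ring.
  - generalize (sin2_cos2 (Im z)); unfold Rsqr; intros H; ring_simplify; lra.
Qed.

Lemma Cexp_neq_0 (z : C) : Cexp z <> 0.
Proof.
  intros H; apply (f_equal Cmod) in H; rewrite Cmod_Cexp, Cmod_0 in H.
  generalize (exp_pos (Re z)); lra.
Qed.

Lemma Cexp_opp (z : C) : Cexp (- z) = / Cexp z.
Proof.
  assert (H : Cexp (- z) * Cexp z = 1).
  { rewrite <- Cexp_plus; replace (- z + z) with (RtoC 0) by ring; apply Cexp_0. }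
  rewrite <- (Cmult_1_l (/ Cexp z)), <- H; field; apply Cexp_neq_0.
Qed.

Lemma Cpower_pos (t : R) (s : C) : (0 < t)%R -> Cpower (RtoC t) s = Cexp (s * RtoC (ln t)).
Proof.
  intros Ht; unfold Cpower, Clog, Carg; f_equal; f_equal.
  rewrite Cmod_R, Rabs_pos_eq by lra; simpl.
  destruct (Rle_dec 0 0) as [_ | H]; [| lra].
  replace (t / t)%R with 1%R by (field; lra).
  now rewrite acos_1.
Qed.

(** A negative real has imaginary part 0, so [Carg] takes its nonnegative branch and returns PI:
    this is the convention (-x)^s = e^(i pi s) x^s. *)
Lemma Cpower_neg (t : R) (s : C) :
  (0 < t)%R -> Cpower (RtoC (- t)) s = Cexp (s * (ln t, PI)).
Proof.
  intros Ht; unfold Cpower, Clog, Carg; f_equal; f_equal.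
  rewrite Cmod_R, Rabs_Ropp, Rabs_pos_eq by lra; simpl.
  destruct (Rle_dec 0 0) as [_ | H]; [| lra].
  replace (- t / t)%R with (-1)%R by (field; lra).
  f_equal; replace (-1)%R with (-(1))%R by lra; rewrite acos_opp, acos_1; lra.
Qed.

Lemma is_derive_pair (u v : R -> R) (t du dv : R) :
  is_derive u t du -> is_derive v t dv ->
  is_derive (V := C_R_NormedModule) (fun s => (u s, v s) : C) t ((du, dv) : C).
Proof.
  intros Hu Hv.
  apply (is_derive_ext (V := C_R_NormedModule)
    (fun s => plus (scal (u s) ((1%R, 0%R) : C_R_NormedModule)) (scal (v s) ((0%R, 1%R) : C_R_NormedModule)))).
  - intros s; apply injective_projections; unfold plus, scal; simpl;
      unfold plus, scal, mult; simpl; unfold mult; simpl; ring.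
  - replace ((du, dv) : C_R_NormedModule) with
      (plus (scal du ((1%R, 0%R) : C_R_NormedModule)) (scal dv ((0%R, 1%R) : C_R_NormedModule))).
    + apply (is_derive_plus (V := C_R_NormedModule)); apply (is_derive_scal_l (V := C_R_NormedModule)); assumption.
    + apply injective_projections; unfold plus, scal; simpl;
      unfold plus, scal, mult; simpl; unfold mult; simpl; ring.
Qed.

Lemma is_derive_Cexp (u v : R -> R) (t du dv : R) :
  is_derive u t du -> is_derive v t dv ->
  is_derive (V := C_R_NormedModule) (fun s => Cexp (u s, v s)) t ((du, dv) * Cexp (u t, v t)).
Proof.
  intros Hu Hv.
  apply (is_derive_ext (V := C_R_NormedModule)
    (fun s => ((exp (u s) * cos (v s))%R, (exp (u s) * sin (v s))%R) : C)).
  - intros s; unfold Cexp; apply injective_projections; simpl; ring.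
  - replace ((du, dv) * Cexp (u t, v t)) with
      (((du * exp (u t) * cos (v t) - exp (u t) * (dv * sin (v t)))%R,
        (du * exp (u t) * sin (v t) + exp (u t) * (dv * cos (v t)))%R) : C).
    + assert (eu : ex_derive u t) by (eexists; eassumption).
      assert (ev : ex_derive v t) by (eexists; eassumption).
      apply is_derive_pair; auto_derive; try tauto;
      change (fun x => u x) with u; change (fun x => v x) with v;
      rewrite (is_derive_unique u t du Hu), (is_derive_unique v t dv Hv); ring.
    + unfold Cexp; apply injective_projections; simpl; ring.
Qed.

Lemma norm_C_R (v : C) : norm (v : C_R_NormedModule) = Cmod v.
Proof.
  change (sqrt (Rabs (fst v) ^ 2 + Rabs (snd v) ^ 2) = Cmod v).
  now rewrite !pow2_abs.
Qed.

(** Multiplication by a constant, the embedding of R and the real part are all handled as bounded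
    real-linear maps; one transport lemma for derivatives and one for integrals then serve the three
    of them. *)
Lemma is_linear_Cmult_l (c : C) :
  is_linear (U := C_R_NormedModule) (V := C_R_NormedModule) (fun v : C => c * v).
Proof.
  split.
  - intros u v; apply (Cmult_plus_distr_l c u v).
  - intros k v; destruct c, v; apply injective_projections; unfold scal; simpl;
    unfold scal; simpl; unfold mult; simpl; ring.
  (* The operator bound must be strictly positive, and c may be 0. *)
  - exists (Cmod c + 1)%R; split; [generalize (Cmod_ge_0 c); lra |].
    intros v; rewrite !norm_C_R.
    rewrite Cmod_mult; generalize (Cmod_ge_0 v); nra.
Qed.

Lemma is_linear_RtoC :
  is_linear (U := R_NormedModule) (V := C_R_NormedModule) RtoC.
Proof.
  split.
  - intros u v; apply RtoC_plus.
  - intros k v; apply injective_projections; unfold scal; simpl;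
    unfold scal; simpl; unfold mult; simpl; ring.
  - exists 1%R; split; [lra |]; intros v.
    rewrite norm_C_R, Cmod_R; change (Rabs v <= 1 * Rabs v)%R; lra.
Qed.

Lemma is_linear_Re :
  is_linear (U := C_R_NormedModule) (V := R_NormedModule) Re.
Proof.
  split.
  - reflexivity.
  - reflexivity.
  - exists 1%R; split; [lra |]; intros v.
    rewrite norm_C_R; change (Rabs (Re v) <= 1 * Cmod v)%R; generalize (re_le_Cmod v); lra.
Qed.

Lemma is_derive_linear (V W : NormedModule R_AbsRing) (L : V -> W) (f : R -> V) (t : R) (l : V) :
  is_linear L -> is_derive f t l -> is_derive (fun s => L (f s)) t (L l).
Proof.
  intros HL Hf.
  generalize (filterdiff_comp f L (fun y : R => scal y l) L Hf
    (filterdiff_linear L HL)).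
  intros H; apply (filterdiff_ext_lin _ _ _ H).
  intros y; apply (linear_scal L HL).
Qed.

Lemma is_derive_continuous (V : NormedModule R_AbsRing) (f : R -> V) (t : R) (l : V) :
  is_derive f t l -> continuous f t.
Proof. intros H; apply ex_derive_continuous; now exists l. Qed.

(** A mean value inequality for complex values, where no intermediate point exists; it follows by
    integrating the derivative over the unit segment. *)
Lemma Cmod_increment (g dg : R -> C) (M : R) :
  (forall s, 0 <= s <= 1 -> is_derive (V := C_R_NormedModule) g s (dg s) /\
     continuous (U := C_R_NormedModule) dg s /\ Cmod (dg s) <= M)%R ->
  (Cmod (g 1%R - g 0%R) <= M)%R.
Proof.
  intros H.
  assert (HI : is_RInt (V := C_R_CompleteNormedModule) dg 0 1 (minus (g 1%R : C_R_NormedModule) (g 0%R))).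
  { apply (is_RInt_derive (V := C_R_CompleteNormedModule) g dg);
    rewrite Rmin_left, Rmax_right by lra; intros s Hs; apply H, Hs. }
  apply (norm_RInt_le_const (V := C_R_NormedModule) _ _ _ _ M) in HI; [| lra | intros s Hs; rewrite norm_C_R; apply (H s Hs)].
  rewrite norm_C_R in HI; change (Cmod (g 1%R - g 0%R) <= (1 - 0) * M)%R in HI; lra.
Qed.

Lemma Cexp_segment (z : C) (s : R) :
  is_derive (V := C_R_NormedModule) (fun s : R => Cexp (RtoC s * z)) s (z * Cexp (RtoC s * z)).
Proof.
  destruct z as [a b].
  apply (is_derive_ext (V := C_R_NormedModule) (fun s : R => Cexp (s * a, s * b)%R)).
  - intros t; f_equal; apply injective_projections; simpl; ring.
  - replace (RtoC s * (a, b)) with ((s * a, s * b)%R : C) by (apply injective_projections; simpl; ring).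
    apply (is_derive_Cexp (fun s => s * a)%R (fun s => s * b)%R s a b); auto_derive; auto; ring.
Qed.

Lemma Cmod_Cexp_segment_le (z : C) (s : R) :
  (0 <= s <= 1)%R -> (Cmod (Cexp (RtoC s * z)) <= exp (Cmod z))%R.
Proof.
  intros Hs; rewrite Cmod_Cexp.
  replace (Re (RtoC s * z)) with (s * Re z)%R by (destruct z; simpl; ring).
  generalize (re_le_Cmod z) (Rle_abs (Re z)) (Cmod_ge_0 z); intros.
  destruct (Rle_lt_or_eq_dec (s * Re z) (Cmod z)) as [Hl | ->]; [nra | | lra].
  left; now apply exp_increasing.
Qed.

Lemma Cmod_Cexp_minus_1 (z : C) : (Cmod (Cexp z - 1) <= Cmod z * exp (Cmod z))%R.
Proof.
  generalize (Cmod_increment (fun s : R => Cexp (RtoC s * z)) (fun s : R => z * Cexp (RtoC s * z))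
    (Cmod z * exp (Cmod z))); cbv beta.
  rewrite Cmult_1_l, Cmult_0_l, Cexp_0; intros H; apply H; clear H.
  intros s Hs; split; [apply Cexp_segment | split].
  - apply (is_derive_continuous C_R_NormedModule) with (z * (z * Cexp (RtoC s * z))).
    apply (is_derive_linear C_R_NormedModule C_R_NormedModule (fun v : C => z * v)).
    + apply is_linear_Cmult_l.
    + apply Cexp_segment.
  - rewrite Cmod_mult; apply Rmult_le_compat_l; [apply Cmod_ge_0 |].
    now apply Cmod_Cexp_segment_le.
Qed.

(** The derivative of e^(sz) - s z in s is z (e^(sz) - 1), so the first-order bound above gives the
    second-order one. This remainder is the source of every complex derivative of an exponential or
    of an integral below. *)
Lemma Cmod_Cexp_minus_1_minus_id (z : C) :
  (Cmod (Cexp z - 1 - z) <= Cmod z ^ 2 * exp (Cmod z))%R.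
Proof.
  generalize (Cmod_increment (fun s : R => Cexp (RtoC s * z) - RtoC s * z)
    (fun s : R => z * (Cexp (RtoC s * z) - 1))
    (Cmod z ^ 2 * exp (Cmod z))); cbv beta.
  rewrite Cmult_1_l, Cmult_0_l, Cexp_0; intros H.
  replace (Cexp z - 1 - z) with (Cexp z - z - (1 - 0)) by ring; apply H; clear H.
  assert (HL : forall s : R, is_derive (V := C_R_NormedModule) (fun s : R => RtoC s * z) s z).
  { intros s; apply (is_derive_ext (V := C_R_NormedModule) (fun s : R => z * RtoC s)).
    - intros t; apply Cmult_comm.
    - cut (is_derive (V := C_R_NormedModule) (fun s : R => z * RtoC s) s (z * RtoC 1)).
      { now rewrite Cmult_1_r. }
      apply (is_derive_linear C_R_NormedModule C_R_NormedModule (fun v : C => z * v)); [apply is_linear_Cmult_l |].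
      apply (is_derive_linear R_NormedModule C_R_NormedModule RtoC); [apply is_linear_RtoC |].
      apply (is_derive_id (K := R_AbsRing)). }
  assert (HE := Cexp_segment z).
  intros s Hs; split; [| split].
  - replace (z * (Cexp (RtoC s * z) - 1)) with (z * Cexp (RtoC s * z) - z) by ring.
    apply (is_derive_minus (V := C_R_NormedModule)); auto.
  - apply (is_derive_continuous C_R_NormedModule) with (z * (z * Cexp (RtoC s * z) - 0)).
    apply (is_derive_linear C_R_NormedModule C_R_NormedModule (fun v : C => z * v)); [apply is_linear_Cmult_l |].
    apply (is_derive_minus (V := C_R_NormedModule)); [auto | apply (is_derive_const (V := C_R_NormedModule))].
  - rewrite Cmod_mult.
    generalize (Cmod_Cexp_minus_1 (RtoC s * z)); rewrite Cmod_mult, Cmod_R, (Rabs_pos_eq s) by lra.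
    intros H1.
    assert (exp (s * Cmod z) <= exp (Cmod z))%R.
    { destruct (Rle_lt_or_eq_dec (s * Cmod z) (Cmod z)) as [Hl | ->]; [| | lra].
      - generalize (Cmod_ge_0 z); nra.
      - left; now apply exp_increasing. }
    assert (s * Cmod z * exp (s * Cmod z) <= Cmod z * exp (Cmod z))%R.
    { generalize (Cmod_ge_0 z) (exp_pos (s * Cmod z)); intros.
      apply Rmult_le_compat; nra. }
    generalize (Cmod_ge_0 z); intros; nra.
Qed.

(** * Improper integrals of complex-valued functions *)

Lemma Riemann_sum_linear (V W : NormedModule R_AbsRing) (L : V -> W) (f : R -> V) (p : SF_seq) :
  is_linear L -> Riemann_sum (fun t => L (f t)) p = L (Riemann_sum f p).
Proof.
  intros HL.
  assert (H0 : L zero = zero).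
  { transitivity (L (scal (@zero R_AbsRing) (zero : V))).
    - f_equal; symmetry; apply (scal_zero_l (zero : V)).
    - rewrite (linear_scal L HL); apply (scal_zero_l (L zero)). }
  unfold Riemann_sum; 
  match goal with |- context [seq.pairmap _ ?x _] => generalize x end.
  induction (SF_t p) as [| h l IH]; intros x0; simpl.
  - symmetry; exact H0.
  - rewrite IH; symmetry; etransitivity; [apply (linear_plus L HL) |].
    f_equal; apply (linear_scal L HL).
Qed.

(** An integral is a limit of Riemann sums; a linear map commutes with the sums and, being
    continuous, with the limit. *)
Lemma is_RInt_linear (V W : NormedModule R_AbsRing) (L : V -> W) (f : R -> V) (a b : R) (l : V) :
  is_linear L -> is_RInt f a b l -> is_RInt (fun t => L (f t)) a b (L l).
Proof.
  intros HL Hf.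
  apply (filterlim_ext (fun p => L (scal (sign (b - a)) (Riemann_sum f p)))).
  - intros p; rewrite (linear_scal L HL); f_equal; symmetry; now apply Riemann_sum_linear.
  - apply (filterlim_comp _ _ _ _ L _ (locally l)); [exact Hf |].
    apply (linear_cont L l HL).
Qed.

Lemma is_RInt_gen_linear (V W : NormedModule R_AbsRing) (L : V -> W) (f : R -> V)
  (Fa Fb : (R -> Prop) -> Prop) {FFa : Filter Fa} {FFb : Filter Fb} (l : V) :
  is_linear L -> is_RInt_gen f Fa Fb l -> is_RInt_gen (fun t => L (f t)) Fa Fb (L l).
Proof.
  intros HL Hf P HP.
  assert (HP' : locally l (fun y => P (L y))) by (apply (linear_cont L l HL), HP).
  specialize (Hf _ HP'); unfold filtermapi in *; revert Hf; apply filter_imp.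
  intros ab [y [Hy Py]]; exists (L y); split; [now apply is_RInt_linear | exact Py].
Qed.

Notation RIntC := (RInt (V := C_R_CompleteNormedModule)).

(** Order-convexity, stated with [Rmin] and [Rmax] because endpoints drawn from two filters come in
    no fixed order. *)
Definition interval (D : R -> Prop) : Prop :=
  forall a b t : R, D a -> D b -> (Rmin a b <= t <= Rmax a b)%R -> D t.

Lemma filter_prod_domain (D : R -> Prop) (Fa Fb : (R -> Prop) -> Prop) (P : R * R -> Prop) :
  Fa D -> Fb D -> (forall a b, D a -> D b -> P (a, b)) -> filter_prod Fa Fb P.
Proof. intros; now exists D D. Qed.

Lemma is_RInt_gen_antiderivative (V : CompleteNormedModule R_AbsRing) (G g : R -> V) (D : R -> Prop)
  (Fa Fb : (R -> Prop) -> Prop) {FFa : Filter Fa} {FFb : Filter Fb} (la lb : V) :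
  interval D -> Fa D -> Fb D ->
  (forall t, D t -> is_derive G t (g t) /\ continuous g t) ->
  filterlim G Fa (locally la) -> filterlim G Fb (locally lb) ->
  is_RInt_gen g Fa Fb (minus lb la).
Proof.
  intros HD Da Db HG Ga Gb P HP.
  assert (HL : filterlim (fun ab : R * R => minus (G (snd ab)) (G (fst ab)))
    (filter_prod Fa Fb) (locally (minus lb la))).
  { apply (filterlim_comp_2 (G := locally lb) (H := locally (opp la))
      (fun ab : R * R => G (snd ab)) (fun ab : R * R => opp (G (fst ab))) (fun u v : V => plus u v)).
    - apply (filterlim_comp _ _ _ snd G _ Fb); [apply filterlim_snd | exact Gb].
    - apply (filterlim_comp _ _ _ (fun ab : R * R => G (fst ab)) opp _ (locally la) (locally (opp la))).
      + apply (filterlim_comp _ _ _ fst G _ Fa); [apply filterlim_fst | exact Ga].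
      + apply (filterlim_opp (K := R_AbsRing) (V := V) la).
    - apply (filterlim_plus (K := R_AbsRing) (V := V) lb (opp la)). }
  assert (HDD : filter_prod Fa Fb (fun ab => D (fst ab) /\ D (snd ab))).
  { apply filter_prod_domain with D; auto. }
  specialize (HL P HP); unfold filtermap in HL; generalize (filter_and _ _ HL HDD); unfold filtermapi; apply filter_imp.
  intros [a b] [Hp [Ha Hb]]; simpl in *; eexists; split; [| exact Hp].
  apply is_RInt_derive; intros t Ht; apply HG, (HD a b); auto.
Qed.

(** * Improper integrals dominated by a function with a convergent antiderivative *)

Section Domination.

Variables (f : R -> C) (phi Phi : R -> R) (D : R -> Prop) (Fa Fb : (R -> Prop) -> Prop).
Context {FFa : ProperFilter Fa} {FFb : ProperFilter Fb}.
Variables (la lb : R).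
Hypotheses (HD : interval D) (Da : Fa D) (Db : Fb D).
Hypothesis Hf : forall t, D t -> continuous (U := C_R_NormedModule) f t.
Hypothesis HPhi : forall t, D t -> is_derive Phi t (phi t) /\ continuous phi t.
Hypothesis Hdom : forall t, D t -> (Cmod (f t) <= phi t)%R.
Hypotheses (Ha : filterlim Phi Fa (locally la)) (Hb : filterlim Phi Fb (locally lb)).

Lemma ex_RInt_domain (a b : R) : D a -> D b -> ex_RInt (V := C_R_CompleteNormedModule) f a b.
Proof.
  intros Da' Db'; apply (ex_RInt_continuous (V := C_R_CompleteNormedModule)).
  intros t Ht; apply Hf, (HD a b); auto.
Qed.

Lemma Cmod_RInt_le (a b : R) :
  D a -> D b -> (Cmod (RIntC f a b) <= Rabs (Phi b - Phi a))%R.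
Proof.
  assert (H : forall a b, (a <= b)%R -> D a -> D b ->
    (Cmod (RIntC f a b) <= Rabs (Phi b - Phi a))%R).
  { clear a b; intros a b Hab Da' Db'.
    apply Rle_trans with (Phi b - Phi a)%R; [| apply Rle_abs].
    rewrite <- norm_C_R.
    apply (norm_RInt_le (V := C_R_NormedModule) f phi a b); auto.
    - intros t Ht; rewrite norm_C_R; apply Hdom, (HD a b); auto; now rewrite Rmin_left, Rmax_right by lra.
    - apply (RInt_correct (V := C_R_CompleteNormedModule)), ex_RInt_domain; auto.
    - apply (is_RInt_derive (V := R_CompleteNormedModule)); intros t Ht; apply HPhi, (HD a b); auto. }
  intros Da' Db'; destruct (Rle_dec a b) as [Hab | Hab]; [now apply H |].
  rewrite <- (opp_RInt_swap (V := C_R_CompleteNormedModule)) by (apply ex_RInt_domain; auto).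
  change (Cmod (- RIntC f b a) <= Rabs (Phi b - Phi a))%R.
  rewrite Cmod_opp, Rabs_minus_sym; apply H; auto; lra.
Qed.

(** Moves the comparison of two partial integrals to the two end pieces, where [Phi] varies
    little. *)
Lemma RInt_Chasles_domain (a b c d : R) : D a -> D b -> D c -> D d ->
  RIntC f c d - RIntC f a b
  = RIntC f b d - RIntC f a c.
Proof.
  intros Da' Db' Dc Dd.
  generalize (RInt_Chasles (V := C_R_CompleteNormedModule) f a b d); intros H1.
  generalize (RInt_Chasles (V := C_R_CompleteNormedModule) f a c d); intros H2.
  specialize (H1 (ex_RInt_domain a b Da' Db') (ex_RInt_domain b d Db' Dd)).
  specialize (H2 (ex_RInt_domain a c Da' Dc) (ex_RInt_domain c d Dc Dd)).
  rewrite <- H1 in H2.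
  change (RIntC f a c + RIntC f c d =
    RIntC f a b + RIntC f b d) in H2.
  rewrite <- (Cplus_0_r (RIntC f c d - _)), <- (Cplus_opp_r (RIntC f a c)).
  replace (RIntC f c d - RIntC f a b + (RIntC f a c + - RIntC f a c)) with
    (RIntC f a c + RIntC f c d - RIntC f a b - RIntC f a c) by ring.
  rewrite H2; ring.
Qed.

(** The partial integrals are Cauchy along the product filter: two of them differ by integrals over
    end pieces, each bounded by an increment of [Phi], which converges at both ends. *)
Lemma ex_RInt_gen_dominated : ex_RInt_gen (V := C_R_NormedModule) f Fa Fb.
Proof.
  destruct (proj1 (filterlim_locally_cauchy (U := C_R_CompleteNormedModule) (F := filter_prod Fa Fb)
    (fun ab => RIntC f (fst ab) (snd ab)))) as [l Hl].
  - intros eps.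
    assert (Hb2 : forall (F : (R -> Prop) -> Prop) (l : R), ProperFilter F -> filterlim Phi F (locally l) -> F D ->
      F (fun t => D t /\ Rabs (Phi t - l) < eps / 4)%R).
    { intros F l FF HF HFD; apply filter_and; [exact HFD |].
      (* Two end pieces, each with two endpoints within eps / 4 of the limit of [Phi]. *)
      assert (He : (0 < eps / 4)%R) by (destruct eps; simpl; lra).
      apply (HF (fun y => Rabs (y - l) < eps / 4)%R); now exists (mkposreal _ He). }
    exists (fun ab => (D (fst ab) /\ Rabs (Phi (fst ab) - la) < eps / 4)%R /\
                      (D (snd ab) /\ Rabs (Phi (snd ab) - lb) < eps / 4)%R); split.
    + exists (fun t => D t /\ Rabs (Phi t - la) < eps / 4)%R (fun t => D t /\ Rabs (Phi t - lb) < eps / 4)%R; [now apply Hb2 | now apply Hb2 | auto].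
    + intros [a b] [c d] [[H1 H2] [H3 H4]] [[H5 H6] [H7 H8]]; simpl in *.
      apply (norm_compat1 (V := C_R_NormedModule)).
      rewrite norm_C_R.
      change (Cmod (RIntC f c d - RIntC f a b) < eps)%R.
      rewrite RInt_Chasles_domain by auto.
      generalize (Cmod_RInt_le b d H3 H7) (Cmod_RInt_le a c H1 H5); intros B1 B2.
      unfold Cminus; eapply Rle_lt_trans; [apply Cmod_triangle |]; rewrite Cmod_opp.
      split_Rabs; lra.
  - exists l; intros P HP; specialize (Hl P HP); unfold filtermap in Hl.
    assert (HDD : filter_prod Fa Fb (fun ab => D (fst ab) /\ D (snd ab))).
    { apply filter_prod_domain with D; auto. }
    generalize (filter_and _ _ Hl HDD); unfold filtermapi; apply filter_imp.
    intros [a b] [Hp [Ha' Hb']]; eexists; split; [| exact Hp].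
    apply (RInt_correct (V := C_R_CompleteNormedModule)), ex_RInt_domain; auto.
Qed.

Lemma Cmod_RInt_gen_le (l : C) :
  is_RInt_gen (V := C_R_NormedModule) f Fa Fb l -> (Cmod l <= Rabs (lb - la))%R.
Proof.
  intros Hl; apply Rnot_lt_le; intros Hlt.
  (* Three errors add up, one from the partial integral and one from [Phi] at each end, so a quarter
     of the gap is small enough for a contradiction. *)
  set (eps := ((Cmod l - Rabs (lb - la)) / 4)%R).
  assert (He : (0 < eps)%R) by (unfold eps; lra).
  assert (H1 : filter_prod Fa Fb (fun ab => exists y, is_RInt (V := C_R_NormedModule) f (fst ab) (snd ab) y /\ (Cmod (y - l) < eps)%R)).
  { apply (Hl (fun y => Cmod (y - l) < eps)%R).
    destruct (locally_ball_norm (V := C_R_NormedModule) l (mkposreal _ He)) as [d Hd].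
    exists d; intros y Hy; rewrite <- norm_C_R; exact (Hd y Hy). }
  assert (H2 : forall (F : (R -> Prop) -> Prop) (l : R), ProperFilter F -> filterlim Phi F (locally l) -> F D ->
      F (fun t => D t /\ Rabs (Phi t - l) < eps)%R).
  { intros F l0 FF HF HFD; apply filter_and; [exact HFD |].
    apply (HF (fun y => Rabs (y - l0) < eps)%R); now exists (mkposreal _ He). }
  assert (H3 : filter_prod Fa Fb (fun ab => (D (fst ab) /\ Rabs (Phi (fst ab) - la) < eps)%R /\
                      (D (snd ab) /\ Rabs (Phi (snd ab) - lb) < eps)%R)).
  { exists (fun t => D t /\ Rabs (Phi t - la) < eps)%R (fun t => D t /\ Rabs (Phi t - lb) < eps)%R; [now apply H2 | now apply H2 | auto]. }
  destruct (filter_ex _ (filter_and _ _ H1 H3)) as [[a b] [[y [Hy Hyl]] [[Da' B1] [Db' B2]]]]; simpl in *.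
  apply (is_RInt_unique (V := C_R_CompleteNormedModule)) in Hy.
  generalize (Cmod_RInt_le a b Da' Db'); rewrite Hy; intros B3.
  assert (B4 : (Cmod l <= Cmod y + Cmod (y - l))%R).
  { replace l with (y + - (y - l)) at 1 by ring; rewrite <- (Cmod_opp (y - l)); apply Cmod_triangle. }
  unfold eps in *; split_Rabs; lra.
Qed.

End Domination.

Notation IntC f l :=
  (is_RInt_gen (V := C_R_NormedModule) f (at_right 0) (Rbar_locally p_infty) l).

Lemma interval_pos : interval (fun t => 0 < t)%R.
Proof. intros a b t Ha Hb [H _]; revert H; unfold Rmin; destruct Rle_dec; lra. Qed.

Lemma at_right_pos : at_right 0 (fun t => 0 < t)%R.
Proof. exists (mkposreal 1 Rlt_0_1); auto. Qed.

Lemma infty_pos : Rbar_locally p_infty (fun t => 0 < t)%R.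
Proof. exists 0%R; auto. Qed.

Lemma IntC_ext (f g : R -> C) (l : C) :
  (forall t, (0 < t)%R -> f t = g t) -> IntC f l -> IntC g l.
Proof.
  intros H; apply is_RInt_gen_ext.
  apply filter_prod_domain with (fun t => 0 < t)%R; [apply at_right_pos | apply infty_pos |].
  intros a b Ha Hb t Ht; apply H, (interval_pos a b); simpl in *; auto; lra.
Qed.

Lemma IntC_plus (f g : R -> C) (k l : C) :
  IntC f k -> IntC g l -> IntC (fun t => f t + g t) (k + l).
Proof. apply (is_RInt_gen_plus (V := C_R_NormedModule)). Qed.

Lemma IntC_minus (f g : R -> C) (k l : C) :
  IntC f k -> IntC g l -> IntC (fun t => f t - g t) (k - l).
Proof. apply (is_RInt_gen_minus (V := C_R_NormedModule)). Qed.

Lemma is_RInt_gen_C_unique {Fa Fb : (R -> Prop) -> Prop} {FFa : ProperFilter' Fa} {FFb : ProperFilter' Fb}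
  (f : R -> C) (k l : C) :
  is_RInt_gen (V := C_R_NormedModule) f Fa Fb k -> is_RInt_gen (V := C_R_NormedModule) f Fa Fb l -> k = l.
Proof.
  intros Hk Hl.
  rewrite <- (is_RInt_gen_unique (V := C_R_CompleteNormedModule) f k Hk).
  apply (is_RInt_gen_unique (V := C_R_CompleteNormedModule) f l Hl).
Qed.

Lemma is_RInt_gen_Cmult_l {Fa Fb : (R -> Prop) -> Prop} {FFa : Filter Fa} {FFb : Filter Fb}
  (c : C) (f : R -> C) (k : C) :
  is_RInt_gen (V := C_R_NormedModule) f Fa Fb k ->
  is_RInt_gen (V := C_R_NormedModule) (fun t => c * f t) Fa Fb (c * k).
Proof.
  apply (is_RInt_gen_linear C_R_NormedModule C_R_NormedModule (fun v : C => c * v));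
    try typeclasses eauto; apply is_linear_Cmult_l.
Qed.

Lemma IntC_scal (c : C) (f : R -> C) (k : C) :
  IntC f k -> IntC (fun t => c * f t) (c * k).
Proof. apply is_RInt_gen_Cmult_l. Qed.

(** The majorant is the real part of a complex integrand, so that it can itself be a Laplace
    integral whose value is known. *)
Lemma IntC_Cmod_le (f g : R -> C) (k l : C) :
  (forall t, (0 < t)%R -> (Cmod (f t) <= Re (g t))%R) -> IntC f k -> IntC g l -> (Cmod k <= Re l)%R.
Proof.
  intros H Hf Hg; rewrite <- norm_C_R.
  apply (RInt_gen_norm (V := C_R_CompleteNormedModule) (Fa := at_right 0) (Fb := Rbar_locally p_infty)
    f (fun t => Re (g t))); [| | exact Hf |].
  (* Separating the endpoints at 1 makes the partial integrals run in the increasing direction. *)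
  - exists (fun t => t < 1)%R (fun t => 1 < t)%R.
    + exists (mkposreal 1 Rlt_0_1); intros y Hy _; apply Rabs_def2 in Hy;
      unfold minus, plus, opp in Hy; simpl in Hy; lra.
    + now exists 1%R.
    + simpl; intros; lra.
  - apply filter_prod_domain with (fun t => 0 < t)%R; [apply at_right_pos | apply infty_pos |].
    simpl; intros a b Ha Hb t Ht; rewrite norm_C_R; apply H; lra.
  - apply (is_RInt_gen_linear C_R_NormedModule R_NormedModule Re);
      try typeclasses eauto; [apply is_linear_Re | exact Hg].
Qed.

(** * Majorants on (0, oo) *)

Lemma ln_le_affine (u c : R) : (0 < u)%R -> (0 < c)%R -> (ln u <= u / c + ln c - 1)%R.
Proof.
  intros Hu Hc.
  assert (H : (0 < u / c)%R) by (apply Rdiv_lt_0_compat; auto).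
  replace (ln u) with (ln (u / c) + ln c)%R.
  - generalize (exp_ineq1_le (ln (u / c))); rewrite exp_ln by auto; lra.
  - rewrite <- ln_mult by auto; f_equal; field; lra.
Qed.

Lemma exp_le_exp (u v : R) : (u <= v)%R -> (exp u <= exp v)%R.
Proof. intros [H | ->]; [left; now apply exp_increasing | apply Rle_refl]. Qed.

Lemma ln_1p_pos (t : R) : (0 < t)%R -> (0 < ln (1 + t))%R.
Proof. intros; rewrite <- ln_1; apply ln_increasing; lra. Qed.

(** With r = |b| + 1, the tangent of ln at r / c bounds r ln (1 + t) by a line of slope exactly c,
    which cancels - c t and leaves a constant. *)
Lemma exp_ln_1p_bounded (b c : R) : (0 < c)%R ->
  exists M, (0 < M)%R /\ forall t, (0 < t)%R -> (exp (b * ln (1 + t) - c * t) <= M)%R.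
Proof.
  intros Hc; set (r := (Rabs b + 1)%R).
  assert (Hr : (0 < r)%R) by (unfold r; generalize (Rabs_pos b); lra).
  assert (Hrc : (0 < r / c)%R) by (apply Rdiv_lt_0_compat; auto).
  exists (exp (c + r * (ln (r / c) - 1))); split; [apply exp_pos |].
  intros t Ht; apply exp_le_exp.
  assert (H := ln_le_affine (1 + t) (r / c) ltac:(lra) Hrc).
  assert (H1 := ln_1p_pos t Ht).
  assert (b * ln (1 + t) <= r * ln (1 + t))%R.
  { apply Rmult_le_compat_r; [lra |]; unfold r; generalize (Rle_abs b); lra. }
  assert (r * ln (1 + t) <= r * ((1 + t) / (r / c) + ln (r / c) - 1))%R by (apply Rmult_le_compat_l; lra).
  replace (r * ((1 + t) / (r / c) + ln (r / c) - 1))%R with (c + c * t + r * (ln (r / c) - 1))%R in H2; [lra |].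
  field; lra.
Qed.

(* [-1 / (1 + t^p)], a bounded antiderivative of a multiple of [t^(p-1)] near 0. *)
Definition envelope (p t : R) : R := (- / (1 + exp (p * ln t)))%R.
Definition envelope' (p t : R) : R := (p * exp ((p - 1) * ln t) / (1 + exp (p * ln t)) ^ 2)%R.

Lemma envelope_derive (p t : R) : (0 < t)%R ->
  is_derive (envelope p) t (envelope' p t) /\ continuous (envelope' p) t.
Proof.
  intros Ht; assert (He := exp_pos (p * ln t)); split.
  - unfold envelope, envelope'; auto_derive; [lra |].
    replace ((p - 1) * ln t)%R with (p * ln t + - ln t)%R by ring.
    rewrite exp_plus, exp_Ropp, exp_ln by auto; field; lra.
  - apply (ex_derive_continuous (V := R_NormedModule)); unfold envelope'; auto_derive; nra.
Qed.

Lemma exp_mult_ln_at_0 (p : R) : (0 < p)%R ->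
  filterlim (fun t => exp (p * ln t))%R (at_right 0) (locally 0%R).
Proof.
  intros Hp P [eps HP]; exists (mkposreal _ (exp_pos (ln eps / p))); intros t Ht Ht0.
  apply HP; change (Rabs (exp (p * ln t) - 0) < eps)%R.
  apply Rabs_def2 in Ht; unfold minus, plus, opp in Ht; simpl in Ht.
  rewrite Rminus_0_r, Rabs_pos_eq by (left; apply exp_pos).
  assert (Heps := cond_pos eps).
  rewrite <- (exp_ln eps) by apply cond_pos; apply exp_increasing.
  apply (Rmult_lt_reg_r (/ p)); [now apply Rinv_0_lt_compat |].
  replace (p * ln t * / p)%R with (ln t) by (field; lra).
  rewrite <- (ln_exp (ln eps * / p)); apply ln_increasing; auto; unfold Rdiv in Ht; lra.
Qed.

Lemma envelope_at_0 (p : R) : (0 < p)%R ->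
  filterlim (envelope p) (at_right 0) (locally (-1)%R).
Proof.
  intros Hp; unfold envelope.
  apply (filterlim_comp _ _ _ (fun t => exp (p * ln t))%R (fun u => - / (1 + u))%R _ (locally 0%R)).
  - now apply exp_mult_ln_at_0.
  - replace (-1)%R with (- / (1 + 0))%R by field.
    apply (ex_derive_continuous (V := R_NormedModule) (fun u => - / (1 + u))%R); auto_derive; lra.
Qed.

Lemma envelope_at_infty (p : R) : (0 < p)%R ->
  filterlim (envelope p) (Rbar_locally p_infty) (locally 0%R).
Proof.
  intros Hp P [eps HP]; exists (exp (- ln eps / p)); intros t Ht.
  apply HP; change (Rabs (envelope p t - 0) < eps)%R; unfold envelope.
  assert (He := exp_pos (p * ln t)).
  rewrite Rminus_0_r, Rabs_Ropp, Rabs_pos_eq by (left; apply Rinv_0_lt_compat; lra).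
  assert (H : (/ eps < exp (p * ln t))%R).
  { rewrite <- (exp_ln (/ eps)), ln_Rinv by (try apply Rinv_0_lt_compat; apply cond_pos).
    apply exp_increasing, (Rmult_lt_reg_r (/ p)); [now apply Rinv_0_lt_compat |].
    replace (p * ln t * / p)%R with (ln t) by (field; lra).
    rewrite <- (ln_exp (- ln eps * / p)); apply ln_increasing; auto; apply exp_pos. }
  rewrite <- (Rinv_inv eps); apply Rinv_lt_contravar; [| lra].
  apply Rmult_lt_0_compat; [apply Rinv_0_lt_compat, cond_pos | lra].
Qed.

(** t^p (1 + t)^q e^(-ct) as one exponential, so that products and comparisons reduce to the
    exponents. *)
Definition weight (p q c t : R) : R := exp (p * ln t + q * ln (1 + t) - c * t).

(** Dividing by [envelope' p] leaves the factor (1 + t^p)^2, at most 4 (1 + t)^(2p); hence the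
    exponent q + 2 p, which the exponential decay absorbs. *)
Lemma weight_envelope (p q c : R) : (0 < p)%R -> (0 < c)%R ->
  exists M, (0 < M)%R /\ forall t, (0 < t)%R -> (weight (p - 1) q c t <= M * envelope' p t)%R.
Proof.
  intros Hp Hc; destruct (exp_ln_1p_bounded (q + 2 * p) c Hc) as [M [HM H]].
  exists (4 * M / p)%R; split; [apply Rdiv_lt_0_compat; lra |].
  intros t Ht; specialize (H t Ht).
  set (T := exp (p * ln t)); set (S := exp (p * ln (1 + t))).
  assert (HT : (0 < T)%R) by apply exp_pos.
  assert (HTS : (T <= S)%R).
  { apply exp_le_exp, Rmult_le_compat_l; [lra |]; left; apply ln_increasing; lra. }
  assert (HS : (1 <= S)%R).
  { rewrite <- exp_0; apply exp_le_exp; generalize (ln_1p_pos t Ht); nra. }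
  unfold weight, envelope'; fold T.
  replace (4 * M / p * (p * exp ((p - 1) * ln t) / (1 + T) ^ 2))%R
    with (exp ((p - 1) * ln t) * (4 * M / (1 + T) ^ 2))%R by (field; lra).
  replace ((p - 1) * ln t + q * ln (1 + t) - c * t)%R with
    ((p - 1) * ln t + (q * ln (1 + t) - c * t))%R by ring.
  rewrite exp_plus; apply Rmult_le_compat_l; [left; apply exp_pos |].
  apply (Rmult_le_reg_r ((1 + T) ^ 2)); [nra |].
  replace (4 * M / (1 + T) ^ 2 * (1 + T) ^ 2)%R with (4 * M)%R by (field; nra).
  replace ((q + 2 * p) * ln (1 + t) - c * t)%R with
    (q * ln (1 + t) - c * t + (p * ln (1 + t) + p * ln (1 + t)))%R in H by ring.
  rewrite !exp_plus in H; fold S in H.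
  assert (He := exp_pos (q * ln (1 + t) - c * t)).
  apply Rle_trans with (exp (q * ln (1 + t) - c * t) * (4 * (S * S)))%R; [| nra].
  apply Rmult_le_compat_l; nra.
Qed.

Lemma ex_IntC_dominated (f : R -> C) (p q c M : R) : (0 < p)%R -> (0 < c)%R ->
  (forall t, (0 < t)%R -> continuous (U := C_R_NormedModule) f t) ->
  (forall t, (0 < t)%R -> (Cmod (f t) <= M * weight (p - 1) q c t)%R) ->
  exists l : C, IntC f l.
Proof.
  intros Hp Hc Hf HM; destruct (weight_envelope p q c Hp Hc) as [K [HK HKw]].
  apply (ex_RInt_gen_dominated f (fun t => Rabs M * K * envelope' p t)%R (fun t => Rabs M * K * envelope p t)%R (fun t => 0 < t)%R
    (at_right 0) (Rbar_locally p_infty) (Rabs M * K * -1)%R (Rabs M * K * 0)%R).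
  - apply interval_pos.
  - apply at_right_pos.
  - apply infty_pos.
  - exact Hf.
  - intros t Ht; destruct (envelope_derive p t Ht) as [H1 H2]; split.
    + now apply is_derive_scal.
    + apply (continuous_scal_r (K := R_AbsRing) (V := R_NormedModule)), H2.
  - intros t Ht; specialize (HM t Ht); specialize (HKw t Ht).
    assert (H := Rle_abs M); assert (H1 := Rabs_pos M); assert (H2 : (0 < weight (p - 1) q c t)%R) by apply exp_pos.
    apply Rle_trans with (Rabs M * weight (p - 1) q c t)%R; [nra |]; rewrite Rmult_assoc.
    now apply Rmult_le_compat_l.
  - apply (filterlim_comp _ _ _ (envelope p) (fun u => Rabs M * K * u)%R _ (locally (-1)%R)); [now apply envelope_at_0 |].
    apply (filterlim_scal_r (K := R_AbsRing) (V := R_NormedModule)).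
  - apply (filterlim_comp _ _ _ (envelope p) (fun u => Rabs M * K * u)%R _ (locally 0%R)); [now apply envelope_at_infty |].
    apply (filterlim_scal_r (K := R_AbsRing) (V := R_NormedModule)).
Qed.

(** * The Laplace integral *)

(** t^p (1 + t)^q e^(-zt), the common integrand: q = 0, z = 1 for Gamma and the upper incomplete
    function, z = x for the Tricomi function, and q = 0, z = - x for the lower incomplete function
    after rescaling. *)
Definition kern (p q z : C) (t : R) : C :=
  Cexp (p * RtoC (ln t) + q * RtoC (ln (1 + t)) - z * RtoC t).

Lemma Cmod_kern (p q z : C) (t : R) : Cmod (kern p q z t) = weight (Re p) (Re q) (Re z) t.
Proof.
  unfold kern, weight; rewrite Cmod_Cexp; f_equal; destruct p, q, z; simpl; ring.
Qed.

Lemma kern_real (p q z t : R) : kern (RtoC p) (RtoC q) (RtoC z) t = RtoC (weight p q z t).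
Proof.
  unfold kern, weight; rewrite <- Cexp_R; f_equal; apply injective_projections; simpl; ring.
Qed.

Lemma kern_mult (p q z p' q' z' : C) (t : R) :
  kern p q z t * kern p' q' z' t = kern (p + p') (q + q') (z + z') t.
Proof. unfold kern; rewrite <- Cexp_plus; f_equal; ring. Qed.

Lemma kern_p (t : R) : (0 < t)%R -> kern 1 0 0 t = RtoC t.
Proof.
  intros Ht; rewrite kern_real; f_equal; unfold weight.
  replace (1 * ln t + 0 * ln (1 + t) - 0 * t)%R with (ln t) by ring; now apply exp_ln.
Qed.

Lemma kern_q (t : R) : (0 < t)%R -> kern 0 1 0 t = 1 + RtoC t.
Proof.
  intros Ht; rewrite kern_real, <- RtoC_plus; f_equal; unfold weight.
  replace (0 * ln t + 1 * ln (1 + t) - 0 * t)%R with (ln (1 + t)) by ring; apply exp_ln; lra.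
Qed.

Lemma kern_succ_p (p q z : C) (t : R) : (0 < t)%R -> kern (p + 1) q z t = RtoC t * kern p q z t.
Proof.
  intros Ht; rewrite <- (kern_p t Ht), kern_mult; f_equal; ring.
Qed.

Lemma kern_succ_q (p q z : C) (t : R) : (0 < t)%R -> kern p (q + 1) z t = (1 + RtoC t) * kern p q z t.
Proof.
  intros Ht; rewrite <- (kern_q t Ht), kern_mult; f_equal; ring.
Qed.

Lemma RtoC_neq_0 (t : R) : (0 < t)%R -> RtoC t <> 0.
Proof. intros Ht H; injection H; lra. Qed.

Lemma is_derive_kern (p q z : C) (t : R) : (0 < t)%R ->
  is_derive (V := C_R_NormedModule) (kern p q z) t
    ((p / RtoC t + q / (1 + RtoC t) - z) * kern p q z t).
Proof.
  intros Ht; destruct p as [p1 p2], q as [q1 q2], z as [z1 z2].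
  apply (is_derive_ext (V := C_R_NormedModule) (fun t => Cexp
    (p1 * ln t + q1 * ln (1 + t) - z1 * t, p2 * ln t + q2 * ln (1 + t) - z2 * t)%R)).
  { intros s; unfold kern; f_equal; apply injective_projections; simpl; ring. }
  unfold kern.
  replace ((p1, p2) * RtoC (ln t) + (q1, q2) * RtoC (ln (1 + t)) - (z1, z2) * RtoC t) with
    ((p1 * ln t + q1 * ln (1 + t) - z1 * t, p2 * ln t + q2 * ln (1 + t) - z2 * t)%R : C)
    by (apply injective_projections; simpl; ring).
  replace ((p1, p2) / RtoC t + (q1, q2) / (1 + RtoC t) - (z1, z2)) with
    ((p1 / t + q1 / (1 + t) - z1, p2 / t + q2 / (1 + t) - z2)%R : C).
  - apply (is_derive_Cexp (fun t => p1 * ln t + q1 * ln (1 + t) - z1 * t)%R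
      (fun t => p2 * ln t + q2 * ln (1 + t) - z2 * t)%R); auto_derive; first [field; lra | repeat split; lra].
  - rewrite <- RtoC_plus; unfold Cdiv; rewrite <- !RtoC_inv by lra.
    apply injective_projections; simpl; field; lra.
Qed.

Lemma continuous_kern (p q z : C) (t : R) : (0 < t)%R ->
  continuous (U := C_R_NormedModule) (kern p q z) t.
Proof.
  intros Ht; exact (is_derive_continuous C_R_NormedModule _ _ _ (is_derive_kern p q z t Ht)).
Qed.

Lemma ex_IntC_kern (a q z : C) : (0 < Re a)%R -> (0 < Re z)%R -> exists l : C, IntC (kern (a - 1) q z) l.
Proof.
  intros Ha Hz; apply (ex_IntC_dominated _ (Re a) (Re q) (Re z) 1); auto.
  - intros; now apply continuous_kern.
  - intros t Ht; rewrite Cmod_kern, Rmult_1_l; right; f_equal; destruct a; simpl; ring.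
Qed.

Definition laplace_int (a q z : C) : C := CInt_gen (kern (a - 1) q z) (at_right 0) (Rbar_locally p_infty).

Lemma laplace_int_correct (a q z : C) : (0 < Re a)%R -> (0 < Re z)%R -> IntC (kern (a - 1) q z) (laplace_int a q z).
Proof.
  intros Ha Hz; destruct (ex_IntC_kern a q z Ha Hz) as [l Hl].
  unfold laplace_int, CInt_gen; now rewrite (is_RInt_gen_unique (V := C_R_CompleteNormedModule) _ l Hl).
Qed.

Lemma laplace_int_unique (a q z l : C) : IntC (kern (a - 1) q z) l -> laplace_int a q z = l.
Proof. apply (is_RInt_gen_unique (V := C_R_CompleteNormedModule)). Qed.

Lemma filterlim_C_0 (F : (R -> Prop) -> Prop) {FF : Filter F} (f : R -> C) (g : R -> R) :
  F (fun t => Cmod (f t) <= g t)%R -> filterlim g F (locally 0%R) ->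
  filterlim f F (locally (RtoC 0 : C_R_NormedModule)).
Proof.
  intros Hfg Hg P [eps HP].
  assert (Hg' : F (fun t => Rabs (g t) < eps)%R).
  { apply (Hg (fun y => Rabs y < eps)%R); exists eps; intros y Hy.
    change (Rabs (y - 0) < eps)%R in Hy; now rewrite Rminus_0_r in Hy. }
  unfold filtermap; generalize (filter_and _ _ Hfg Hg'); apply filter_imp; intros t [H1 H2].
  apply HP, (norm_compat1 (V := C_R_NormedModule)); rewrite norm_C_R.
  change (Cmod (f t - 0) < eps)%R.
  replace (f t - 0) with (f t) by ring.
  generalize (Rle_abs (g t)); lra.
Qed.

Lemma kern_at_0 (a q z : C) : (0 < Re a)%R ->
  filterlim (kern a q z) (at_right 0) (locally (RtoC 0 : C_R_NormedModule)).
Proof.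
  intros Ha; set (M := exp (Rabs (Re q) * ln 2 + Rabs (Re z))).
  apply (filterlim_C_0 _ _ (fun t => M * exp (Re a * ln t))%R).
  - exists (mkposreal 1 Rlt_0_1); intros t Ht1 Ht.
    apply Rabs_def2 in Ht1; unfold minus, plus, opp in Ht1; simpl in Ht1.
    rewrite Cmod_kern; unfold weight, M; rewrite <- exp_plus; apply exp_le_exp.
    assert (H1 := ln_1p_pos t Ht).
    assert (H2 : (ln (1 + t) <= ln 2)%R) by (apply ln_le; lra).
    assert (H3 : (Re q * ln (1 + t) <= Rabs (Re q) * ln 2)%R).
    { generalize (Rle_abs (Re q)) (Rabs_pos (Re q)); nra. }
    assert (H4 : (- Re z * t <= Rabs (Re z))%R).
    { generalize (Rabs_pos (Re z)) (Rle_abs (- Re z)); rewrite Rabs_Ropp; nra. }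
    lra.
  - replace 0%R with (M * 0)%R at 2 by ring.
    apply (filterlim_comp _ _ _ (fun t => exp (Re a * ln t))%R (fun u => M * u)%R _ (locally 0%R)).
    + now apply exp_mult_ln_at_0.
    + apply (filterlim_scal_r (K := R_AbsRing) (V := R_NormedModule)).
Qed.

Lemma kern_at_infty (a q z : C) : (0 < Re z)%R ->
  filterlim (kern a q z) (Rbar_locally p_infty) (locally (RtoC 0 : C_R_NormedModule)).
Proof.
  (* For t > 1 the power of t is absorbed by (1 + t)^|Re a|; the extra power of 1 + t pays for a
     factor 1 / t, which tends to 0. *)
  intros Hz; destruct (exp_ln_1p_bounded (Rabs (Re a) + Re q + 1) (Re z) Hz) as [M [HM HB]].
  apply (filterlim_C_0 _ _ (fun t => M * / t)%R).
  - apply (filter_imp (F := Rbar_locally p_infty) (fun t => 1 < t)%R); [| now exists 1%R].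
    intros t Ht; rewrite Cmod_kern; unfold weight.
    apply Rle_trans with (exp ((Rabs (Re a) + Re q + 1) * ln (1 + t) - Re z * t + - ln t))%R.
    + apply exp_le_exp.
      assert (Hl : (ln t < ln (1 + t))%R) by (apply ln_increasing; lra).
      assert (Hl0 : (0 < ln t)%R) by (rewrite <- ln_1; apply ln_increasing; lra).
      generalize (Rle_abs (Re a)) (Rabs_pos (Re a)); nra.
    + rewrite exp_plus, exp_Ropp, exp_ln by lra.
      apply Rmult_le_compat_r; [left; apply Rinv_0_lt_compat; lra | apply HB; lra].
  - replace 0%R with (M * 0)%R by ring.
    apply (filterlim_comp _ _ _ (fun t => / t)%R (fun u => M * u)%R _ (locally 0%R)).
    + apply (filterlim_Rbar_inv p_infty); discriminate.
    + apply (filterlim_scal_r (K := R_AbsRing) (V := R_NormedModule)).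
Qed.

Lemma kern_total_derivative (a q z : C) (t : R) : (0 < t)%R ->
  (a / RtoC t + q / (1 + RtoC t) - z) * kern a q z t =
  a * kern (a - 1) q z t + q * kern a (q - 1) z t - z * kern a q z t.
Proof.
  intros Ht.
  replace a with (a - 1 + 1) at 2 5 6 by ring.
  replace q with (q - 1 + 1) at 2 3 6 by ring.
  rewrite !kern_succ_p, !kern_succ_q by auto.
  field; split; [| now apply RtoC_neq_0].
  rewrite <- RtoC_plus; apply RtoC_neq_0; lra.
Qed.

Lemma IntC_kern_total_derivative (a q z : C) : (0 < Re a)%R -> (0 < Re z)%R ->
  IntC (fun t => (a / RtoC t + q / (1 + RtoC t) - z) * kern a q z t) (RtoC 0).
Proof.
  intros Ha Hz.
  replace (RtoC 0) with (minus (RtoC 0 : C_R_NormedModule) (RtoC 0)).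
  2: { change (RtoC 0 - RtoC 0 = RtoC 0); ring. }
  apply (is_RInt_gen_antiderivative C_R_CompleteNormedModule (kern a q z) _ (fun t => 0 < t)%R);
    try typeclasses eauto.
  - apply interval_pos.
  - apply at_right_pos.
  - apply infty_pos.
  - intros t Ht; split; [now apply is_derive_kern |].
    apply (continuous_ext_loc (T := R_UniformSpace) (U := C_R_NormedModule) _ 
      (fun t => a * kern (a - 1) q z t + q * kern a (q - 1) z t - z * kern a q z t)).
    + exists (mkposreal t Ht); intros s Hs.
      assert (Hs0 : (0 < s)%R).
      { apply Rabs_def2 in Hs; unfold minus, plus, opp in Hs; simpl in Hs; lra. }
      symmetry; now apply kern_total_derivative.
    + assert (HC : forall c p q, continuous (U := C_R_NormedModule) (fun t => c * kern p q z t) t).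
      { intros c p r; apply (continuous_comp (V := C_R_NormedModule) (W := C_R_NormedModule) (kern p r z) (fun v => c * v)).
        - now apply continuous_kern.
        - apply linear_cont, is_linear_Cmult_l. }
      apply (continuous_minus (V := C_R_NormedModule)); [apply (continuous_plus (V := C_R_NormedModule)) |]; apply HC.
  - now apply kern_at_0.
  - now apply kern_at_infty.
Qed.

Lemma Re_plus_1 (a : C) : Re (a + 1) = (Re a + 1)%R.
Proof. destruct a; reflexivity. Qed.

(** t^a (1 + t)^q e^(-zt) vanishes at both ends, so its derivative integrates to 0. For q = 0, z = 1
    this is the functional equation of Gamma; for z = x it is the relation by which [tricomi_cont]
    continues U. *)
Lemma laplace_int_parts (a q z : C) : (0 < Re a)%R -> (0 < Re z)%R ->
  a * laplace_int a q z = z * laplace_int (a + 1) q z - q * laplace_int (a + 1) (q - 1) z.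
Proof.
  intros Ha Hz.
  assert (Ha1 : (0 < Re (a + 1))%R) by (rewrite Re_plus_1; lra).
  generalize (IntC_minus _ _ _ _ (IntC_plus _ _ _ _
    (IntC_scal a _ _ (laplace_int_correct a q z Ha Hz)) (IntC_scal q _ _ (laplace_int_correct (a + 1) (q - 1) z Ha1 Hz)))
    (IntC_scal z _ _ (laplace_int_correct (a + 1) q z Ha1 Hz))); intros H1.
  generalize (IntC_kern_total_derivative a q z Ha Hz); intros H2.
  apply (IntC_ext _ (fun t => a * kern (a - 1) q z t + q * kern (a + 1 - 1) (q - 1) z t - z * kern (a + 1 - 1) q z t)) in H2.
  - generalize (is_RInt_gen_C_unique _ _ _ H1 H2); intros H3.
    replace (a * laplace_int a q z) with (a * laplace_int a q z + q * laplace_int (a + 1) (q - 1) z - z * laplace_int (a + 1) q z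
      - q * laplace_int (a + 1) (q - 1) z + z * laplace_int (a + 1) q z) by ring.
    rewrite H3; ring.
  - intros s Hs.
    replace (a + 1 - 1) with a by ring; now apply kern_total_derivative.
Qed.

(** Integrates (1 + t)^q = (1 + t)^(q-1) + t (1 + t)^(q-1). *)
Lemma laplace_int_contiguous (a q z : C) : (0 < Re a)%R -> (0 < Re z)%R ->
  laplace_int a q z = laplace_int a (q - 1) z + laplace_int (a + 1) (q - 1) z.
Proof.
  intros Ha Hz.
  assert (Ha1 : (0 < Re (a + 1))%R) by (rewrite Re_plus_1; lra).
  apply laplace_int_unique.
  apply (IntC_ext (fun t => kern (a - 1) (q - 1) z t + kern (a + 1 - 1) (q - 1) z t)).
  - intros t Ht; replace (a + 1 - 1) with (a - 1 + 1) by ring.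
    replace q with (q - 1 + 1) at 3 by ring.
    rewrite kern_succ_p, kern_succ_q by auto; ring.
  - apply IntC_plus; now apply laplace_int_correct.
Qed.

Lemma laplace_int_scale (a : C) (x : R) : (0 < Re a)%R -> (0 < x)%R ->
  laplace_int a 0 (RtoC x) = Cexp (- a * RtoC (ln x)) * laplace_int a 0 1.
Proof.
  intros Ha Hx; apply laplace_int_unique.
  assert (H1 : IntC (kern (a - 1) 0 1) (laplace_int a 0 1)) by (apply laplace_int_correct; simpl; auto; lra).
  apply (IntC_ext (fun t => Cexp (- a * RtoC (ln x)) * scal x (kern (a - 1) 0 1 (x * t + 0)%R : C_R_NormedModule))).
  - intros t Ht.
    replace (scal x (kern (a - 1) 0 1 (x * t + 0)%R : C_R_NormedModule)) with
      (RtoC x * kern (a - 1) 0 1 (x * t)%R).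
    2: { rewrite Rplus_0_r; apply injective_projections; unfold scal; simpl;
         unfold scal; simpl; unfold mult; simpl; ring. }
    unfold kern; rewrite (ln_mult x t) by auto.
    replace (RtoC x) with (Cexp (RtoC (ln x))) at 1 by (rewrite Cexp_R, exp_ln; auto).
    rewrite <- !Cexp_plus; f_equal; rewrite RtoC_plus, RtoC_mult; ring.
  (* The substitution t -> x t is carried out on the filters: a radius e at 0 becomes e / x, a
     threshold m at infinity becomes m / x. *)
  - apply IntC_scal; intros P HP.
    destruct (H1 P HP) as [Q S HQ HS HQS].
    exists (fun t => Q (x * t)%R) (fun t => S (x * t)%R).
    + destruct HQ as [e He].
      assert (Hex : (0 < e / x)%R) by (apply Rdiv_lt_0_compat; [apply cond_pos | auto]).
      exists (mkposreal _ Hex); intros y Hy Hy0; apply He; [| nra].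
      apply Rabs_def2 in Hy; unfold minus, plus, opp in Hy; simpl in Hy.
      apply (Rabs_def1 (x * y + - 0)).
      * replace (pos e) with (x * (e / x))%R by (field; lra); nra.
      * generalize (cond_pos e); nra.
    + destruct HS as [m Hm]; exists (m / x)%R; intros y Hy; apply Hm.
      replace m with (x * (m / x))%R by (field; lra); nra.
    + intros u v Hu Hv; destruct (HQS _ _ Hu Hv) as [y [Hy HPy]]; exists y; split; [| exact HPy].
      apply (is_RInt_comp_lin (V := C_R_NormedModule)); simpl in *; now rewrite !Rplus_0_r.
Qed.

(** * Complex derivatives *)

Lemma Cplus_minus (z w : C) : z + (w - z) = w.
Proof. ring. Qed.

Notation is_derive_C f z l := (is_derive (K := C_AbsRing) (V := C_NormedModule) f z l).

Lemma is_derive_C_iff (f : C -> C) (z l : C) :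
  is_derive_C f z l <->
  forall eps : R, (0 < eps)%R -> exists d : R, (0 < d)%R /\
    forall h : C, (Cmod h < d)%R -> (Cmod (f (z + h)%C - f z - h * l) <= eps * Cmod h)%R.
Proof.
  split.
  - intros [_ H] eps Heps; specialize (H z (fun P HP => HP) (mkposreal _ Heps)).
    destruct H as [d Hd]; exists d; split; [apply cond_pos |].
    intros h Hh; specialize (Hd (z + h)).
    change (Cmod (z + h - z) < d -> Cmod (f (z + h)%C - f z - (z + h - z) * l) <= eps * Cmod (z + h - z))%R in Hd.
    replace (z + h - z) with h in Hd by ring; auto.
  - intros H; split.
    + apply (is_linear_scal_l (K := C_AbsRing) (V := C_NormedModule)).
    + intros w Hw.
      apply (is_filter_lim_locally_unique (K := C_AbsRing) (V := AbsRing_NormedModule C_AbsRing)) in Hw; subst w.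
      intros eps; destruct (H eps (cond_pos eps)) as [d [Hd0 Hd]].
      exists (mkposreal _ Hd0); intros y Hy.
      specialize (Hd (y - z)); rewrite (Cplus_minus z y) in Hd.
      apply Hd, Hy.
Qed.

(** The product and chain rules live in the module [AbsRing_NormedModule C_AbsRing]. The estimate
    defining a derivative is the same in both modules; only the linearity part has to be supplied
    again. *)
Lemma is_derive_C_AbsRing (f : C -> C) (z l : C) :
  is_derive_C f z l <-> is_derive (K := C_AbsRing) (V := AbsRing_NormedModule C_AbsRing) f z l.
Proof.
  split; intros [_ Hf]; split; try exact Hf.
  - apply (is_linear_scal_l (K := C_AbsRing) (V := AbsRing_NormedModule C_AbsRing)).
  - apply (is_linear_scal_l (K := C_AbsRing) (V := C_NormedModule)).
Qed.

Lemma is_derive_C_mult (f g : C -> C) (z df dg : C) :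
  is_derive_C f z df -> is_derive_C g z dg ->
  is_derive_C (fun w => f w * g w) z (df * g z + f z * dg).
Proof.
  rewrite !is_derive_C_AbsRing; intros Hf Hg.
  apply (is_derive_mult (K := C_AbsRing) f g z df dg Hf Hg), Cmult_comm.
Qed.

Lemma is_derive_C_comp (f g : C -> C) (z df dg : C) :
  is_derive_C f (g z) df -> is_derive_C g z dg -> is_derive_C (fun w => f (g w)) z (dg * df).
Proof.
  intros Hf Hg; apply is_derive_C_AbsRing in Hg.
  exact (is_derive_comp (K := C_AbsRing) (V := C_NormedModule) f g z df dg Hf Hg).
Qed.

Lemma is_derive_C_plus (f g : C -> C) (z df dg : C) :
  is_derive_C f z df -> is_derive_C g z dg -> is_derive_C (fun w => f w + g w) z (df + dg).
Proof. apply (is_derive_plus (K := C_AbsRing) (V := C_NormedModule)). Qed.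

Lemma is_derive_C_minus (f g : C -> C) (z df dg : C) :
  is_derive_C f z df -> is_derive_C g z dg -> is_derive_C (fun w => f w - g w) z (df - dg).
Proof. apply (is_derive_minus (K := C_AbsRing) (V := C_NormedModule)). Qed.

Lemma is_derive_C_const (c z : C) : is_derive_C (fun _ => c) z (RtoC 0).
Proof. apply (is_derive_const (K := C_AbsRing) (V := C_NormedModule)). Qed.

Lemma is_derive_C_id (z : C) : is_derive_C (fun w => w) z (RtoC 1).
Proof. apply is_derive_C_AbsRing, (is_derive_id (K := C_AbsRing)). Qed.

Lemma is_derive_C_scal (c : C) (f : C -> C) (z df : C) :
  is_derive_C f z df -> is_derive_C (fun w => c * f w) z (c * df).
Proof.
  intros Hf; replace (c * df) with (RtoC 0 * f z + c * df) by ring.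
  apply (is_derive_C_mult (fun _ => c)); [apply is_derive_C_const | exact Hf].
Qed.

Lemma is_derive_C_unique (f : C -> C) (z l l' : C) :
  is_derive_C f z l -> is_derive_C f z l' -> l = l'.
Proof.
  intros H H'; rewrite <- (is_C_derive_unique f z l H); now apply is_C_derive_unique.
Qed.

Lemma is_derive_C_eq (f : C -> C) (z l l' : C) :
  is_derive_C f z l -> l = l' -> is_derive_C f z l'.
Proof. intros Hf <-; exact Hf. Qed.

Lemma is_derive_C_ext_near (f g : C -> C) (z l : C) (r : R) : (0 < r)%R ->
  (forall h, (Cmod h < r)%R -> f (z + h) = g (z + h)) -> is_derive_C f z l -> is_derive_C g z l.
Proof.
  intros Hr Hfg; apply (is_derive_ext_loc (K := C_AbsRing) (V := C_NormedModule)).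
  exists (mkposreal r Hr); intros w Hw; specialize (Hfg (w - z)).
  rewrite (Cplus_minus z w) in Hfg; apply Hfg, Hw.
Qed.

(** The form in which the derivatives of the exponential, of the inverse and of the Laplace integral
    are obtained. *)
Lemma is_derive_C_quadratic (f : C -> C) (z l : C) (r K : R) : (0 < r)%R ->
  (forall h, (Cmod h < r)%R -> (Cmod (f (z + h)%C - f z - h * l) <= K * Cmod h ^ 2)%R) ->
  is_derive_C f z l.
Proof.
  intros Hr HK; apply is_derive_C_iff; intros eps Heps.
  assert (HK1 : (0 < Rabs K + 1)%R) by (generalize (Rabs_pos K); lra).
  exists (Rmin r (eps / (Rabs K + 1))); split.
  { apply Rmin_glb_lt; [auto | now apply Rdiv_lt_0_compat]. }
  intros h Hh.
  assert (Hh1 : (Cmod h < r)%R) by (eapply Rlt_le_trans; [exact Hh | apply Rmin_l]).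
  assert (Hh2 : (Cmod h < eps / (Rabs K + 1))%R) by (eapply Rlt_le_trans; [exact Hh | apply Rmin_r]).
  apply Rle_trans with (1 := HK h Hh1).
  apply (Rmult_lt_compat_r (Rabs K + 1)) in Hh2; [| auto].
  replace (eps / (Rabs K + 1) * (Rabs K + 1))%R with eps in Hh2 by (field; lra).
  generalize (Cmod_ge_0 h) (Rle_abs K) (Rabs_pos K); intros.
  replace (K * Cmod h ^ 2)%R with (K * Cmod h * Cmod h)%R by ring.
  apply Rmult_le_compat_r; auto; nra.
Qed.

Lemma is_derive_Cexp_C (z : C) : is_derive_C Cexp z (Cexp z).
Proof.
  apply (is_derive_C_quadratic _ _ _ 1 (Cmod (Cexp z) * exp 1)); [lra |].
  intros h Hh; rewrite Cexp_plus.
  replace (Cexp z * Cexp h - Cexp z - h * Cexp z) with (Cexp z * (Cexp h - 1 - h)) by ring.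
  rewrite Cmod_mult, Rmult_assoc; apply Rmult_le_compat_l; [apply Cmod_ge_0 |].
  apply Rle_trans with (1 := Cmod_Cexp_minus_1_minus_id h).
  rewrite Rmult_comm; apply Rmult_le_compat_r; [nra |].
  apply exp_le_exp; lra.
Qed.

Lemma is_derive_Cinv (z : C) : z <> 0 -> is_derive_C Cinv z (- / (z * z)).
Proof.
  intros Hz; assert (Hz0 := proj1 (Cmod_gt_0 z) Hz).
  (* Within radius |z| / 2 one has |z + h| >= |z| / 2, and the remainder is h^2 / (z^2 (z + h)). *)
  apply (is_derive_C_quadratic _ _ _ (Cmod z / 2) (2 * / (Cmod z ^ 3))); [lra |].
  intros h Hh.
  assert (Hzh : (Cmod z / 2 <= Cmod (z + h))%R).
  { assert (Cmod z <= Cmod (z + h) + Cmod h)%R; [| lra].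
    replace z with (z + h + - h) at 1 by ring; rewrite <- (Cmod_opp h); apply Cmod_triangle. }
  assert (Hzh0 : z + h <> 0) by (apply Cmod_gt_0; lra).
  replace (/ (z + h) - / z - h * - / (z * z)) with (h * h * / (z * z * (z + h)))
    by (field; auto).
  rewrite Cmod_mult, Cmod_inv, !Cmod_mult by (repeat apply Cmult_neq_0; auto).
  rewrite Rmult_comm; replace (Cmod h ^ 2)%R with (Cmod h * Cmod h)%R by ring.
  apply Rmult_le_compat_r; [generalize (Cmod_ge_0 h); nra |].
  replace (2 * / Cmod z ^ 3)%R with (/ (Cmod z * Cmod z * (Cmod z / 2)))%R by (field; lra).
  apply Rinv_le_contravar; [apply Rmult_lt_0_compat; nra |].
  apply Rmult_le_compat_l; nra.
Qed.

Lemma is_derive_C_inv (f : C -> C) (z l : C) : f z <> 0 ->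
  is_derive_C f z l -> is_derive_C (fun w => / f w) z (l * - / (f z * f z)).
Proof. intros Hz Hf; apply (is_derive_C_comp Cinv); auto; now apply is_derive_Cinv. Qed.

Lemma is_derive_C_affine (a c z : C) : is_derive_C (fun w => a + c * w) z c.
Proof.
  apply is_derive_C_eq with (RtoC 0 + c * RtoC 1); [| ring].
  apply is_derive_C_plus; [apply is_derive_C_const | apply is_derive_C_scal, is_derive_C_id].
Qed.

Lemma is_derive_C_shift (f : C -> C) (a z l : C) :
  is_derive_C (fun h => f (a + h)) z l <-> is_derive_C f (a + z) l.
Proof.
  rewrite !is_derive_C_iff; split; intros Hd eps Heps; destruct (Hd eps Heps) as [d [Hd0 H]];
    exists d; (split; [exact Hd0 |]); intros h Hh; specialize (H h Hh);
    [rewrite Cplus_assoc in H; exact H | rewrite Cplus_assoc; exact H].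
Qed.

Lemma is_derive_C_at_0 (f : C -> C) (a l : C) :
  is_derive_C (fun h => f (a + h)) (RtoC 0) l <-> is_derive_C f a l.
Proof.
  generalize (is_derive_C_shift f a (RtoC 0) l); now rewrite Cplus_0_r.
Qed.

(** * Differentiation of the Laplace integral in its parameters *)

Lemma le_exp (u : R) : (0 <= u)%R -> (u <= exp u)%R.
Proof. intros Hu; generalize (exp_ineq1_le u); lra. Qed.

Lemma sqr_le_exp (u : R) : (0 <= u)%R -> (u ^ 2 <= 4 * exp u)%R.
Proof.
  intros Hu; generalize (le_exp (u / 2) ltac:(lra)); intros H.
  replace (exp u) with (exp (u / 2) * exp (u / 2))%R by (rewrite <- exp_plus; f_equal; field).
  nra.
Qed.

(* Bounds the logarithmic derivative of [kern] along any direction with coordinates in [-1, 1]. *)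
Definition log_size (t : R) : R := (Rabs (ln t) + ln (1 + t) + t)%R.

Lemma log_size_pos (t : R) : (0 < t)%R -> (0 < log_size t)%R.
Proof. intros Ht; unfold log_size; generalize (Rabs_pos (ln t)) (ln_1p_pos t Ht); lra. Qed.

(** Since |ln t| <= 2 ln (1 + t) - ln t, the factor costs at most t^(-1) (1 + t)^3 e^(ct). The lost
    power of t is why Re a > 1 is assumed in the next section. *)
Lemma exp_log_size_le (r c t : R) : (0 < t)%R -> (0 < r <= 1 / 2)%R -> (r <= c)%R ->
  (exp (r * log_size t) <= weight (-1) 3 (- c) t)%R.
Proof.
  intros Ht Hr Hc; apply exp_le_exp; unfold log_size.
  assert (H1 := ln_1p_pos t Ht).
  assert (Rabs (ln t) <= 2 * ln (1 + t) - ln t)%R.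
  { assert (ln t < ln (1 + t))%R by (apply ln_increasing; lra).
    unfold Rabs; destruct Rcase_abs; lra. }
  generalize (Rabs_pos (ln t)); intros.
  assert (r * Rabs (ln t) <= Rabs (ln t))%R by nra.
  assert (r * ln (1 + t) <= ln (1 + t))%R by nra.
  assert (r * t <= c * t)%R by nra.
  lra.
Qed.

Section Directional_derivative.

Variables (a q z : C) (u v w : R).
Hypotheses (Ha : (1 < Re a)%R) (Hz : (0 < Re z)%R).
Hypotheses (Hu : (Rabs u <= 1)%R) (Hv : (Rabs v <= 1)%R) (Hw : (Rabs w <= 1)%R).

Let L (t : R) : R := (u * ln t + v * ln (1 + t) - w * t)%R.
(** Chosen for a factor exp (2 r [log_size]): 2 r <= 1 / 2 as [exp_log_size_le] asks, and 2 r <= Re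
    z / 2, so that half of the decay rate survives. *)
Let r : R := Rmin (1 / 4) (Re z / 4).

Let Hr : (0 < r)%R /\ (r <= 1 / 4)%R /\ (r <= Re z / 4)%R.
Proof.
  unfold r; split; [apply Rmin_glb_lt; lra | split; [apply Rmin_l | apply Rmin_r]].
Qed.

Let L_le (t : R) : (0 < t)%R -> (Rabs (L t) <= log_size t)%R.
Proof.
  intros Ht; unfold L, log_size, Rminus.
  eapply Rle_trans; [apply Rabs_triang |]; apply Rplus_le_compat.
  - eapply Rle_trans; [apply Rabs_triang |]; apply Rplus_le_compat; rewrite Rabs_mult.
    + generalize (Rabs_pos (ln t)); nra.
    + rewrite (Rabs_pos_eq (ln _)) by (left; now apply ln_1p_pos); generalize (ln_1p_pos t Ht); nra.
  - rewrite Rabs_Ropp, Rabs_mult, (Rabs_pos_eq t); nra.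
Qed.

Let kern_dom (t : R) : (0 < t)%R ->
  (weight (Re (a - 1)) (Re q) (Re z) t * exp (2 * r * log_size t) <=
   weight (Re a - 1 - 1) (Re q + 3) (Re z / 2) t)%R.
Proof.
  intros Ht; destruct Hr as [Hr0 [Hr1 Hr2]].
  apply Rle_trans with (weight (Re (a - 1)) (Re q) (Re z) t * weight (-1) 3 (- (Re z / 2)) t)%R.
  - apply Rmult_le_compat_l; [left; apply exp_pos |]; apply exp_log_size_le; lra.
  - right; unfold weight; rewrite <- exp_plus; f_equal; destruct a; simpl; field.
Qed.

Lemma ex_IntC_log_derivative : exists l : C,
  IntC (fun t => RtoC (u * ln t + v * ln (1 + t) - w * t) * kern (a - 1) q z t) l.
Proof.
  destruct Hr as [Hr0 [Hr1 Hr2]].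
  apply (ex_IntC_dominated _ (Re a - 1) (Re q + 3) (Re z / 2) (/ r)); try lra.
  - intros t Ht; change (continuous (U := C_R_NormedModule) (fun t => RtoC (L t) * kern (a - 1) q z t) t).
    apply (continuous_ext (T := R_UniformSpace) (U := C_R_NormedModule) (fun t => scal (L t) (kern (a - 1) q z t : C_R_NormedModule))).
    + intros s; apply injective_projections; unfold scal; simpl;
         unfold scal; simpl; unfold mult; simpl; ring.
    + apply (continuous_scal (K := R_AbsRing) (V := C_R_NormedModule)); [| now apply continuous_kern].
      apply (ex_derive_continuous (V := R_NormedModule)); unfold L; auto_derive; repeat split; lra.
  - intros t Ht; fold (L t); rewrite Cmod_mult, Cmod_R, Cmod_kern.
    apply Rle_trans with (/ r * (weight (Re (a - 1)) (Re q) (Re z) t * exp (2 * r * log_size t)))%R.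
    + rewrite Rmult_comm, <- Rmult_assoc, (Rmult_comm (/ r)), Rmult_assoc.
      apply Rmult_le_compat_l; [left; apply exp_pos |].
      apply Rle_trans with (1 := L_le t Ht).
      assert (Hl := log_size_pos t Ht).
      apply (Rmult_le_reg_l r); [auto |].
      replace (r * (/ r * exp (2 * r * log_size t)))%R with (exp (2 * r * log_size t)) by (field; lra).
      apply Rle_trans with (exp (r * log_size t)); [apply le_exp; nra | apply exp_le_exp; nra].
    + apply Rmult_le_compat_l; [left; now apply Rinv_0_lt_compat | now apply kern_dom].
Qed.

(** The integrand at h is the one at 0 times e^(hL), so the remainder is the kernel times e^(hL) - 1
    - h L, bounded by |h|^2 L^2 e^|hL| with an integrable majorant uniform in |h| < r. The
    directions (1, 0, 0), (1, 1, 0) and (0, 0, 1) are used later. *)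
Lemma is_derive_laplace_int (l : C) :
  IntC (fun t => RtoC (u * ln t + v * ln (1 + t) - w * t) * kern (a - 1) q z t) l ->
  is_derive_C (fun h => laplace_int (a + RtoC u * h) (q + RtoC v * h) (z + RtoC w * h)) (RtoC 0) l.
Proof.
  intros Hl; destruct Hr as [Hr0 [Hr1 Hr2]].
  assert (HJ := laplace_int_correct (RtoC (Re a - 1)) (RtoC (Re q + 3)) (RtoC (Re z / 2)) ltac:(simpl; lra) ltac:(simpl; lra)).
  set (J := laplace_int (RtoC (Re a - 1)) (RtoC (Re q + 3)) (RtoC (Re z / 2))) in *.
  (* The factor 4 / r^2 is u^2 <= 4 e^u at u = r [log_size], which trades L^2 for one factor exp (r
     [log_size]); e^|hL| takes the other. *)
  apply (is_derive_C_quadratic _ _ _ r (4 / r ^ 2 * Re J)); [auto |].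
  intros h Hh; rewrite Cplus_0_l, !Cmult_0_r, !Cplus_0_r.
  assert (Hre : forall k : R, (Rabs k <= 1)%R -> (Rabs (Re (RtoC k * h)) <= Cmod h)%R).
  { intros k Hk; eapply Rle_trans; [apply re_le_Cmod |]; rewrite Cmod_mult, Cmod_R.
    generalize (Cmod_ge_0 h); nra. }
  assert (H1 : IntC (kern (a + RtoC u * h - 1) (q + RtoC v * h) (z + RtoC w * h))
     (laplace_int (a + RtoC u * h) (q + RtoC v * h) (z + RtoC w * h))).
  { apply laplace_int_correct.
    - generalize (Hre u Hu); intros Hb; change (0 < Re a + Re (RtoC u * h))%R.
      apply Rabs_le_between in Hb; lra.
    - generalize (Hre w Hw); intros Hb; change (0 < Re z + Re (RtoC w * h))%R.
      apply Rabs_le_between in Hb; lra. }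
  assert (H2 : IntC (kern (a - 1) q z) (laplace_int a q z)) by (apply laplace_int_correct; lra).
  assert (H3 := IntC_minus _ _ _ _ (IntC_minus _ _ _ _ H1 H2) (IntC_scal h _ _ Hl)).
  assert (H4 := IntC_scal (RtoC (4 / r ^ 2 * Cmod h ^ 2)) _ _ HJ).
  assert (H5 := fun HH => IntC_Cmod_le _ _ _ _ HH H3 H4).
  replace (4 / r ^ 2 * Re J * Cmod h ^ 2)%R with (Re (RtoC (4 / r ^ 2 * Cmod h ^ 2) * J)).
  2: { destruct J; simpl; ring. }
  apply H5; clear H5; intros t Ht.
  replace (kern (a + RtoC u * h - 1) (q + RtoC v * h) (z + RtoC w * h) t) with
    (kern (a - 1) q z t * Cexp (h * RtoC (L t))).
  2: { unfold kern; rewrite <- Cexp_plus; f_equal; unfold L.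
       rewrite RtoC_minus, RtoC_plus, !RtoC_mult; ring. }
  fold (L t).
  replace (kern (a - 1) q z t * Cexp (h * RtoC (L t)) - kern (a - 1) q z t - h * (RtoC (L t) * kern (a - 1) q z t))
    with (kern (a - 1) q z t * (Cexp (h * RtoC (L t)) - 1 - h * RtoC (L t))) by ring.
  replace (kern (RtoC (Re a - 1) - 1) (RtoC (Re q + 3)) (RtoC (Re z / 2)) t) with
    (RtoC (weight (Re a - 1 - 1) (Re q + 3) (Re z / 2) t)).
  2: { rewrite <- kern_real; f_equal; apply injective_projections; simpl; ring. }
  rewrite <- RtoC_mult; simpl Re.
  rewrite Cmod_mult, Cmod_kern.
  apply Rle_trans with (4 / r ^ 2 * Cmod h ^ 2 * (weight (Re (a - 1)) (Re q) (Re z) t * exp (2 * r * log_size t)))%R.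
  2: { apply Rmult_le_compat_l; [| now apply kern_dom].
       apply Rmult_le_pos; [left; apply Rdiv_lt_0_compat; nra | nra]. }
  replace (4 / r ^ 2 * Cmod h ^ 2 * (weight (Re (a - 1)) (Re q) (Re z) t * exp (2 * r * log_size t)))%R with
    (weight (Re (a - 1)) (Re q) (Re z) t * (4 / r ^ 2 * Cmod h ^ 2 * exp (2 * r * log_size t)))%R by ring.
  apply Rmult_le_compat_l; [left; apply exp_pos |].
  apply Rle_trans with (1 := Cmod_Cexp_minus_1_minus_id _).
  rewrite Cmod_mult, Cmod_R.
  assert (HL := L_le t Ht); assert (Hl0 := log_size_pos t Ht).
  assert (Hh0 := Cmod_ge_0 h); assert (HL0 := Rabs_pos (L t)).
  replace (2 * r * log_size t)%R with (r * log_size t + r * log_size t)%R by ring.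
  rewrite exp_plus.
  assert (E1 : (exp (Cmod h * Rabs (L t)) <= exp (r * log_size t))%R) by (apply exp_le_exp, Rmult_le_compat; lra).
  assert (E2 := sqr_le_exp (r * log_size t) ltac:(nra)).
  assert (E3 : (log_size t ^ 2 <= 4 / r ^ 2 * exp (r * log_size t))%R).
  { apply (Rmult_le_reg_l (r ^ 2)); [nra |].
    replace (r ^ 2 * (4 / r ^ 2 * exp (r * log_size t)))%R with (4 * exp (r * log_size t))%R by (field; lra).
    nra. }
  assert (E4 : (Rabs (L t) ^ 2 <= log_size t ^ 2)%R) by (apply pow_incr; lra).
  replace ((Cmod h * Rabs (L t)) ^ 2)%R with (Cmod h ^ 2 * Rabs (L t) ^ 2)%R by ring.
  replace (4 / r ^ 2 * Cmod h ^ 2 * (exp (r * log_size t) * exp (r * log_size t)))%R with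
    (Cmod h ^ 2 * (4 / r ^ 2 * exp (r * log_size t)) * exp (r * log_size t))%R by (field; lra).
  apply Rmult_le_compat; [apply Rmult_le_pos; apply pow2_ge_0 | left; apply exp_pos | | exact E1].
  apply Rmult_le_compat_l; [apply pow2_ge_0 | lra].
Qed.

End Directional_derivative.

(** * The Gamma function *)

Definition nonpole (a : C) : Prop := forall n : nat, a + RtoC (INR n) <> 0.

Lemma Re_plus_R (a : C) (r : R) : Re (a + RtoC r) = (Re a + r)%R.
Proof. destruct a; reflexivity. Qed.

Lemma nonpole_neq_0 (a : C) : nonpole a -> a <> 0.
Proof. intros Ha H; apply (Ha 0%nat); rewrite H; simpl; ring. Qed.

Lemma nonpole_succ (a : C) : nonpole a -> nonpole (a + 1).
Proof.
  intros Ha n H; apply (Ha (S n)); rewrite S_INR, RtoC_plus, <- H; ring.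
Qed.

Lemma nonpole_pos (a : C) : (0 < Re a)%R -> nonpole a.
Proof.
  intros Ha n H; apply (f_equal Re) in H; rewrite Re_plus_R in H.
  simpl in H; generalize (pos_INR n); lra.
Qed.

Lemma INR_unbounded (r : R) : exists n : nat, (r < INR n)%R.
Proof. exists (Z.to_nat (up (Rabs r))).
  destruct (archimed (Rabs r)) as [H _].
  rewrite INR_IZR_INZ, Z2Nat.id.
  - generalize (Rle_abs r); lra.
  - apply le_IZR; generalize (Rabs_pos r); lra.
Qed.

(** The substitute for analytic continuation: prove P in a right half-plane, then descend by unit
    steps along the nonpoles. *)
Lemma nonpole_ind (r : R) (P : C -> Prop) :
  (forall a, (r < Re a)%R -> P a) -> (forall a, nonpole a -> P (a + 1) -> P a) ->
  forall a, nonpole a -> P a.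
Proof.
  intros H0 HS a Ha; destruct (INR_unbounded (r - Re a)) as [n Hn].
  revert a Ha Hn; induction n as [| n IH]; intros a Ha Hn.
  - apply H0; simpl in Hn; lra.
  - apply HS; auto; apply IH; [now apply nonpole_succ |].
    rewrite Re_plus_1; rewrite S_INR in Hn; lra.
Qed.

Lemma right_shift_spec (z : C) : (0 < Re z + INR (right_shift z))%R.
Proof.
  unfold right_shift; destruct (archimed (- Re z)) as [H1 H2].
  destruct (Z_le_gt_dec 0 (up (- Re z))) as [Hu | Hu].
  - rewrite INR_IZR_INZ, Z2Nat.id by exact Hu; lra.
  - replace (Z.to_nat (up (- Re z))) with 0%nat by lia; simpl.
    assert (IZR (up (- Re z)) <= 0)%R by (apply IZR_le; lia); lra.
Qed.

Lemma Gamma_int_laplace_int (z : C) : (0 < Re z)%R -> Gamma_int z = laplace_int z 0 1.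
Proof.
  intros Hz; unfold Gamma_int, CInt_gen.
  apply (is_RInt_gen_unique (V := C_R_CompleteNormedModule)).
  apply (IntC_ext (kern (z - 1) 0 1)).
  - intros t Ht; rewrite Cpower_pos by auto; unfold kern.
    rewrite <- Cexp_R, <- Cexp_plus; f_equal; rewrite RtoC_opp; ring.
  - apply laplace_int_correct; simpl; auto; lra.
Qed.

Lemma Gamma_int_succ (z : C) : (0 < Re z)%R -> Gamma_int (z + 1) = z * Gamma_int z.
Proof.
  intros Hz; rewrite !Gamma_int_laplace_int by (rewrite ?Re_plus_1; lra).
  rewrite (laplace_int_parts z 0 1) by (simpl; auto; lra); ring.
Qed.

Lemma Gamma_cont_S (n : nat) (z : C) :
  (0 < Re z + INR n)%R -> Gamma_cont (S n) z = Gamma_cont n z.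
Proof.
  revert z; induction n as [| n IH]; intros z Hz.
  - simpl in *; rewrite Gamma_int_succ by lra; field.
    apply nonpole_neq_0, nonpole_pos; lra.
  - change (Gamma_cont (S n) (z + 1) / z = Gamma_cont n (z + 1) / z).
    rewrite IH; auto; rewrite Re_plus_1; rewrite S_INR in Hz; lra.
Qed.

(** The number of shifts in [Gamma] depends on z and jumps. Any sufficient number gives the same
    value, so it can be chosen freely. *)
Lemma Gamma_cont_eq (n : nat) (z : C) : (0 < Re z + INR n)%R -> Gamma z = Gamma_cont n z.
Proof.
  assert (Hle : forall m k, (0 < Re z + INR m)%R -> Gamma_cont (k + m) z = Gamma_cont m z).
  { intros m k Hm; induction k as [| k IH]; [reflexivity |].
    rewrite <- IH; apply (Gamma_cont_S (k + m)).
    rewrite plus_INR; generalize (pos_INR k); lra. }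
  intros Hn; unfold Gamma; assert (Hr := right_shift_spec z).
  destruct (Nat.le_ge_cases n (right_shift z)) as [Hl | Hl].
  - replace (right_shift z) with (right_shift z - n + n)%nat by lia; now apply Hle.
  - replace n with (n - right_shift z + right_shift z)%nat by lia; symmetry; now apply Hle.
Qed.

Lemma Gamma_laplace_int (z : C) : (0 < Re z)%R -> Gamma z = laplace_int z 0 1.
Proof.
  intros Hz; rewrite (Gamma_cont_eq 0) by (simpl; lra); now apply Gamma_int_laplace_int.
Qed.

Lemma Gamma_succ (z : C) : z <> 0 -> Gamma (z + 1) = z * Gamma z.
Proof.
  intros Hz; assert (Hr := right_shift_spec (z + 1)); rewrite Re_plus_1 in Hr.
  rewrite (Gamma_cont_eq (S (right_shift (z + 1))) z) by (rewrite S_INR; lra).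
  unfold Gamma; simpl; field; exact Hz.
Qed.

Lemma Gamma_1 : Gamma 1 = 1.
Proof.
  rewrite Gamma_laplace_int by (simpl; lra); apply laplace_int_unique.
  cut (is_RInt_gen (V := C_R_NormedModule) (kern (1 - 1) 0 1) (at_right 0) (Rbar_locally p_infty)
    (minus (RtoC 0 : C_R_NormedModule) (RtoC (-1)))).
  { replace (minus (RtoC 0 : C_R_NormedModule) (RtoC (-1))) with (RtoC 1 : C_R_NormedModule); auto.
    apply injective_projections; unfold minus, plus, opp; simpl; unfold plus, opp; simpl; ring. }
  assert (Hk : forall t, (kern (1 - 1) 0 1) t = RtoC (exp (- t))).
  { intros t; unfold kern; rewrite <- Cexp_R; f_equal; rewrite RtoC_opp; ring. }
  apply (is_RInt_gen_antiderivative C_R_CompleteNormedModule (fun t => RtoC (- exp (- t))) _ (fun t => 0 < t)%R);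
    try typeclasses eauto.
  - apply interval_pos.
  - apply at_right_pos.
  - apply infty_pos.
  - intros t Ht; split; [| now apply continuous_kern].
    rewrite Hk; apply (is_derive_linear R_NormedModule C_R_NormedModule RtoC); [apply is_linear_RtoC |].
    auto_derive; auto; ring.
  - apply (filterlim_comp _ _ _ (fun t => - exp (- t))%R RtoC _ (locally (-1)%R)).
    + replace (-1)%R with (- exp (- 0))%R by (rewrite Ropp_0, exp_0; ring).
      intros P HP.
      assert (HC : continuous (fun t => - exp (- t))%R 0).
      { apply (ex_derive_continuous (V := R_NormedModule)); auto_derive; auto. }
      destruct (HC P HP) as [e He]; exists e; intros y Hy _; now apply He.
    + apply (linear_cont (U := R_NormedModule) (V := C_R_NormedModule)), is_linear_RtoC.
  - apply (filterlim_C_0 _ _ (fun t => / t)%R).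
    + apply (filter_imp (F := Rbar_locally p_infty) (fun t => 0 < t)%R); [| apply infty_pos].
      intros t Ht; rewrite Cmod_R, Rabs_Ropp, Rabs_pos_eq by (left; apply exp_pos).
      rewrite exp_Ropp; apply Rinv_le_contravar; [auto |]; generalize (exp_ineq1_le t); lra.
    + apply (filterlim_Rbar_inv p_infty); discriminate.
Qed.

Lemma IntC_Re_le (f g : R -> C) (k l : C) :
  (forall t, (0 < t)%R -> (Re (f t) <= Re (g t))%R) -> IntC f k -> IntC g l -> (Re k <= Re l)%R.
Proof.
  intros H Hf Hg.
  assert (H0 : (Cmod (0 * k) <= Re (l - k))%R).
  { apply (IntC_Cmod_le (fun t => 0 * f t) (fun t => g t - f t)).
    - intros t Ht; rewrite Cmult_0_l, Cmod_0; specialize (H t Ht).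
      change (0 <= Re (g t) - Re (f t))%R; lra.
    - now apply IntC_scal.
    - now apply IntC_minus. }
  rewrite Cmult_0_l, Cmod_0 in H0; change (0 <= Re l - Re k)%R in H0; lra.
Qed.

Lemma Re_RtoC_mult (r : R) (z : C) : Re (RtoC r * z) = (r * Re z)%R.
Proof. destruct z; simpl; ring. Qed.

(* [t^(r+1) e^(-t) >= (t + r (t - 1)) e^(-t)], and the right-hand side has integral 1. *)
Lemma Re_Gamma_ge_1 (X : R) : (2 <= X)%R -> (1 <= Re (Gamma (RtoC X)))%R.
Proof.
  intros HX; set (r := (X - 2)%R).
  rewrite Gamma_laplace_int by (simpl; lra).
  assert (H1 := laplace_int_correct 1 0 1 ltac:(simpl; lra) ltac:(simpl; lra)).
  assert (H2 := laplace_int_correct (1 + 1) 0 1 ltac:(simpl; lra) ltac:(simpl; lra)).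
  rewrite <- Gamma_laplace_int in H1, H2 by (simpl; lra).
  rewrite Gamma_succ, Gamma_1 in H2 by apply C1_nz.
  rewrite Gamma_1 in H1.
  assert (H3 := IntC_minus _ _ _ _ (IntC_scal (RtoC (1 + r)) _ _ H2) (IntC_scal (RtoC r) _ _ H1)).
  apply Rle_trans with (Re (RtoC (1 + r) * (1 * 1) - RtoC r * 1)); [right; simpl; ring |].
  apply (IntC_Re_le _ _ _ _) with (2 := H3) (3 := laplace_int_correct (RtoC X) 0 1 ltac:(simpl; lra) ltac:(simpl; lra)).
  intros t Ht.
  replace (1 + 1 - 1) with (1 - 1 + 1) by ring; rewrite kern_succ_p by auto.
  replace (RtoC X - 1) with (RtoC r + (1 - 1 + 1)).
  2: { unfold r; apply injective_projections; simpl; ring. }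
  replace (kern (RtoC r + (1 - 1 + 1)) 0 1 t) with (kern (RtoC r) 0 0 t * (RtoC t * kern (1 - 1) 0 1 t)).
  2: { rewrite <- kern_succ_p, kern_mult by auto; f_equal; ring. }
  replace (1 - 1) with (RtoC 0) by ring.
  rewrite !kern_real, <- !RtoC_mult, <- RtoC_minus; simpl Re.
  assert (Hw := exp_pos (0 * ln t + 0 * ln (1 + t) - 1 * t)); fold (weight 0 0 1 t) in Hw.
  assert (Hr : (1 + r * ln t <= weight r 0 0 t)%R).
  { unfold weight; replace (r * ln t + 0 * ln (1 + t) - 0 * t)%R with (r * ln t)%R by ring; apply exp_ineq1_le. }
  assert (Hl : (t - 1 <= ln t * t)%R).
  { generalize (exp_ineq1_le (- ln t)); rewrite exp_Ropp, exp_ln by auto; intros He.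
    apply (Rmult_le_compat_r t) in He; [| lra]; rewrite Rinv_l in He by lra; lra. }
  assert ((1 + r * ln t) * t <= weight r 0 0 t * t)%R by (apply Rmult_le_compat_r; lra).
  assert (r * (t - 1) <= r * (ln t * t))%R by (apply Rmult_le_compat_l; unfold r; lra).
  replace ((1 + r) * (t * weight 0 0 1 t) - r * weight 0 0 1 t)%R with ((t + r * (t - 1)) * weight 0 0 1 t)%R by ring.
  rewrite <- Rmult_assoc; apply Rmult_le_compat_r; lra.
Qed.

(** From cos u = 1 - 2 sin (u / 2)^2 and |sin v| <= |v|. *)
Lemma cos_ge (u : R) : (1 - u ^ 2 / 2 <= cos u)%R.
Proof.
  replace u with (2 * (u / 2))%R at 2 by field.
  rewrite cos_2a_sin.
  assert (Hs : forall v, (0 <= v -> Rabs (sin v) <= v)%R).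
  { intros v [Hv | <-]; [| rewrite sin_0, Rabs_R0; lra].
    apply Rabs_le; split; [| left; now apply sin_lt_x].
    destruct (Rle_dec v PI).
    - apply Rle_trans with 0%R; [lra | apply sin_ge_0; lra].
    - generalize (SIN_bound v) PI2_1; lra. }
  assert (H : (Rabs (sin (u / 2)) <= Rabs (u / 2))%R).
  { unfold Rabs at 2; destruct Rcase_abs.
    - rewrite <- Rabs_Ropp, <- sin_neg; apply Hs; lra.
    - apply Hs; lra. }
  assert (H2 : (sin (u / 2) ^ 2 <= (u / 2) ^ 2)%R).
  { rewrite <- (pow2_abs (sin _)), <- (pow2_abs (u / 2)); apply pow_incr; split; [apply Rabs_pos | exact H]. }
  nra.
Qed.

(** At s = ln (t / X) the right-hand side is 4 (t / X - 2 + X / t), whose integral against t^(X-1)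
    e^(-t) consists of Gamma values; this replaces the integral of a squared logarithm. The bracket
    is the square of e^(s/2) - e^(-s/2). *)
Lemma sqr_le_exp_sym (s : R) : (s ^ 2 <= 4 * (exp s - 2 + exp (- s)))%R.
Proof.
  assert (Hw : forall s, (0 <= s -> s ^ 2 <= 4 * (exp s - 2 + exp (- s)))%R).
  { clear s; intros s Hs.
    assert (H1 := exp_ineq1_le (s / 2)).
    assert (H2 : (exp (- (s / 2)) <= 1)%R) by (rewrite <- exp_0; apply exp_le_exp; lra).
    replace (exp s) with (exp (s / 2) * exp (s / 2))%R by (rewrite <- exp_plus; f_equal; field).
    replace (exp (- s)) with (exp (- (s / 2)) * exp (- (s / 2)))%R by (rewrite <- exp_plus; f_equal; field).
    assert (H3 : (exp (s / 2) * exp (- (s / 2)) = 1)%R) by (rewrite <- exp_plus, Rplus_opp_r; apply exp_0).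
    assert (H4 : (s / 2 <= exp (s / 2) - exp (- (s / 2)))%R) by lra.
    nra. }
  destruct (Rle_dec 0 s) as [Hs | Hs]; [now apply Hw |].
  generalize (Hw (- s)%R ltac:(lra)); rewrite Ropp_involutive; lra.
Qed.

(* The density [t^(X-1) e^(-t)] concentrates near [t = X], where the factor [(t/X)^(iY)] is close to 1. *)
Lemma Gamma_lower_bound (a : C) : (2 <= Re a)%R -> (4 * Im a ^ 2 <= Re a - 1)%R ->
  (Re (Gamma (RtoC (Re a))) / 2 <= Cmod (Gamma a))%R.
Proof.
  intros Ha Hy; set (X := Re a) in *; set (y := Im a) in *.
  rewrite !Gamma_laplace_int by (simpl; fold X; lra).
  set (G := laplace_int (RtoC X) 0 1).
  assert (HG : (1 <= Re G)%R) by (unfold G; rewrite <- Gamma_laplace_int by (simpl; lra); now apply Re_Gamma_ge_1).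
  assert (I1 : IntC (kern (RtoC X - 1) 0 1) G) by (apply laplace_int_correct; simpl; lra).
  assert (I2 : IntC (kern (RtoC X + 1 - 1) 0 1) (RtoC X * G)).
  { replace (RtoC X * G) with (laplace_int (RtoC X + 1) 0 1); [apply laplace_int_correct; simpl; lra |].
    unfold G; rewrite <- !Gamma_laplace_int, Gamma_succ by (simpl; lra || (apply RtoC_neq_0; lra)); ring. }
  assert (I3 : IntC (kern (RtoC (X - 1) - 1) 0 1) (RtoC (/ (X - 1)) * G)).
  { replace (RtoC (/ (X - 1)) * G) with (laplace_int (RtoC (X - 1)) 0 1); [apply laplace_int_correct; simpl; lra |].
    unfold G; replace (RtoC X) with (RtoC (X - 1) + 1) by (rewrite <- RtoC_plus; f_equal; ring).
    rewrite <- !Gamma_laplace_int, Gamma_succ by (simpl; lra || (apply RtoC_neq_0; lra)).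
    rewrite RtoC_inv by lra; field; apply RtoC_neq_0; lra. }
  assert (I4 : IntC (kern (a - 1) 0 1) (laplace_int a 0 1)) by (apply laplace_int_correct; simpl; fold X; lra).
  (* The unimodular factor X^(-iy) centres the phase at t = X and leaves the modulus of Gamma a
     unchanged. *)
  assert (I5 := IntC_scal (Cexp (0, - y * ln X)%R) _ _ I4).
  assert (I6 := IntC_minus _ _ _ _ I1 (IntC_scal (RtoC (2 * y ^ 2)) _ _
    (IntC_plus _ _ _ _ (IntC_minus _ _ _ _ (IntC_scal (RtoC (/ X)) _ _ I2) (IntC_scal (RtoC 2) _ _ I1)) (IntC_scal (RtoC X) _ _ I3)))).
  assert (Hre : (Re G / 2 <= Re (Cexp (0, - y * ln X)%R * laplace_int a 0 1))%R).
  { eapply Rle_trans; [| eapply (IntC_Re_le _ _ _ _) with (2 := I6) (3 := I5)].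
    - replace (G - RtoC (2 * y ^ 2) * (RtoC (/ X) * (RtoC X * G) - RtoC 2 * G + RtoC X * (RtoC (/ (X - 1)) * G)))
        with (RtoC (1 - 2 * y ^ 2 * (/ X * X - 2 + X * / (X - 1))) * G)
        by (rewrite !RtoC_minus, !RtoC_mult, !RtoC_plus, !RtoC_minus, !RtoC_mult; ring).
      rewrite Re_RtoC_mult.
      (* The mean of t / X - 2 + X / t for the Gamma density is 1 / (X - 1), so the loss is 2 y^2 /
         (X - 1), at most 1 / 2 by hypothesis. *)
      replace (/ X * X - 2 + X * / (X - 1))%R with (/ (X - 1))%R by (field; lra).
      assert (2 * y ^ 2 * / (X - 1) <= 1 / 2)%R.
      { apply (Rmult_le_reg_r (X - 1)); [lra |].
        replace (2 * y ^ 2 * / (X - 1) * (X - 1))%R with (2 * y ^ 2)%R by (field; lra); lra. }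
      nra.
    - intros t Ht.
      set (w := weight (X - 1) 0 1 t); assert (Hw : (0 < w)%R) by apply exp_pos.
      assert (K1 : kern (RtoC X - 1) 0 1 t = RtoC w).
      { unfold w; rewrite <- kern_real, RtoC_minus; reflexivity. }
      assert (K2 : kern (RtoC X + 1 - 1) 0 1 t = RtoC (t * w)).
      { rewrite RtoC_mult, <- K1, <- kern_succ_p by auto; f_equal; ring. }
      assert (K3 : kern (RtoC (X - 1) - 1) 0 1 t = RtoC (w / t)).
      { unfold Rdiv; rewrite RtoC_mult, <- K1, RtoC_inv by lra.
        replace (RtoC X - 1) with (RtoC (X - 1) - 1 + 1) by (rewrite RtoC_minus; ring).
        rewrite kern_succ_p by auto; field; now apply RtoC_neq_0. }
      rewrite K1, K2, K3.
      assert (K4 : Cexp (0, - y * ln X)%R * kern (a - 1) 0 1 t = RtoC w * Cexp (0, y * (ln t - ln X))%R).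
      { rewrite <- K1; unfold kern; rewrite <- !Cexp_plus; f_equal.
        unfold X, y; destruct a; apply injective_projections; simpl; ring. }
      rewrite K4, Re_RtoC_mult, <- !RtoC_mult, <- RtoC_minus, <- RtoC_plus, <- RtoC_mult, <- RtoC_minus; simpl Re.
      rewrite exp_0, Rmult_1_l, Rmult_0_l, Rminus_0_r.
      set (s := (ln t - ln X)%R).
      assert (C1' := cos_ge (y * s)); assert (C2' := sqr_le_exp_sym s).
      assert (E1 : exp s = (t / X)%R).
      { unfold s, Rminus; rewrite exp_plus, exp_Ropp, !exp_ln by lra; reflexivity. }
      assert (E2 : exp (- s) = (X / t)%R) by (rewrite exp_Ropp, E1; field; lra).
      rewrite E1, E2 in C2'.
      apply Rle_trans with (w * (1 - 2 * y ^ 2 * (t / X - 2 + X / t)))%R; [right; field; lra |].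
      apply Rmult_le_compat_l; [lra |].
      replace ((y * s) ^ 2)%R with (y ^ 2 * s ^ 2)%R in C1' by ring.
      assert (y ^ 2 * s ^ 2 <= y ^ 2 * (4 * (t / X - 2 + X / t)))%R by (apply Rmult_le_compat_l; [apply pow2_ge_0 | exact C2']).
      lra. }
  apply Rle_trans with (1 := Hre).
  eapply Rle_trans; [apply Rle_abs |]; eapply Rle_trans; [apply re_le_Cmod |].
  rewrite Cmod_mult, Cmod_Cexp; simpl Re; rewrite exp_0; lra.
Qed.

(** * Rising factorials, absence of zeros of Gamma, digamma *)

Fixpoint rising (a : C) (n : nat) : C :=
  match n with O => 1 | S m => rising a m * (a + RtoC (INR m)) end.

Lemma rising_neq_0 (a : C) (n : nat) : nonpole a -> rising a n <> 0.
Proof.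
  intros Ha; induction n as [| n IH]; simpl; [apply C1_nz | apply Cmult_neq_0; auto].
Qed.

Lemma rising_Sl (a : C) (n : nat) : rising a (S n) = a * rising (a + 1) n.
Proof.
  induction n as [| n IH]; [simpl; ring |].
  change (rising a (S n) * (a + RtoC (INR (S n))) = a * (rising (a + 1) n * (a + 1 + RtoC (INR n)))).
  rewrite IH, S_INR, RtoC_plus; ring.
Qed.

Lemma Gamma_rising (a : C) (n : nat) : nonpole a -> Gamma (a + RtoC (INR n)) = rising a n * Gamma a.
Proof.
  intros Ha; induction n as [| n IH].
  - simpl; rewrite Cplus_0_r; ring.
  - rewrite S_INR, RtoC_plus, Cplus_assoc, Gamma_succ, IH by auto; simpl; ring.
Qed.

(** A zero at a would propagate to every a + n; but the imaginary part stays fixed while the real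
    part grows, so the lower bound eventually applies. *)
Lemma Gamma_neq_0 (a : C) : nonpole a -> Gamma a <> 0.
Proof.
  intros Ha H; destruct (INR_unbounded (2 + 4 * Im a ^ 2 - Re a)) as [n Hn].
  assert (H0 := pow2_ge_0 (Im a)).
  assert (HR : Re (a + RtoC (INR n)) = (Re a + INR n)%R) by (destruct a; reflexivity).
  assert (HI : Im (a + RtoC (INR n)) = Im a) by (destruct a; simpl; ring).
  generalize (Gamma_lower_bound (a + RtoC (INR n))); rewrite Gamma_rising, H, Cmult_0_r, Cmod_0, HR, HI by auto.
  intros H1; specialize (H1 ltac:(lra) ltac:(lra)).
  generalize (Re_Gamma_ge_1 (Re a + INR n) ltac:(lra)); lra.
Qed.

Lemma poch_rising (a : C) (n : nat) : nonpole a -> poch a n = rising a n.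
Proof.
  intros Ha; unfold poch; rewrite Gamma_rising by auto; field; now apply Gamma_neq_0.
Qed.

Lemma Re_near (a h : C) (r : R) : (Cmod h < r)%R -> (Re a - r < Re (a + h) < Re a + r)%R.
Proof.
  intros Hh; generalize (re_le_Cmod h); intros H1.
  assert (H2 : (Rabs (Re h) < r)%R) by lra; apply Rabs_def2 in H2.
  change (Re (a + h)) with (Re a + Re h)%R; lra.
Qed.

(** Differentiation under the integral for Re a > 1, then Gamma w = Gamma (w + 1) / w; the radius
    |a| keeps a + h away from 0. *)
Lemma ex_derive_Gamma (a : C) : nonpole a -> exists d : C, is_derive_C Gamma a d.
Proof.
  revert a; apply (nonpole_ind 1).
  - intros a Ha.
    assert (H1 : (0 < Re 1)%R) by (simpl; lra).
    assert (R1 : (Rabs 1 <= 1)%R) by (rewrite Rabs_R1; lra).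
    assert (R0 : (Rabs 0 <= 1)%R) by (rewrite Rabs_R0; lra).
    destruct (ex_IntC_log_derivative a 0 1 1 0 0 Ha H1 R1 R0 R0) as [d Hd]; exists d.
    apply (is_derive_laplace_int a 0 1 1 0 0 Ha H1 R1 R0 R0) in Hd.
    apply (proj1 (is_derive_C_at_0 Gamma a d)).
    refine (is_derive_C_ext_near _ _ _ _ 1 Rlt_0_1 _ Hd).
    intros h Hh; rewrite Cplus_0_l, Gamma_laplace_int by (generalize (Re_near a h 1 Hh); lra).
    f_equal; ring.
  - intros a Ha [d Hd].
    assert (Ha0 := nonpole_neq_0 a Ha); assert (Hm := proj1 (Cmod_gt_0 a) Ha0).
    eexists; apply (is_derive_C_ext_near (fun w => Gamma (1 + w) * / w) _ _ _ (Cmod a)); [auto | |].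
    + intros h Hh.
      assert (a + h <> 0).
      { intros E; replace h with (- a) in Hh by (rewrite <- (Cplus_0_r (-a)), <- E; ring).
        rewrite Cmod_opp in Hh; lra. }
      rewrite (Cplus_comm 1), Gamma_succ by auto; field; auto.
    + apply is_derive_C_mult.
      * apply (proj2 (is_derive_C_shift Gamma 1 a d)); rewrite Cplus_comm; exact Hd.
      * now apply is_derive_Cinv.
Qed.

Lemma digamma_eq (a d : C) : is_derive_C Gamma a d -> digamma a = d / Gamma a.
Proof. intros Hd; unfold digamma; now rewrite (is_C_derive_unique _ _ _ Hd). Qed.

Lemma digamma_succ (a : C) : nonpole a -> digamma (a + 1) = digamma a + / a.
Proof.
  intros Ha; destruct (ex_derive_Gamma a Ha) as [d Hd].
  assert (Ha0 := nonpole_neq_0 a Ha); assert (Hm := proj1 (Cmod_gt_0 a) Ha0).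
  assert (Hd1 : is_derive_C Gamma (a + 1) (1 * Gamma a + a * d)).
  { rewrite (Cplus_comm a); apply (proj1 (is_derive_C_shift Gamma 1 a _)).
    apply (is_derive_C_ext_near (fun w => w * Gamma w) _ _ _ (Cmod a)); [auto | |].
    - intros h Hh.
      assert (a + h <> 0).
      { intros E; replace h with (- a) in Hh by (rewrite <- (Cplus_0_r (-a)), <- E; ring).
        rewrite Cmod_opp in Hh; lra. }
      rewrite (Cplus_comm 1), Gamma_succ by auto; reflexivity.
    - apply is_derive_C_mult; [apply is_derive_C_id | exact Hd]. }
  rewrite (digamma_eq _ _ Hd), (digamma_eq _ _ Hd1), Gamma_succ by auto.
  field; split; auto; now apply Gamma_neq_0.
Qed.

(** * The upper incomplete Gamma function *)

Lemma RtoC_m1 : RtoC (-1) = - (1).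
Proof. now rewrite <- RtoC_opp. Qed.

Lemma is_derive_C_real (f : C -> C) (s : R) (l : C) :
  is_derive_C f (RtoC s) l -> is_derive (V := C_R_NormedModule) (fun s => f (RtoC s)) s l.
Proof.
  rewrite is_derive_C_iff; intros Hf; split.
  - apply (is_linear_scal_l (K := R_AbsRing) (V := C_R_NormedModule)).
  - intros w Hw.
    apply (is_filter_lim_locally_unique (K := R_AbsRing) (V := R_NormedModule)) in Hw; subst w.
    intros eps; destruct (Hf eps (cond_pos eps)) as [d [Hd0 Hd]].
    exists (mkposreal _ Hd0); intros y Hy.
    change (Rabs (y - s) < d)%R in Hy.
    specialize (Hd (RtoC (y - s))); rewrite Cmod_R in Hd; specialize (Hd Hy).
    rewrite norm_C_R.
    replace (RtoC s + RtoC (y - s)) with (RtoC y) in Hd by (rewrite RtoC_minus; ring).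
    refine (Rle_trans _ _ _ (Req_le _ _ (f_equal Cmod _)) Hd).
    apply injective_projections; unfold minus, plus, opp, scal; simpl;
      unfold plus, opp, scal, mult; simpl; unfold mult; simpl; ring.
Qed.

Notation IntU x f l :=
  (is_RInt_gen (V := C_R_NormedModule) f (at_point x) (Rbar_locally p_infty) l).

Lemma interval_ge (x : R) : interval (fun t => x <= t)%R.
Proof. intros a b t Ha Hb [H _]; revert H; unfold Rmin; destruct Rle_dec; lra. Qed.

Lemma infty_ge (x : R) : Rbar_locally p_infty (fun t => x <= t)%R.
Proof. exists x; intros; lra. Qed.

Lemma filterlim_at_point (V : UniformSpace) (f : R -> V) (x : R) :
  filterlim f (at_point x) (locally (f x)).
Proof. intros P HP; apply (locally_singleton _ _ HP). Qed.

Lemma ex_IntU_kern (nu : C) (x : R) : (0 < x)%R -> exists l : C, IntU x (kern (nu - 1) 0 1) l.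
Proof.
  (* Re nu is arbitrary, but the envelope needs a positive exponent. On t >= x the exponent may be
     raised from Re nu to p at the cost of the constant x^(Re nu - p). *)
  intros Hx; set (p := (Rabs (Re nu) + 1)%R).
  assert (Hp : (0 < p)%R) by (unfold p; generalize (Rabs_pos (Re nu)); lra).
  assert (Hp1 : (Re nu <= p)%R) by (unfold p; generalize (Rle_abs (Re nu)); lra).
  destruct (weight_envelope p 0 1 Hp Rlt_0_1) as [M [HM HB]].
  set (K := (exp ((Re nu - p) * ln x) * M)%R).
  apply (ex_RInt_gen_dominated _ (fun t => K * envelope' p t)%R (fun t => K * envelope p t)%R
    (fun t => x <= t)%R (at_point x) (Rbar_locally p_infty) (K * envelope p x)%R (K * 0)%R).
  - apply interval_ge.
  - apply Rle_refl.
  - apply infty_ge.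
  - intros t Ht; apply continuous_kern; lra.
  - intros t Ht; destruct (envelope_derive p t ltac:(lra)) as [H1 H2]; split.
    + now apply is_derive_scal.
    + apply (continuous_scal_r (K := R_AbsRing) (V := R_NormedModule)), H2.
  - intros t Ht; rewrite Cmod_kern.
    apply Rle_trans with (exp ((Re nu - p) * ln x) * weight (p - 1) 0 1 t)%R.
    + unfold weight; rewrite <- exp_plus; apply exp_le_exp.
      assert (ln x <= ln t)%R by (apply ln_le; lra).
      replace (Re (nu - 1)) with (Re nu - 1)%R by (destruct nu; reflexivity); simpl Re.
      nra.
    + unfold K; rewrite Rmult_assoc; apply Rmult_le_compat_l; [left; apply exp_pos |]; apply HB; lra.
  - apply (filterlim_at_point R_UniformSpace (fun t => K * envelope p t)%R).
  - apply (filterlim_comp _ _ _ (envelope p) (fun u => K * u)%R _ (locally 0%R)); [now apply envelope_at_infty |].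
    apply (filterlim_scal_r (K := R_AbsRing) (V := R_NormedModule)).
Qed.

Lemma IntU_ext (x : R) (f g : R -> C) (l : C) :
  (forall t, (x <= t)%R -> f t = g t) -> IntU x f l -> IntU x g l.
Proof.
  intros H; apply is_RInt_gen_ext.
  apply filter_prod_domain with (fun t => x <= t)%R; [apply Rle_refl | apply infty_ge |].
  intros a b Ha Hb t Ht; apply H, (interval_ge x a b); simpl in *; auto; lra.
Qed.

Lemma Gamma_upper_correct (nu : C) (x : R) : (0 < x)%R -> IntU x (kern (nu - 1) 0 1) (Gamma_upper nu x).
Proof.
  intros Hx; destruct (ex_IntU_kern nu x Hx) as [l Hl].
  replace (Gamma_upper nu x) with l; [exact Hl |].
  symmetry; unfold Gamma_upper, CInt_gen.
  apply (is_RInt_gen_unique (V := C_R_CompleteNormedModule)).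
  apply (IntU_ext x) with (2 := Hl).
  intros t Ht; rewrite Cpower_pos by lra; unfold kern.
  rewrite <- Cexp_R, <- Cexp_plus; f_equal; rewrite RtoC_opp; ring.
Qed.

(** Integration by parts, with the boundary term x^nu e^(-x) at the finite end. *)
Lemma Gamma_upper_succ (nu : C) (x : R) : (0 < x)%R ->
  Gamma_upper (nu + 1) x = nu * Gamma_upper nu x + Cexp (nu * RtoC (ln x)) * RtoC (exp (- x)).
Proof.
  intros Hx.
  assert (H1 : IntU x (fun t => nu * kern (nu - 1) 0 1 t - kern nu 0 1 t) (0 - kern nu 0 1 x)).
  { apply (is_RInt_gen_antiderivative C_R_CompleteNormedModule (kern nu 0 1) _ (fun t => x <= t)%R);
      try typeclasses eauto.
    - apply interval_ge.
    - apply Rle_refl.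
    - apply infty_ge.
    - intros t Ht; assert (Ht0 : (0 < t)%R) by lra; split.
      + generalize (is_derive_kern nu 0 1 t Ht0).
        rewrite kern_total_derivative by exact Ht0.
        now replace (nu * kern (nu - 1) 0 1 t + 0 * kern nu (0 - 1) 1 t - 1 * kern nu 0 1 t)
          with (nu * kern (nu - 1) 0 1 t - kern nu 0 1 t) by ring.
      + apply (continuous_minus (V := C_R_NormedModule)); [| now apply continuous_kern].
        apply (continuous_comp (V := C_R_NormedModule) (W := C_R_NormedModule) (kern (nu - 1) 0 1) (fun v => nu * v)).
        * now apply continuous_kern.
        * apply linear_cont, is_linear_Cmult_l.
    - apply (filterlim_at_point C_R_NormedModule).
    - apply kern_at_infty; simpl; lra. }
  assert (H2 := Gamma_upper_correct nu x Hx).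
  apply (is_RInt_gen_Cmult_l nu) in H2.
  assert (H3 := is_RInt_gen_minus (V := C_R_NormedModule) _ _ _ _ H2 H1).
  apply (IntU_ext x _ (kern (nu + 1 - 1) 0 1)) in H3.
  - rewrite (is_RInt_gen_C_unique _ _ _ (Gamma_upper_correct (nu + 1) x Hx) H3).
    replace (Cexp (nu * RtoC (ln x)) * RtoC (exp (- x))) with (kern nu 0 1 x).
    + change (nu * Gamma_upper nu x - (0 - kern nu 0 1 x) = nu * Gamma_upper nu x + kern nu 0 1 x); ring.
    + unfold kern; rewrite <- Cexp_R, <- Cexp_plus; f_equal; rewrite RtoC_opp; ring.
  - intros t _; replace (nu + 1 - 1) with nu by ring.
    change (nu * kern (nu - 1) 0 1 t - (nu * kern (nu - 1) 0 1 t - kern nu 0 1 t) = kern nu 0 1 t); ring.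
Qed.

Lemma exp_opp_at_infty : filterlim (fun t => exp (- t))%R (Rbar_locally p_infty) (locally 0%R).
Proof.
  intros P [e HP]; exists (- ln e)%R; intros t Ht; apply HP.
  change (Rabs (exp (- t) - 0) < e)%R; rewrite Rminus_0_r, Rabs_pos_eq by (left; apply exp_pos).
  rewrite <- (exp_ln e) by apply cond_pos; apply exp_increasing; lra.
Qed.

(** For t >= x one has |t^(-a)| <= x^(-Re a), and the remaining integral of e^(-t) is exact. *)
Lemma Cmod_Gamma_upper_le (a : C) (x : R) : (0 < x)%R -> (0 < Re a)%R ->
  (Cmod (Gamma_upper (1 - a) x) <= exp (- Re a * ln x) * exp (- x))%R.
Proof.
  intros Hx Ha; set (K := exp (- Re a * ln x)); assert (HK : (0 < K)%R) by apply exp_pos.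
  replace (K * exp (- x))%R with (Rabs (0 - - K * exp (- x))).
  2: { rewrite Rabs_pos_eq; [ring |]; generalize (exp_pos (- x)); nra. }
  apply (Cmod_RInt_gen_le (kern (1 - a - 1) 0 1) (fun t => K * exp (- t))%R (fun t => - K * exp (- t))%R
    (fun t => x <= t)%R (at_point x) (Rbar_locally p_infty)).
  - apply interval_ge.
  - apply Rle_refl.
  - apply infty_ge.
  - intros t Ht; apply continuous_kern; lra.
  - intros t Ht; split; [auto_derive; auto; ring |].
    apply (ex_derive_continuous (V := R_NormedModule)); auto_derive; auto.
  - intros t Ht; rewrite Cmod_kern; unfold K, weight; rewrite <- exp_plus; apply exp_le_exp.
    assert (ln x <= ln t)%R by (apply ln_le; lra).
    replace (Re (1 - a - 1)) with (- Re a)%R by (destruct a; simpl; ring); simpl Re; nra.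
  - apply (filterlim_at_point R_UniformSpace (fun t => - K * exp (- t))%R).
  - replace (locally 0%R) with (locally (- K * 0)%R) by (f_equal; ring).
    apply (filterlim_comp _ _ _ (fun t => exp (- t))%R (fun u => - K * u)%R _ (locally 0%R)).
    + apply exp_opp_at_infty.
    + apply (filterlim_scal_r (K := R_AbsRing) (V := R_NormedModule)).
  - now apply Gamma_upper_correct.
Qed.

(* [y(s) = laplace_int a (-1) s] satisfies [y' - y = - Gamma(a) s^(-a)], so that [e^(-s) y(s)] is an
   antiderivative of [- Gamma(a) s^(-a) e^(-s)]. *)
Lemma laplace_int_m1 (a : C) (x : R) : (1 < Re a)%R -> (0 < x)%R ->
  laplace_int a (- (1)) (RtoC x) = Gamma a * (RtoC (exp x) * Gamma_upper (1 - a) x).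
Proof.
  intros Ha Hx.
  set (G := fun w => Cexp (- w) * laplace_int a (- (1)) w).
  assert (HG : forall s, (0 < s)%R ->
    is_derive (V := C_R_NormedModule) (fun s => G (RtoC s)) s (- Gamma a * kern (- a) 0 1 s)).
  { intros s Hs; apply is_derive_C_real.
    assert (Hs1 : (0 < Re (RtoC s))%R) by exact Hs.
    assert (R1 : (Rabs 1 <= 1)%R) by (rewrite Rabs_R1; lra).
    assert (R0 : (Rabs 0 <= 1)%R) by (rewrite Rabs_R0; lra).
    assert (Hint1 : IntC (fun t => RtoC (0 * ln t + 0 * ln (1 + t) - 1 * t) * kern (a - 1) (- (1)) (RtoC s) t)
      (RtoC (-1) * laplace_int (a + 1) (- (1)) (RtoC s))).
    { apply (IntC_ext (fun t => RtoC (-1) * kern (a + 1 - 1) (- (1)) (RtoC s) t)).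
      - intros t Ht; replace (a + 1 - 1) with (a - 1 + 1) by ring; rewrite kern_succ_p by auto.
        replace (RtoC (0 * ln t + 0 * ln (1 + t) - 1 * t)) with (RtoC (-1) * RtoC t)
          by (rewrite <- RtoC_mult; f_equal; ring); ring.
      - apply IntC_scal, laplace_int_correct; auto; rewrite Re_plus_1; lra. }
    assert (HD := is_derive_laplace_int a (- (1)) (RtoC s) 0 0 1 Ha Hs1 R0 R0 R1 _ Hint1).
    assert (HD1 : is_derive_C (fun w => laplace_int a (- (1)) w) (RtoC s) (RtoC (-1) * laplace_int (a + 1) (- (1)) (RtoC s))).
    { apply (proj1 (is_derive_C_at_0 _ _ _)).
      refine (is_derive_C_ext_near _ _ _ _ 1 Rlt_0_1 _ HD).
      intros h _; rewrite Cplus_0_l; f_equal; ring. }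
    assert (HE : is_derive_C (fun w => Cexp (- w)) (RtoC s) (RtoC (-1) * Cexp (- RtoC s))).
    { apply (is_derive_C_comp Cexp Copp); [apply is_derive_Cexp_C |].
      refine (is_derive_C_ext_near _ _ _ _ 1 Rlt_0_1 _ (is_derive_C_affine 0 (RtoC (-1)) (RtoC s))).
      intros h _; rewrite RtoC_m1; ring. }
    apply (is_derive_C_eq _ _ _ _ (is_derive_C_mult _ _ _ _ _ HE HD1)).
    (* By contiguity y - y' is the integral with q = 0, which scaling evaluates as Gamma (a)
       s^(-a). *)
    assert (HS := laplace_int_scale a s ltac:(lra) Hs).
    rewrite <- Gamma_laplace_int in HS by lra.
    rewrite (laplace_int_contiguous a 0 (RtoC s)) in HS by (auto; lra).
    replace (0 - 1) with (- (1)) in HS by ring.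
    replace (kern (- a) 0 1 s) with (Cexp (- RtoC s) * Cexp (- a * RtoC (ln s))).
    2: { unfold kern; rewrite <- Cexp_plus; f_equal; ring. }
    replace (- Gamma a * (Cexp (- RtoC s) * Cexp (- a * RtoC (ln s)))) with
      (- Cexp (- RtoC s) * (Cexp (- a * RtoC (ln s)) * Gamma a)) by ring.
    rewrite <- HS, RtoC_m1; ring. }
  assert (HI : IntU x (fun s => - Gamma a * kern (- a) 0 1 s) (0 - G (RtoC x))).
  { apply (is_RInt_gen_antiderivative C_R_CompleteNormedModule (fun s => G (RtoC s)) _ (fun t => x <= t)%R);
      try typeclasses eauto.
    - apply interval_ge.
    - apply Rle_refl.
    - apply infty_ge.
    - intros t Ht; split; [apply HG; lra |].
      apply (continuous_comp (V := C_R_NormedModule) (W := C_R_NormedModule) (kern (- a) 0 1) (fun v => - Gamma a * v)).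
      + apply continuous_kern; lra.
      + apply linear_cont, is_linear_Cmult_l.
    - apply (filterlim_at_point C_R_NormedModule (fun s => G (RtoC s))).
    (* For s >= x the integrals y(s) are bounded by J, since e^(-st) <= e^(-xt) and (1 + t)^(-1) <=
       1; the factor e^(-s) then gives the limit 0. *)
    - set (J := Re (laplace_int (RtoC (Re a)) 0 (RtoC x))).
      apply (filterlim_C_0 _ _ (fun t => J * exp (- t))%R).
      + apply (filter_imp (F := Rbar_locally p_infty) (fun t => x <= t)%R); [| apply infty_ge].
        intros s Hs; unfold G; rewrite Cmod_mult, Cmod_Cexp, Rmult_comm.
        apply Rmult_le_compat_r; [left; apply exp_pos |].
        apply (IntC_Cmod_le (kern (a - 1) (- (1)) (RtoC s)) (kern (RtoC (Re a) - 1) 0 (RtoC x))).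
        * intros t Ht; rewrite Cmod_kern, <- RtoC_minus, kern_real.
          change (Re (RtoC (weight (Re a - 1) 0 x t))) with (weight (Re a - 1) 0 x t).
          apply exp_le_exp; assert (Hl := ln_1p_pos t Ht).
          assert (x * t <= s * t)%R by (apply Rmult_le_compat_r; lra).
          replace (Re (a - 1)) with (Re a - 1)%R by (destruct a; reflexivity).
          replace (Re (- (1))) with (-1)%R by (simpl; ring).
          change (Re (RtoC s)) with s; lra.
        * apply laplace_int_correct; simpl; lra.
        * apply laplace_int_correct; simpl; lra.
      + replace (locally 0%R) with (locally (J * 0)%R) by (f_equal; ring).
        apply (filterlim_comp _ _ _ (fun t => exp (- t))%R (fun u => J * u)%R _ (locally 0%R)).
        * apply exp_opp_at_infty.
        * apply (filterlim_scal_r (K := R_AbsRing) (V := R_NormedModule)). }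
  assert (HU := Gamma_upper_correct (1 - a) x Hx).
  apply (is_RInt_gen_Cmult_l (- Gamma a)) in HU.
  replace (1 - a - 1) with (- a) in HU by ring.
  assert (HE := is_RInt_gen_C_unique _ _ _ HI HU); unfold G in HE.
  rewrite <- RtoC_opp, Cexp_R, exp_Ropp, RtoC_inv in HE by (generalize (exp_pos x); lra).
  assert (Hx0 : RtoC (exp x) <> 0) by (apply RtoC_neq_0, exp_pos).
  transitivity (RtoC (exp x) * - (0 - / RtoC (exp x) * laplace_int a (- (1)) (RtoC x))); [field; auto |].
  rewrite HE; ring.
Qed.

(** * The Tricomi function *)

(* [tricomi_cont] in the parameters [a] and [q = b - a - 1], the exponents of the Laplace integral. *)
Definition tricomiV (x : R) (n : nat) (a q : C) : C := tricomi_cont n a (a + q + 1) x.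

Lemma tricomiV_0 (x : R) (a q : C) : (0 < x)%R -> (0 < Re a)%R ->
  tricomiV x 0 a q = / Gamma a * laplace_int a q (RtoC x).
Proof.
  intros Hx Ha; unfold tricomiV; simpl; unfold tricomi_int; f_equal.
  apply (is_RInt_gen_unique (V := C_R_CompleteNormedModule)).
  apply (IntC_ext (kern (a - 1) q (RtoC x))); [| now apply laplace_int_correct].
  intros t Ht; rewrite !Cpower_pos by lra; unfold kern.
  rewrite <- Cexp_R, <- !Cexp_plus; f_equal; rewrite RtoC_opp, RtoC_mult; ring.
Qed.

(** In these parameters a + 1 - b = - q. *)
Lemma tricomiV_S (x : R) (n : nat) (a q : C) :
  tricomiV x (S n) a q = RtoC x * tricomiV x n (a + 1) q - q * tricomiV x n (a + 1) (q - 1).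
Proof.
  unfold tricomiV; simpl.
  replace (a + 1 + q + 1) with (a + q + 1 + 1) by ring.
  replace (a + 1 + (q - 1) + 1) with (a + q + 1) by ring.
  ring.
Qed.

Lemma tricomiV_stable (x : R) (n : nat) (a q : C) : (0 < x)%R -> (0 < Re a + INR n)%R ->
  tricomiV x (S n) a q = tricomiV x n a q.
Proof.
  intros Hx; revert a q; induction n as [| n IH]; intros a q Ha.
  - simpl in Ha; assert (Ha0 : (0 < Re a)%R) by lra.
    assert (Ha1 : (0 < Re (a + 1))%R) by (rewrite Re_plus_1; lra).
    assert (Hn := nonpole_pos a Ha0).
    rewrite tricomiV_S, !tricomiV_0 by auto.
    rewrite Gamma_succ by now apply nonpole_neq_0.
    transitivity (/ (a * Gamma a) * (a * laplace_int a q (RtoC x))).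
    + rewrite laplace_int_parts by auto; ring.
    + field; split; [now apply Gamma_neq_0 | now apply nonpole_neq_0].
  - rewrite (tricomiV_S x (S n) a q), (tricomiV_S x n a q).
    rewrite !IH by (rewrite Re_plus_1; rewrite S_INR in Ha; lra); reflexivity.
Qed.

(** Frees the depth of continuation, so that all points near a can share one n when
    differentiating. *)
Lemma tricomiV_eq (x : R) (n m : nat) (a q : C) : (0 < x)%R ->
  (0 < Re a + INR n)%R -> (0 < Re a + INR m)%R -> tricomiV x n a q = tricomiV x m a q.
Proof.
  intros Hx.
  assert (Hle : forall m k, (0 < Re a + INR m)%R -> tricomiV x (k + m) a q = tricomiV x m a q).
  { clear n m; intros m k Hm; induction k as [| k IH]; [reflexivity |].
    rewrite <- IH; apply (tricomiV_stable x (k + m)); auto.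
    rewrite plus_INR; generalize (pos_INR k); lra. }
  intros Hn Hm; destruct (Nat.le_ge_cases n m).
  - replace m with (m - n + n)%nat by lia; symmetry; now apply Hle.
  - replace n with (n - m + m)%nat by lia; now apply Hle.
Qed.

(** For Re a > 0 this is [laplace_int_contiguous], the factor a coming from Gamma (a + 1) = a Gamma
    a; the continuation relation carries it to the left. *)
Lemma tricomiV_contiguous (x : R) (n : nat) (a q : C) : (0 < x)%R -> (0 < Re a + INR n)%R ->
  tricomiV x n a q = tricomiV x n a (q - 1) + a * tricomiV x n (a + 1) (q - 1).
Proof.
  intros Hx; revert a q; induction n as [| n IH]; intros a q Ha.
  - simpl in Ha; assert (Ha0 : (0 < Re a)%R) by lra.
    assert (Ha1 : (0 < Re (a + 1))%R) by (rewrite Re_plus_1; lra).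
    assert (Hn := nonpole_pos a Ha0).
    rewrite !tricomiV_0 by auto.
    rewrite Gamma_succ by now apply nonpole_neq_0.
    rewrite (laplace_int_contiguous a q) by auto.
    field; split; [now apply Gamma_neq_0 | now apply nonpole_neq_0].
  - rewrite S_INR in Ha.
    assert (Ha1 : (0 < Re (a + 1) + INR n)%R) by (rewrite Re_plus_1; lra).
    rewrite (tricomiV_S x n a q), (tricomiV_S x n a (q - 1)).
    rewrite (tricomiV_stable x n (a + 1)) by auto.
    assert (E1 := tricomiV_stable x n (a + 1) (q - 1) Hx Ha1); rewrite tricomiV_S in E1.
    rewrite (IH (a + 1) q) by auto.
    assert (E2 := IH (a + 1) (q - 1) Ha1).
    set (A := tricomiV x n (a + 1) (q - 1)) in *; set (B := tricomiV x n (a + 1) (q - 1 - 1)) in *.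
    set (C' := tricomiV x n (a + 1 + 1) (q - 1)) in *; set (D' := tricomiV x n (a + 1 + 1) (q - 1 - 1)) in *.
    (* The continuation relation at (a + 1, q - 1), available at the same depth by stability,
       eliminates C'. *)
    assert (E3 : RtoC x * C' = A + (q - 1) * D') by (rewrite <- E1; ring).
    replace (RtoC x * (A + (a + 1) * C')) with (RtoC x * A + (a + 1) * (RtoC x * C')) by ring.
    rewrite E3, E2; ring.
Qed.

(** U (a, a + 1, x) = x^(-a): for q = 0 the integral is a scaled Gamma integral, and the second term
    of the recurrence drops out. *)
Lemma tricomiV_q0 (x : R) (n : nat) (a : C) : (0 < x)%R -> (0 < Re a + INR n)%R ->
  tricomiV x n a 0 = Cexp (- a * RtoC (ln x)).
Proof.
  intros Hx; revert a; induction n as [| n IH]; intros a Ha.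
  - simpl in Ha; assert (Ha0 : (0 < Re a)%R) by lra.
    rewrite tricomiV_0, laplace_int_scale, <- Gamma_laplace_int by auto.
    field; now apply Gamma_neq_0, nonpole_pos.
  - rewrite tricomiV_S, IH by (rewrite Re_plus_1; rewrite S_INR in Ha; lra).
    replace (RtoC x) with (Cexp (RtoC (ln x))) at 1 by (rewrite Cexp_R, exp_ln; auto).
    rewrite <- Cexp_plus, Cmult_0_l; unfold Cminus; rewrite Copp_0, Cplus_0_r; f_equal; ring.
Qed.

(** U (a, a, x) = e^x Gamma (1 - a, x). The descent compares the contiguous relation at q = 0 with
    the recurrence of the upper incomplete function. *)
Lemma tricomiV_qm1 (x : R) (a : C) : (0 < x)%R -> nonpole a ->
  forall n, (0 < Re a + INR n)%R -> tricomiV x n a (- (1)) = RtoC (exp x) * Gamma_upper (1 - a) x.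
Proof.
  intros Hx; revert a; apply (nonpole_ind 1 (fun a => forall n, (0 < Re a + INR n)%R ->
    tricomiV x n a (- (1)) = RtoC (exp x) * Gamma_upper (1 - a) x)).
  - intros a Ha n Hn.
    rewrite (tricomiV_eq x n 0), tricomiV_0, laplace_int_m1 by (simpl; auto; lra).
    field; apply Gamma_neq_0, nonpole_pos; lra.
  - intros a Ha IH n Hn.
    assert (E1 := tricomiV_contiguous x n a 0 Hx Hn).
    replace (0 - 1) with (- (1)) in E1 by ring.
    rewrite tricomiV_q0, IH in E1 by (try rewrite Re_plus_1; auto; lra).
    assert (E2 := Gamma_upper_succ (1 - (a + 1)) x Hx).
    replace (1 - (a + 1) + 1) with (1 - a) in E2 by ring.
    replace (1 - (a + 1)) with (- a) in E1, E2 by ring.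
    rewrite E2.
    replace (tricomiV x n a (- (1))) with (Cexp (- a * RtoC (ln x)) - a * (RtoC (exp x) * Gamma_upper (- a) x))
      by (rewrite E1; ring).
    rewrite exp_Ropp, RtoC_inv by (generalize (exp_pos x); lra).
    field; apply RtoC_neq_0, exp_pos.
Qed.

(* The parameters move along [(a + h, q + h)] because [a = 1/2 + m - kappa] and [b - a - 1 = m + kappa - 1/2]. *)
Lemma ex_derive_tricomiV (x : R) (n : nat) (a q : C) : (0 < x)%R -> (1 < Re a + INR n)%R ->
  exists l : C, is_derive_C (fun h => tricomiV x n (a + h) (q + h)) (RtoC 0) l.
Proof.
  intros Hx; revert a q; induction n as [| n IH]; intros a q Ha.
  - simpl in Ha; assert (Ha0 : (1 < Re a)%R) by lra.
    assert (R1 : (Rabs 1 <= 1)%R) by (rewrite Rabs_R1; lra).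
    assert (R0 : (Rabs 0 <= 1)%R) by (rewrite Rabs_R0; lra).
    assert (Hx1 : (0 < Re (RtoC x))%R) by exact Hx.
    destruct (ex_IntC_log_derivative a q (RtoC x) 1 1 0 Ha0 Hx1 R1 R1 R0) as [d Hd].
    apply (is_derive_laplace_int a q (RtoC x) 1 1 0 Ha0 Hx1 R1 R1 R0) in Hd.
    destruct (ex_derive_Gamma a ltac:(apply nonpole_pos; lra)) as [g Hg].
    apply (proj2 (is_derive_C_at_0 Gamma a g)) in Hg.
    assert (Hg0 : Gamma (a + 0) <> 0) by (rewrite Cplus_0_r; apply Gamma_neq_0, nonpole_pos; lra).
    apply (is_derive_C_inv (fun h => Gamma (a + h)) 0 g Hg0) in Hg.
    eexists; refine (is_derive_C_ext_near _ _ _ _ 1 Rlt_0_1 _ (is_derive_C_mult _ _ _ _ _ Hg Hd)).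
    intros h Hh; rewrite Cplus_0_l, tricomiV_0 by (auto; generalize (Re_near a h 1 Hh); lra).
    f_equal; f_equal; ring.
  - rewrite S_INR in Ha.
    assert (Ha1 : (1 < Re (a + 1) + INR n)%R) by (rewrite Re_plus_1; lra).
    destruct (IH (a + 1) q Ha1) as [d1 H1]; destruct (IH (a + 1) (q - 1) Ha1) as [d2 H2].
    assert (H3 := is_derive_C_affine q 1 (RtoC 0)).
    eexists; refine (is_derive_C_ext_near _ _ _ _ 1 Rlt_0_1 _
      (is_derive_C_minus _ _ _ _ _ (is_derive_C_scal (RtoC x) _ _ _ H1) (is_derive_C_mult _ _ _ _ _ H3 H2))).
    intros h _; rewrite tricomiV_S, !Cplus_0_l, Cmult_1_l.
    replace (a + 1 + h) with (a + h + 1) by ring.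
    replace (q - 1 + h) with (q + h - 1) by ring; reflexivity.
Qed.

(** Along q = h the second term of the recurrence has the factor h, so its derivative at 0 is the
    value U (a + 1, a + 1, x) of the other, differentiable, factor. *)
Lemma is_derive_tricomiV_S (x : R) (n : nat) (a k : C) : (0 < x)%R -> (0 < Re a + INR n)%R -> nonpole a ->
  is_derive_C (fun h => tricomiV x n (a + 1 + h) h) (RtoC 0) k ->
  is_derive_C (fun h => tricomiV x (S n) (a + h) h) (RtoC 0) (RtoC x * k - RtoC (exp x) * Gamma_upper (- a) x).
Proof.
  intros Hx Hn Ha Hk.
  destruct (ex_derive_tricomiV x n (a + 1) (- (1)) Hx) as [d Hd].
  { rewrite Re_plus_1; lra. }
  assert (HD := is_derive_C_minus _ _ _ _ _ (is_derive_C_scal (RtoC x) _ _ _ Hk)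
      (is_derive_C_mult _ _ _ _ _ (is_derive_C_id (RtoC 0)) Hd)).
  cbv beta in HD.
  rewrite !Cplus_0_r, tricomiV_qm1, Cmult_0_l, Cplus_0_r, Cmult_1_l in HD
    by first [exact Hx | now apply nonpole_succ | rewrite Re_plus_1; lra].
  replace (1 - (a + 1)) with (- a) in HD by ring.
  refine (is_derive_C_ext_near _ _ _ _ 1 Rlt_0_1 _ HD).
  intros h _; rewrite tricomiV_S, !Cplus_0_l.
  replace (a + 1 + h) with (a + h + 1) by ring.
  replace (- (1) + h) with (h - 1) by ring; reflexivity.
Qed.

Lemma is_derive_tricomiV_n (x : R) (n m : nat) (a k : C) : (0 < x)%R ->
  (0 < Re a + INR n)%R -> (0 < Re a + INR m)%R ->
  is_derive_C (fun h => tricomiV x n (a + h) h) (RtoC 0) k ->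
  is_derive_C (fun h => tricomiV x m (a + h) h) (RtoC 0) k.
Proof.
  intros Hx Hn Hm Hk.
  set (r := Rmin (Re a + INR n) (Re a + INR m)).
  assert (Hr : (0 < r)%R) by now apply Rmin_glb_lt.
  refine (is_derive_C_ext_near _ _ _ _ r Hr _ Hk).
  intros h Hh; rewrite Cplus_0_l.
  assert (H1 := Re_near a h r Hh).
  assert (r <= Re a + INR n)%R by apply Rmin_l.
  assert (r <= Re a + INR m)%R by apply Rmin_r.
  apply tricomiV_eq; auto; lra.
Qed.

(** * Power series *)

Notation is_series_C a l := (is_series (K := C_AbsRing) (V := C_NormedModule) a l).

Lemma CSeries_unique (a : nat -> C) (l : C) : is_series_C a l -> CSeries a = l.
Proof.
  intros Ha; unfold CSeries.
  apply (iota_filterlim_locally (K := C_AbsRing) (V := C_CompleteNormedModule) (F := eventually) (sum_n a) l Ha).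
Qed.

Lemma is_series_C_unique (a : nat -> C) (l l' : C) : is_series_C a l -> is_series_C a l' -> l = l'.
Proof. intros H H'; rewrite <- (CSeries_unique a l H); now apply CSeries_unique. Qed.

Lemma CSeries_correct (a : nat -> C) (b : nat -> R) :
  (forall n, (Cmod (a n) <= b n)%R) -> ex_series b -> is_series_C a (CSeries a).
Proof.
  intros Hab Hb.
  destruct (ex_series_le (K := C_AbsRing) (V := C_CompleteNormedModule) a b Hab Hb) as [l Hl].
  now rewrite (CSeries_unique a l Hl).
Qed.

Lemma Cmod_series_le (a : nat -> C) (b : nat -> R) (l : C) (m : R) :
  (forall n, (Cmod (a n) <= b n)%R) -> is_series_C a l -> is_series b m -> (Cmod l <= m)%R.
Proof.
  intros Hab Ha Hb; apply Rnot_lt_le; intros Hlt.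
  set (e := ((Cmod l - m) / 3)%R); assert (He : (0 < e)%R) by (unfold e; lra).
  assert (H1 : eventually (fun n => Cmod (sum_n (a : nat -> C_NormedModule) n - l) < e)%R).
  { apply (proj1 (filterlim_locally_ball_norm (K := C_AbsRing) (U := C_NormedModule) (F := eventually) _ _) Ha (mkposreal e He)). }
  assert (H2 : eventually (fun n => Rabs (sum_n b n - m) < e)%R).
  { apply (proj1 (filterlim_locally_ball_norm (K := R_AbsRing) (U := R_NormedModule) (F := eventually) _ _) Hb (mkposreal e He)). }
  destruct (filter_ex _ (filter_and _ _ H1 H2)) as [n [Hn1 Hn2]].
  assert (H3 : (Cmod (sum_n (a : nat -> C_NormedModule) n) <= sum_n b n)%R).
  { eapply Rle_trans; [apply (norm_sum_n_m (K := C_AbsRing) (V := C_NormedModule)) |].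
    apply sum_n_m_le; intros k; apply Hab. }
  assert (H4 : (Cmod l <= Cmod (sum_n (a : nat -> C_NormedModule) n) + Cmod (sum_n (a : nat -> C_NormedModule) n - l))%R).
  { set (u := sum_n (a : nat -> C_NormedModule) n) in *; clearbody u; change C in (type of u).
    replace l with (u + - (u - l)) at 1 by ring; rewrite <- (Cmod_opp (u - l)); apply Cmod_triangle. }
  unfold e in *; apply Rabs_def2 in Hn2; lra.
Qed.

Lemma is_series_C_minus (a b : nat -> C) (k l : C) :
  is_series_C a k -> is_series_C b l -> is_series_C (fun n => a n - b n) (k - l).
Proof. apply (is_series_minus (K := C_AbsRing) (V := C_NormedModule)). Qed.

Lemma is_series_C_scal (c : C) (a : nat -> C) (k : C) :
  is_series_C a k -> is_series_C (fun n => c * a n) (c * k).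
Proof. apply (is_series_scal (K := C_AbsRing) (V := C_NormedModule)). Qed.

Lemma is_series_C_ext (a b : nat -> C) (k : C) :
  (forall n, a n = b n) -> is_series_C a k -> is_series_C b k.
Proof. apply (is_series_ext (K := C_AbsRing) (V := C_NormedModule)). Qed.

Lemma is_series_C_decr (a : nat -> C) (k : C) :
  is_series_C (fun n => a (S n)) k -> is_series_C a (a 0%nat + k).
Proof.
  intros H; apply (is_series_decr_1 (K := C_AbsRing) (V := C_NormedModule)).
  refine (eq_ind k (fun l => is_series_C (fun n => a (S n)) l) H _ _).
  change (k = a 0%nat + k + - a 0%nat); ring.
Qed.

Lemma is_series_C_RtoC (b : nat -> R) (m : R) :
  is_series b m -> (forall n, (0 <= b n)%R) -> is_series_C (fun n => RtoC (b n)) (RtoC m).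
Proof.
  intros Hb Hp.
  assert (H : is_series_C (fun n => RtoC (b n)) (CSeries (fun n => RtoC (b n)))).
  { apply (CSeries_correct _ b); [| now exists m].
    intros n; rewrite Cmod_R, Rabs_pos_eq by auto; apply Rle_refl. }
  replace (RtoC m) with (CSeries (fun n => RtoC (b n))); [exact H |].
  assert (HS : forall n, sum_n (fun n => RtoC (b n) : C_NormedModule) n = RtoC (sum_n b n)).
  { intros n; induction n as [| n IH]; [now rewrite !sum_O |].
    rewrite !sum_Sn, IH; symmetry; apply RtoC_plus. }
  apply (is_series_C_unique (fun n => RtoC (b n))); [exact H |].
  apply (filterlim_locally_ball_norm (K := C_AbsRing) (U := C_NormedModule) (F := eventually)); intros eps.
  generalize (proj1 (filterlim_locally_ball_norm (K := R_AbsRing) (U := R_NormedModule) (F := eventually) _ _) Hb eps).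
  apply filter_imp; intros n Hn; change (Cmod (sum_n (fun n => RtoC (b n) : C_NormedModule) n - RtoC m) < eps)%R.
  rewrite HS, <- RtoC_minus, Cmod_R; exact Hn.
Qed.

Lemma Cmod_ge_Re (z : C) : (Re z <= Cmod z)%R.
Proof. generalize (re_le_Cmod z) (Rle_abs (Re z)); lra. Qed.

Lemma rising_ge (a : C) (n : nat) : (1 <= Re a)%R -> (INR (fact n) <= Cmod (rising a n))%R.
Proof.
  intros Ha; induction n as [| n IH]; [simpl; rewrite Cmod_1; lra |].
  rewrite fact_simpl, mult_INR, S_INR; simpl; rewrite Cmod_mult, Rmult_comm.
  apply Rmult_le_compat; [apply pos_INR | generalize (pos_INR n); lra | exact IH |].
  eapply Rle_trans; [| apply Cmod_ge_Re]; rewrite Re_plus_R; lra.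
Qed.

(** Bounds all denominators a + n at once, so the exponential series dominates [lower_term]. *)
Lemma nonpole_bounded_below (a : C) : nonpole a ->
  exists c, (0 < c)%R /\ forall n, (c <= Cmod (a + RtoC (INR n)))%R.
Proof.
  revert a; apply (nonpole_ind 1).
  - intros a Ha; exists 1%R; split; [lra |]; intros n.
    eapply Rle_trans; [| apply Cmod_ge_Re]; rewrite Re_plus_R; generalize (pos_INR n); lra.
  - intros a Ha [c [Hc H]].
    assert (Hm := proj1 (Cmod_gt_0 a) (nonpole_neq_0 a Ha)).
    exists (Rmin (Cmod a) c); split; [now apply Rmin_glb_lt |].
    intros [| n].
    + simpl; rewrite Cplus_0_r; apply Rmin_l.
    + eapply Rle_trans; [apply Rmin_r |].
      replace (a + RtoC (INR (S n))) with (a + 1 + RtoC (INR n)) by (rewrite S_INR, RtoC_plus; ring).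
      apply H.
Qed.

Lemma is_series_exp (x : R) : is_series (fun n => x ^ n / INR (fact n))%R (exp x).
Proof.
  generalize (is_exp_Reals x); rewrite is_pseries_R; apply is_series_ext.
  intros n; apply Rmult_comm.
Qed.

Lemma exp_term_pos (x : R) (n : nat) : (0 < x)%R -> (0 <= x ^ n / INR (fact n))%R.
Proof. intros Hx; left; apply Rdiv_lt_0_compat; [now apply pow_lt | apply INR_fact_lt_0]. Qed.

(* The only bounded solution of [(a + n) u_n = - x u_(n+1)] is 0, as [u_n / u_(n+1)] tends to 0. *)
Lemma recurrence_unique (x B : R) (a : C) (u : nat -> C) : (0 < x)%R -> nonpole a ->
  (forall n, (a + RtoC (INR n)) * u n = - (RtoC x * u (S n))) ->
  (forall n, (1 <= Re a + INR n)%R -> (Cmod (u n) <= B)%R) -> u 0%nat = 0.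
Proof.
  intros Hx Ha Hu HB.
  (* From M on, |a + n| >= 2 x, so |u_n| at least doubles at each step, and Re a + n >= 1, so the
     bound B is in force. *)
  destruct (INR_unbounded (2 * x + 1 - Re a)) as [M HM].
  assert (Hhalf : forall n, (M <= n)%nat -> (Cmod (u n) <= Cmod (u (S n)) / 2)%R).
  { intros n Hn; apply le_INR in Hn.
    apply (Rmult_le_reg_l (2 * x)); [lra |].
    apply Rle_trans with (Cmod ((a + RtoC (INR n)) * u n)).
    - rewrite Cmod_mult; apply Rmult_le_compat_r; [apply Cmod_ge_0 |].
      eapply Rle_trans; [| apply Cmod_ge_Re]; rewrite Re_plus_R; lra.
    - rewrite Hu, Cmod_opp, Cmod_mult, Cmod_R, Rabs_pos_eq by lra; lra. }
  assert (Hpow : forall k, (Cmod (u M) * 2 ^ k <= Cmod (u (k + M)%nat))%R).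
  { induction k as [| k IH]; [simpl; lra |].
    simpl (2 ^ S k)%R; simpl (S k + M)%nat; generalize (Hhalf (k + M)%nat ltac:(lia)); lra. }
  assert (HuM : u M = 0).
  { apply Cmod_eq_0, Rle_antisym; [| apply Cmod_ge_0]; apply Rnot_lt_le; intros Hlt.
    assert (Hp : forall k, (INR k + 1 <= 2 ^ k)%R).
    { induction k as [| k IH]; [simpl; lra |]; rewrite S_INR; simpl; generalize (pos_INR k); lra. }
    destruct (INR_unbounded (B / Cmod (u M))) as [k Hk].
    assert (H1 := Hpow k); assert (H2 := Hp k).
    assert (H3 : (Cmod (u (k + M)%nat) <= B)%R) by (apply HB; rewrite plus_INR; generalize (pos_INR k); lra).
    apply (Rmult_lt_compat_r (Cmod (u M))) in Hk; [| exact Hlt].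
    replace (B / Cmod (u M) * Cmod (u M))%R with B in Hk by (field; lra); nra. }
  (* The zero at M travels down to 0 because no a + n vanishes. *)
  clear - Ha Hu HuM; induction M as [| M IH]; [exact HuM |].
  apply IH; generalize (Hu M); rewrite HuM; intros H.
  replace (u M) with (/ (a + RtoC (INR M)) * ((a + RtoC (INR M)) * u M)) by (field; apply Ha).
  rewrite H; ring.
Qed.

Section Series.

Variable x : R.
Hypothesis Hx : (0 < x)%R.

(* [x^(-a)] times the integral of [t^(a-1) e^t] over (0, x), when Re a > 0. *)
Definition lower_term (a : C) (n : nat) : C := RtoC (x ^ n / INR (fact n)) / (a + RtoC (INR n)).
Definition lower_series (a : C) : C := CSeries (lower_term a).

Lemma Cmod_lower_term (a : C) (c : R) (n : nat) : (0 < c)%R -> (c <= Cmod (a + RtoC (INR n)))%R ->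
  (Cmod (lower_term a n) <= / c * (x ^ n / INR (fact n)))%R.
Proof.
  intros Hc Hn; unfold lower_term.
  rewrite Cmod_div, Cmod_R, Rabs_pos_eq by (try (now apply exp_term_pos); apply Cmod_gt_0; lra).
  unfold Rdiv at 1; rewrite Rmult_comm; apply Rmult_le_compat_r; [now apply exp_term_pos |].
  apply Rinv_le_contravar; lra.
Qed.

Lemma is_series_lower_series (a : C) : nonpole a -> is_series_C (lower_term a) (lower_series a).
Proof.
  intros Ha; destruct (nonpole_bounded_below a Ha) as [c [Hc H]].
  apply (CSeries_correct _ (fun n => / c * (x ^ n / INR (fact n)))%R).
  - intros n; now apply Cmod_lower_term.
  - exists (/ c * exp x)%R; apply (is_series_scal (K := R_AbsRing) (V := R_NormedModule)), is_series_exp.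
Qed.

Lemma Cmod_lower_series_le (a : C) : (1 <= Re a)%R -> (Cmod (lower_series a) <= / Re a * exp x)%R.
Proof.
  intros Ha.
  apply (Cmod_series_le (lower_term a) (fun n => / Re a * (x ^ n / INR (fact n)))%R).
  - intros n; apply Cmod_lower_term; [lra |].
    eapply Rle_trans; [| apply Cmod_ge_Re]; rewrite Re_plus_R; generalize (pos_INR n); lra.
  - apply is_series_lower_series, nonpole_pos; lra.
  - apply (is_series_scal (K := R_AbsRing) (V := R_NormedModule)), is_series_exp.
Qed.

(** From a / (a + n) = 1 - n / (a + n): the term n = 0 vanishes and n lowers the factorial. *)
Lemma lower_series_succ (a : C) : nonpole a -> a * lower_series a = RtoC (exp x) - RtoC x * lower_series (a + 1).
Proof.
  intros Ha.
  assert (H1 := is_series_lower_series a Ha); assert (H2 := is_series_lower_series (a + 1) (nonpole_succ a Ha)).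
  assert (H3 := is_series_C_RtoC _ _ (is_series_exp x) (fun n => exp_term_pos x n Hx)).
  assert (H4 := is_series_C_minus _ _ _ _ H3 (is_series_C_scal a _ _ H1)).
  assert (H5 := is_series_C_scal (RtoC x) _ _ H2).
  assert (H6 := is_series_C_decr (fun n => RtoC (x ^ n / INR (fact n)) - a * lower_term a n) (RtoC x * lower_series (a + 1))).
  lapply H6; [clear H6; intros H6 |].
  - assert (E := is_series_C_unique _ _ _ H4 H6).
    replace (RtoC (x ^ 0 / INR (fact 0)) - a * lower_term a 0) with (RtoC 0) in E.
    + replace (RtoC x * lower_series (a + 1)) with (0 + RtoC x * lower_series (a + 1)) by ring.
      rewrite <- E; ring.
    + unfold lower_term; simpl; replace (1 / 1)%R with 1%R by field; field.
      now apply nonpole_neq_0.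
  - refine (is_series_C_ext _ _ _ _ H5).
    intros n; unfold lower_term.
    replace (x ^ S n / INR (fact (S n)))%R with (x * (x ^ n / INR (fact n)) / (INR n + 1))%R.
    2: { rewrite fact_simpl, mult_INR, S_INR; simpl; field; split; [apply INR_fact_neq_0 |].
         generalize (pos_INR n); lra. }
    set (e := (x ^ n / INR (fact n))%R).
    replace (RtoC (x * e / (INR n + 1))) with (RtoC x * RtoC e / (RtoC (INR n) + 1)).
    2: { unfold Rdiv; rewrite !RtoC_mult, RtoC_inv, RtoC_plus by (generalize (pos_INR n); lra); reflexivity. }
    assert (Hn := Ha (S n)); rewrite S_INR, RtoC_plus in *.
    field; repeat split; first
      [ intros E; apply Hn; rewrite <- E; ring
      | rewrite <- RtoC_plus; apply RtoC_neq_0; generalize (pos_INR n); lra ].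
Qed.

(** The sum is 1F1 (1; 1 + a; - x) / a. *)
Definition kummer_term (a : C) (n : nat) : C := RtoC ((- x) ^ n) / rising a (S n).
Definition kummer_series (a : C) : C := CSeries (kummer_term a).

Lemma kummer_term_0 (a : C) : kummer_term a 0 = / a.
Proof. unfold kummer_term; simpl; rewrite Cplus_0_r, Cmult_1_l; unfold Cdiv; ring. Qed.

Lemma kummer_term_S (a : C) (n : nat) : nonpole a -> kummer_term a (S n) = - RtoC x / a * kummer_term (a + 1) n.
Proof.
  intros Ha; unfold kummer_term; rewrite (rising_Sl a (S n)); simpl pow.
  rewrite RtoC_mult, RtoC_opp; field; split; [| now apply nonpole_neq_0].
  now apply rising_neq_0, nonpole_succ.
Qed.

Lemma Cmod_pow_opp (n : nat) : Cmod (RtoC ((- x) ^ n)) = (x ^ n)%R.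
Proof. rewrite Cmod_R, <- RPow_abs, Rabs_Ropp, Rabs_pos_eq by lra; reflexivity. Qed.

(* [rising a (n + 1) = a * rising (a + 1) n] and [|rising (a + 1) n| >= n!]. *)
Lemma Cmod_kummer_term_le (a : C) (n : nat) : (1 <= Re a)%R ->
  (Cmod (kummer_term a n) <= / Re a * (x ^ n / INR (fact n)))%R.
Proof.
  intros Ha; assert (Hn : nonpole a) by (apply nonpole_pos; lra).
  unfold kummer_term; rewrite Cmod_div, Cmod_pow_opp by (now apply rising_neq_0).
  rewrite rising_Sl, Cmod_mult.
  assert (H1 := INR_fact_lt_0 n); assert (H2 : (Re a <= Cmod a)%R) by apply Cmod_ge_Re.
  assert (H3 : (INR (fact n) <= Cmod (rising (a + 1) n))%R) by (apply rising_ge; rewrite Re_plus_1; lra).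
  replace (/ Re a * (x ^ n / INR (fact n)))%R with (x ^ n * / (Re a * INR (fact n)))%R by (field; lra).
  apply Rmult_le_compat_l; [left; now apply pow_lt |].
  apply Rinv_le_contravar; [nra |]; apply Rmult_le_compat; lra.
Qed.

Lemma ex_series_kummer_term (a : C) : nonpole a -> ex_series (fun n => Cmod (kummer_term a n)).
Proof.
  revert a; apply (nonpole_ind 1).
  - intros a Ha.
    apply (ex_series_le (K := R_AbsRing) (V := R_CompleteNormedModule) _ (fun n => / Re a * (x ^ n / INR (fact n)))%R).
    + intros n; change (Rabs (Cmod (kummer_term a n)) <= / Re a * (x ^ n / INR (fact n)))%R.
      rewrite Rabs_pos_eq by apply Cmod_ge_0; apply Cmod_kummer_term_le; lra.
    + exists (/ Re a * exp x)%R; apply (is_series_scal (K := R_AbsRing) (V := R_NormedModule)), is_series_exp.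
  - intros a Ha [l Hl]; apply ex_series_incr_1.
    exists (Cmod (- RtoC x / a) * l)%R.
    apply (is_series_ext (fun n => Cmod (- RtoC x / a) * Cmod (kummer_term (a + 1) n))%R).
    + intros n; now rewrite kummer_term_S, Cmod_mult.
    + apply (is_series_scal (K := R_AbsRing) (V := R_NormedModule)), Hl.
Qed.

Lemma is_series_kummer_series (a : C) : nonpole a -> is_series_C (kummer_term a) (kummer_series a).
Proof.
  intros Ha; apply (CSeries_correct _ (fun n => Cmod (kummer_term a n))); [intros; lra | now apply ex_series_kummer_term].
Qed.

Lemma Cmod_kummer_series_le (a : C) : (1 <= Re a)%R -> (Cmod (kummer_series a) <= / Re a * exp x)%R.
Proof.
  intros Ha; apply (Cmod_series_le (kummer_term a) (fun n => / Re a * (x ^ n / INR (fact n)))%R).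
  - intros n; now apply Cmod_kummer_term_le.
  - apply is_series_kummer_series, nonpole_pos; lra.
  - apply (is_series_scal (K := R_AbsRing) (V := R_NormedModule)), is_series_exp.
Qed.

Lemma kummer_series_succ (a : C) : nonpole a -> a * kummer_series a = 1 - RtoC x * kummer_series (a + 1).
Proof.
  intros Ha; assert (Ha0 := nonpole_neq_0 a Ha).
  assert (H1 := is_series_C_scal (- RtoC x / a) _ _ (is_series_kummer_series (a + 1) (nonpole_succ a Ha))).
  apply (is_series_C_ext _ (fun n => kummer_term a (S n))) in H1; [| intros n; symmetry; now apply kummer_term_S].
  apply is_series_C_decr in H1.
  rewrite (is_series_C_unique _ _ _ (is_series_kummer_series a Ha) H1), kummer_term_0; field; exact Ha0.
Qed.

Lemma nonpole_plus (a : C) (n : nat) : nonpole a -> nonpole (a + RtoC (INR n)).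
Proof.
  intros Ha k H; apply (Ha (n + k)%nat); rewrite plus_INR, RtoC_plus, <- H; ring.
Qed.

(* Kummer's transformation for [1F1(1; 1 + a; -x)]. *)
Lemma lower_series_kummer (a : C) : nonpole a -> lower_series a = RtoC (exp x) * kummer_series a.
Proof.
  intros Ha.
  set (u := fun n : nat => lower_series (a + RtoC (INR n)) - RtoC (exp x) * kummer_series (a + RtoC (INR n))).
  assert (H : u 0%nat = 0).
  { apply (recurrence_unique x (exp x + exp x * exp x) a u Hx Ha).
    - intros n; unfold u; assert (Hn := nonpole_plus a n Ha).
      assert (E1 := lower_series_succ _ Hn); assert (E2 := kummer_series_succ _ Hn).
      replace (a + RtoC (INR (S n))) with (a + RtoC (INR n) + 1) by (rewrite S_INR, RtoC_plus; ring).
      set (b := a + RtoC (INR n)) in *.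
      replace (b * (lower_series b - RtoC (exp x) * kummer_series b)) with (b * lower_series b - RtoC (exp x) * (b * kummer_series b)) by ring.
      rewrite E1, E2; ring.
    - intros n Hn; unfold u; rewrite <- Re_plus_R in Hn.
      assert (B1 := Cmod_lower_series_le _ Hn); assert (B2 := Cmod_kummer_series_le _ Hn).
      set (b := a + RtoC (INR n)) in *.
      assert (Hi : (/ Re b <= 1)%R) by (rewrite <- Rinv_1; apply Rinv_le_contravar; lra).
      assert (He := exp_pos x).
      eapply Rle_trans; [apply Cmod_minus_le |].
      rewrite Cmod_mult, Cmod_R, Rabs_pos_eq by lra.
      assert (/ Re b * exp x <= exp x)%R by nra.
      apply Rplus_le_compat; [lra |]; apply Rmult_le_compat_l; lra. }
  unfold u in H; simpl in H; rewrite Cplus_0_r in H.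
  replace (lower_series a) with (lower_series a - RtoC (exp x) * kummer_series a + RtoC (exp x) * kummer_series a) by ring.
  rewrite H; ring.
Qed.

(** As (1)_n / (2)_n = 1 / (n + 1), the sum is x / a times 2F2 (1, 1; 2, 1 + a; - x). *)
Definition hyp_term (a : C) (n : nat) : C := RtoC (x / (INR n + 1)) * kummer_term a n.
Definition hyp_series (a : C) : C := CSeries (hyp_term a).

Lemma Cmod_hyp_term_le (a : C) (n : nat) : (Cmod (hyp_term a n) <= x * Cmod (kummer_term a n))%R.
Proof.
  assert (Hn := pos_INR n).
  assert (H : (0 < / (INR n + 1) <= 1)%R).
  { split; [apply Rinv_0_lt_compat; lra |]; rewrite <- Rinv_1 at 2; apply Rinv_le_contravar; lra. }
  unfold hyp_term, Rdiv; rewrite Cmod_mult, Cmod_R, Rabs_pos_eq by nra.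
  apply Rmult_le_compat_r; [apply Cmod_ge_0 | nra].
Qed.

Lemma is_series_hyp_series (a : C) : nonpole a -> is_series_C (hyp_term a) (hyp_series a).
Proof.
  intros Ha; apply (CSeries_correct _ (fun n => x * Cmod (kummer_term a n))%R).
  - intros n; apply Cmod_hyp_term_le.
  - destruct (ex_series_kummer_term a Ha) as [l Hl]; exists (x * l)%R.
    apply (is_series_scal (K := R_AbsRing) (V := R_NormedModule)), Hl.
Qed.

Lemma Cmod_hyp_series_le (a : C) : (1 <= Re a)%R -> (Cmod (hyp_series a) <= x * (/ Re a * exp x))%R.
Proof.
  intros Ha; apply (Cmod_series_le (hyp_term a) (fun n => x * (/ Re a * (x ^ n / INR (fact n))))%R).
  - intros n; eapply Rle_trans; [apply Cmod_hyp_term_le |].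
    apply Rmult_le_compat_l; [lra | now apply Cmod_kummer_term_le].
  - apply is_series_hyp_series, nonpole_pos; lra.
  - do 2 apply (is_series_scal (K := R_AbsRing) (V := R_NormedModule)); apply is_series_exp.
Qed.

(** 1 / a - 1 / (a + n + 1) produces a factor n + 1, which cancels the denominator: the n-th
    difference is - [kummer_term a (n + 1)]. *)
Lemma hyp_series_succ (a : C) : nonpole a -> hyp_series a - hyp_series (a + 1) = / a - kummer_series a.
Proof.
  intros Ha.
  assert (H1 := is_series_C_minus _ _ _ _ (is_series_hyp_series a Ha) (is_series_hyp_series (a + 1) (nonpole_succ a Ha))).
  assert (H2 : is_series_C (fun n => kummer_term a (S n)) (- (1) * (hyp_series a - hyp_series (a + 1)))).
  { refine (is_series_C_ext _ _ _ _ (is_series_C_scal (- (1)) _ _ H1)).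
    intros n; rewrite kummer_term_S by auto; unfold hyp_term, kummer_term.
    assert (E : rising a (S n) = a * rising (a + 1) (S n) / (a + RtoC (INR n) + 1)).
    { rewrite <- rising_Sl; change (rising a (S (S n))) with (rising a (S n) * (a + RtoC (INR (S n)))).
      rewrite S_INR, RtoC_plus; field.
      intros E; apply (Ha (S n)); rewrite S_INR, RtoC_plus, <- E; ring. }
    rewrite E; unfold Rdiv; rewrite RtoC_mult, RtoC_inv, RtoC_plus by (generalize (pos_INR n); lra).
    assert (Hr := rising_neq_0 (a + 1) (S n) (nonpole_succ a Ha)).
    field; repeat split; first
      [ exact Hr | now apply nonpole_neq_0
      | intros E'; apply (Ha (S n)); rewrite S_INR, RtoC_plus, <- E'; ring
      | rewrite <- RtoC_plus; apply RtoC_neq_0; generalize (pos_INR n); lra ]. }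
  apply is_series_C_decr in H2; rewrite kummer_term_0 in H2.
  rewrite (is_series_C_unique _ _ _ (is_series_kummer_series a Ha) H2); ring.
Qed.

End Series.

(** * The lower incomplete Gamma function *)

Lemma Cexp_ln_PI (x : R) : (0 < x)%R -> Cexp (ln x, PI) = RtoC (- x).
Proof.
  intros Hx; unfold Cexp; simpl; rewrite exp_ln, cos_PI, sin_PI by auto.
  apply injective_projections; simpl; ring.
Qed.

Lemma Cexp_INR (n : nat) (z : C) : Cexp (RtoC (INR n) * z) = Cexp z ^ n.
Proof.
  induction n as [| n IH].
  - simpl; rewrite Cmult_0_l; apply Cexp_0.
  - rewrite S_INR, RtoC_plus, Cmult_plus_distr_r, Cexp_plus, IH, Cmult_1_l; simpl; ring.
Qed.

Notation Int01 f l := (is_RInt_gen (V := C_R_NormedModule) f (at_right 0) (at_point 1) l).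

Definition unit_segment (t : R) : Prop := (0 < t <= 1)%R.

Lemma interval_unit_segment : interval unit_segment.
Proof.
  intros a b t [Ha Ha'] [Hb Hb'] [H1 H2]; unfold unit_segment; revert H1 H2.
  unfold Rmin, Rmax; destruct Rle_dec; lra.
Qed.

Lemma at_right_unit_segment : at_right 0 unit_segment.
Proof.
  exists (mkposreal 1 Rlt_0_1); intros y Hy Hy0.
  apply Rabs_def2 in Hy; unfold minus, plus, opp in Hy; simpl in Hy; split; lra.
Qed.

Lemma at_point_unit_segment : at_point 1%R unit_segment.
Proof. unfold at_point, unit_segment; lra. Qed.

Lemma Int01_ext (f g : R -> C) (l : C) :
  (forall t, unit_segment t -> f t = g t) -> Int01 f l -> Int01 g l.
Proof.
  intros H; apply is_RInt_gen_ext.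
  apply filter_prod_domain with unit_segment; [apply at_right_unit_segment | apply at_point_unit_segment |].
  intros a b Ha Hb t Ht; apply H, (interval_unit_segment a b); simpl in *; auto; lra.
Qed.

Section Lower.

Variable x : R.
Hypothesis Hx : (0 < x)%R.

Lemma Int01_kern_dominated (a : C) : (0 < Re a)%R ->
  (exists l : C, Int01 (kern (a - 1) 0 (RtoC (- x))) l) /\
  forall l, Int01 (kern (a - 1) 0 (RtoC (- x))) l -> (Cmod l <= exp x / Re a)%R.
Proof.
  intros Ha; set (p := Re a) in *.
  set (phi := fun t => (exp x * exp ((p - 1) * ln t))%R).
  set (Phi := fun t => (exp x / p * exp (p * ln t))%R).
  assert (Hf : forall t, unit_segment t -> continuous (U := C_R_NormedModule) (kern (a - 1) 0 (RtoC (- x))) t).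
  { intros t [Ht _]; now apply continuous_kern. }
  assert (HPhi : forall t, unit_segment t -> is_derive Phi t (phi t) /\ continuous phi t).
  { intros t [Ht _]; split.
    - unfold Phi, phi; auto_derive; [auto |].
      replace ((p - 1) * ln t)%R with (p * ln t + - ln t)%R by ring.
      rewrite exp_plus, exp_Ropp, exp_ln by auto; field; lra.
    - apply (ex_derive_continuous (V := R_NormedModule)); unfold phi; auto_derive; auto. }
  assert (Hdom : forall t, unit_segment t -> (Cmod (kern (a - 1) 0 (RtoC (- x)) t) <= phi t)%R).
  { intros t [Ht Ht1]; rewrite Cmod_kern; unfold weight, phi; rewrite <- exp_plus; apply exp_le_exp.
    replace (Re (a - 1)) with (p - 1)%R by (unfold p; destruct a; reflexivity); simpl Re; nra. }
  assert (H0 : filterlim Phi (at_right 0) (locally (exp x / p * 0)%R)).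
  { apply (filterlim_comp _ _ _ (fun t => exp (p * ln t))%R (fun u => exp x / p * u)%R _ (locally 0%R)).
    - now apply exp_mult_ln_at_0.
    - apply (filterlim_scal_r (K := R_AbsRing) (V := R_NormedModule)). }
  assert (H1 := filterlim_at_point R_UniformSpace Phi 1%R).
  split.
  - apply (ex_RInt_gen_dominated _ phi Phi unit_segment (at_right 0) (at_point 1%R) _ _
      interval_unit_segment at_right_unit_segment at_point_unit_segment Hf HPhi Hdom H0 H1).
  - intros l Hl.
    apply Rle_trans with (1 := Cmod_RInt_gen_le _ phi Phi unit_segment (at_right 0) (at_point 1%R) _ _
      interval_unit_segment at_right_unit_segment at_point_unit_segment Hf HPhi Hdom H0 H1 l Hl).
    assert (0 < exp x / p)%R by (apply Rdiv_lt_0_compat; [apply exp_pos | auto]).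
    unfold Phi; rewrite ln_1, Rmult_0_r, exp_0, Rabs_pos_eq; lra.
Qed.

(** gamma (a, - x) with the factor (-x)^a taken out: the integral of t^(a-1) e^(xt) over (0, 1). *)
Definition lower_int (a : C) : C := CInt_gen (kern (a - 1) 0 (RtoC (- x))) (at_right 0) (at_point 1).

Lemma lower_int_correct (a : C) : (0 < Re a)%R -> Int01 (kern (a - 1) 0 (RtoC (- x))) (lower_int a).
Proof.
  intros Ha; destruct (proj1 (Int01_kern_dominated a Ha)) as [l Hl].
  unfold lower_int, CInt_gen; now rewrite (is_RInt_gen_unique (V := C_R_CompleteNormedModule) _ l Hl).
Qed.

Lemma lower_int_succ (a : C) : (0 < Re a)%R -> a * lower_int a = RtoC (exp x) - RtoC x * lower_int (a + 1).
Proof.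
  intros Ha; assert (Ha1 : (0 < Re (a + 1))%R) by (rewrite Re_plus_1; lra).
  assert (H1 := lower_int_correct a Ha).
  apply (is_RInt_gen_Cmult_l a) in H1.
  assert (H2 := lower_int_correct (a + 1) Ha1).
  apply (is_RInt_gen_Cmult_l (RtoC x)) in H2.
  assert (H3 := is_RInt_gen_plus (V := C_R_NormedModule) _ _ _ _ H1 H2).
  assert (H4 : Int01 (fun t => a * kern (a - 1) 0 (RtoC (- x)) t + RtoC x * kern (a + 1 - 1) 0 (RtoC (- x)) t)
    (kern a 0 (RtoC (- x)) 1 - 0)).
  { apply (is_RInt_gen_antiderivative C_R_CompleteNormedModule (kern a 0 (RtoC (- x))) _ unit_segment);
      try typeclasses eauto.
    - apply interval_unit_segment.
    - apply at_right_unit_segment.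
    - apply at_point_unit_segment.
    - intros t [Ht _]; split.
      + generalize (is_derive_kern a 0 (RtoC (- x)) t Ht).
        rewrite kern_total_derivative by exact Ht.
        replace (a + 1 - 1) with a by ring.
        now replace (a * kern (a - 1) 0 (RtoC (- x)) t + 0 * kern a (0 - 1) (RtoC (- x)) t - RtoC (- x) * kern a 0 (RtoC (- x)) t)
          with (a * kern (a - 1) 0 (RtoC (- x)) t + RtoC x * kern a 0 (RtoC (- x)) t) by (rewrite RtoC_opp; ring).
      + assert (HC : forall c p, continuous (U := C_R_NormedModule) (fun t => c * kern p 0 (RtoC (- x)) t) t).
        { intros c p; apply (continuous_comp (V := C_R_NormedModule) (W := C_R_NormedModule) (kern p 0 (RtoC (- x))) (fun v => c * v)).
          - now apply continuous_kern.
          - apply linear_cont, is_linear_Cmult_l. }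
        apply (continuous_plus (V := C_R_NormedModule)); apply HC.
    - now apply kern_at_0.
    - apply (filterlim_at_point C_R_NormedModule). }
  assert (E := is_RInt_gen_C_unique _ _ _ H3 H4).
  change (a * lower_int a + RtoC x * lower_int (a + 1) = kern a 0 (RtoC (- x)) 1 - 0) in E.
  replace (kern a 0 (RtoC (- x)) 1) with (RtoC (exp x)) in E.
  - replace (a * lower_int a) with (a * lower_int a + RtoC x * lower_int (a + 1) - RtoC x * lower_int (a + 1)) by ring.
    rewrite E; ring.
  - unfold kern; rewrite <- Cexp_R, ln_1; f_equal; rewrite RtoC_opp; ring.
Qed.

(** Both sides satisfy the same recurrence and are bounded for Re a >= 1, so [recurrence_unique]
    applies to their difference; no sum and integral are interchanged. *)
Lemma lower_int_series (a : C) : (0 < Re a)%R -> lower_int a = lower_series x a.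
Proof.
  intros Ha; assert (Hn := nonpole_pos a Ha).
  set (u := fun n : nat => lower_int (a + RtoC (INR n)) - lower_series x (a + RtoC (INR n))).
  assert (H : u 0%nat = 0).
  { apply (recurrence_unique x (exp x + exp x) a u Hx Hn).
    - intros n; unfold u; assert (Hm := nonpole_plus a n Hn).
      assert (Hp : (0 < Re (a + RtoC (INR n)))%R) by (rewrite Re_plus_R; generalize (pos_INR n); lra).
      assert (E1 := lower_int_succ _ Hp); assert (E2 := lower_series_succ x Hx _ Hm).
      replace (a + RtoC (INR (S n))) with (a + RtoC (INR n) + 1) by (rewrite S_INR, RtoC_plus; ring).
      set (b := a + RtoC (INR n)) in *.
      replace (b * (lower_int b - lower_series x b)) with (b * lower_int b - b * lower_series x b) by ring.
      rewrite E1, E2; ring.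
    - intros n H; unfold u; rewrite <- Re_plus_R in H.
      assert (B1 := Cmod_lower_series_le x Hx _ H).
      assert (Hp : (0 < Re (a + RtoC (INR n)))%R) by lra.
      assert (B2 := proj2 (Int01_kern_dominated _ Hp) _ (lower_int_correct _ Hp)).
      set (b := a + RtoC (INR n)) in *.
      assert (Hi : (/ Re b <= 1)%R) by (rewrite <- Rinv_1; apply Rinv_le_contravar; lra).
      assert (He := exp_pos x).
      assert (/ Re b * exp x <= exp x)%R by nra.
      eapply Rle_trans; [apply Cmod_minus_le |].
      apply Rplus_le_compat; [unfold Rdiv in B2; lra | lra]. }
  unfold u in H; simpl in H; rewrite Cplus_0_r in H.
  replace (lower_int a) with (lower_int a - lower_series x a + lower_series x a) by ring.
  rewrite H; ring.
Qed.

(** Both branches of [gamma_lower] reduce to the same expression; in the series branch (-1)^n and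
    (-x)^n combine to x^n. *)
Lemma gamma_lower_series (a : C) : nonpole a ->
  gamma_lower a (RtoC (- x)) = Cexp (a * (ln x, PI)) * lower_series x a.
Proof.
  intros Hn; unfold gamma_lower; destruct (Rlt_dec 0 (Re a)) as [Ha | Ha].
  - rewrite <- lower_int_series by exact Ha; unfold CInt_gen.
    apply (is_RInt_gen_unique (V := C_R_CompleteNormedModule)).
    apply (Int01_ext (fun s => Cexp (a * (ln x, PI)) * kern (a - 1) 0 (RtoC (- x)) s)).
    + intros s [Hs _].
      replace (RtoC s * RtoC (- x)) with (RtoC (- (s * x))) by (rewrite <- RtoC_mult; f_equal; ring).
      rewrite Cpower_neg by nra.
      replace (RtoC (- x)) with (Cexp (ln x, PI)) at 2 by now apply Cexp_ln_PI.
      unfold kern; rewrite <- !Cexp_plus; f_equal.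
      rewrite ln_mult by auto.
      replace ((ln s + ln x)%R, PI) with (RtoC (ln s) + (ln x, PI))
        by (apply injective_projections; simpl; ring).
      rewrite !RtoC_opp, RtoC_mult; ring.
    + apply (is_RInt_gen_Cmult_l (Cexp (a * (ln x, PI)))); now apply lower_int_correct.
  - apply CSeries_unique.
    refine (is_series_C_ext _ _ _ _ (is_series_C_scal (Cexp (a * (ln x, PI))) _ _ (is_series_lower_series x Hx a Hn))).
    intros n; rewrite Cpower_neg by auto; unfold lower_term.
    rewrite Cmult_plus_distr_r, Cexp_plus, Cexp_INR, Cexp_ln_PI by auto.
    unfold Rdiv; rewrite RtoC_mult, RtoC_inv by apply INR_fact_neq_0.
    replace (RtoC (x ^ n)) with (RtoC (-1) ^ n * RtoC (- x) ^ n).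
    + field; split; [apply Hn |]; apply RtoC_neq_0, INR_fact_lt_0.
    + rewrite <- !RtoC_pow, <- RtoC_mult, <- Rpow_mult_distr; f_equal; f_equal; ring.
Qed.

Lemma pFq_hyp_series (a : C) : nonpole a ->
  RtoC x / a * pFq [RtoC 1; RtoC 1] [RtoC 2; 1 + a] (RtoC (- x)) = hyp_series x a.
Proof.
  intros Hn; assert (Ha := nonpole_neq_0 a Hn).
  assert (Hx0 : RtoC x <> 0) by now apply RtoC_neq_0.
  replace (pFq _ _ _) with (a / RtoC x * hyp_series x a); [field; auto |].
  symmetry; apply CSeries_unique.
  refine (is_series_C_ext _ _ _ _ (is_series_C_scal (a / RtoC x) _ _ (is_series_hyp_series x Hx a Hn))).
  intros n; unfold hyp_term, kummer_term; simpl map; unfold Cprod; simpl fold_right.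
  assert (H1 : nonpole 1) by (apply nonpole_pos; simpl; lra).
  assert (H2 : nonpole (RtoC 2)) by (apply nonpole_pos; simpl; lra).
  assert (Hn1 := nonpole_succ a Hn).
  replace (1 + a) with (a + 1) by ring.
  rewrite !poch_rising, rising_Sl by auto.
  assert (R1 : forall m, rising 1 m = RtoC (INR (fact m))).
  { induction m as [| m IH]; [reflexivity |].
    rewrite fact_simpl, mult_INR, S_INR, RtoC_mult, RtoC_plus; simpl; rewrite IH; ring. }
  assert (R2 : rising (RtoC 2) n = (RtoC (INR n) + 1) * RtoC (INR (fact n))).
  { replace (RtoC 2) with (RtoC 1 + 1) by (rewrite <- RtoC_plus; f_equal; ring).
    replace (rising (RtoC 1 + 1) n) with (rising 1 (S n)) by (rewrite rising_Sl; ring).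
    rewrite R1, fact_simpl, mult_INR, S_INR, RtoC_mult, RtoC_plus; reflexivity. }
  rewrite R1, R2, RtoC_pow.
  assert (Hf : RtoC (INR (fact n)) <> 0) by apply RtoC_neq_0, INR_fact_lt_0.
  assert (Hn0 : RtoC (INR n) + 1 <> 0) by (rewrite <- RtoC_plus; apply RtoC_neq_0; generalize (pos_INR n); lra).
  assert (Hr := rising_neq_0 (a + 1) n Hn1).
  unfold Rdiv; rewrite RtoC_mult, RtoC_inv, RtoC_plus by (generalize (pos_INR n); lra).
  field; auto 10.
Qed.

(** * The recurrence in [a] *)

(** The braces of the theorem at a = 2 mu, after e^(-i pi a) has cancelled the phase of (-x)^a. *)
Definition bracket (a : C) : C :=
  hyp_series x a + Gamma_upper (1 - a) x * (Cexp (a * RtoC (ln x)) * lower_series x a) + digamma a - RtoC (ln x).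

(** The 1 / a of [hyp_series] cancels that of [digamma]. The boundary term of the upper incomplete
    function leaves e^(-x) [lower_series], which Kummer's transformation turns into [kummer_series],
    cancelling the rest of the difference of [hyp_series]. *)
Lemma bracket_succ (a : C) : nonpole a ->
  bracket a = bracket (a + 1) - Cexp (a * RtoC (ln x)) * RtoC (exp x) * Gamma_upper (- a) x.
Proof.
  intros Hn; assert (Ha := nonpole_neq_0 a Hn).
  assert (E1 := hyp_series_succ x Hx a Hn); assert (E2 := Gamma_upper_succ (- a) x Hx).
  assert (E3 := lower_series_succ x Hx a Hn); assert (E4 := lower_series_kummer x Hx a Hn).
  assert (E5 := digamma_succ a Hn).
  replace (- a + 1) with (1 - a) in E2 by ring.
  unfold bracket; replace (1 - (a + 1)) with (- a) by ring; rewrite E5, E2.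
  replace (hyp_series x a) with (hyp_series x (a + 1) + (/ a - kummer_series x a)) by (rewrite <- E1; ring).
  replace (Cexp ((a + 1) * RtoC (ln x))) with (Cexp (a * RtoC (ln x)) * RtoC x).
  2: { replace ((a + 1) * RtoC (ln x)) with (a * RtoC (ln x) + RtoC (ln x)) by ring.
       rewrite Cexp_plus, (Cexp_R (ln x)), exp_ln by auto; reflexivity. }
  replace (- a * RtoC (ln x)) with (- (a * RtoC (ln x))) by ring.
  rewrite Cexp_opp, exp_Ropp, RtoC_inv by (generalize (exp_pos x); lra).
  set (w := Cexp (a * RtoC (ln x))); assert (Hw : w <> 0) by apply Cexp_neq_0.
  assert (He : RtoC (exp x) <> 0) by apply RtoC_neq_0, exp_pos.
  set (g := Gamma_upper (- a) x).
  replace ((- a * g + / w * / RtoC (exp x)) * (w * lower_series x a)) with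
    (- g * w * (a * lower_series x a) + / RtoC (exp x) * lower_series x a) by (field; auto).
  rewrite E3, E4; field; auto.
Qed.

Lemma bracket_step (a k k' : C) : (1 < Re a)%R ->
  is_derive_C (fun h => tricomiV x 0 (a + h) h) (RtoC 0) k ->
  is_derive_C (fun h => tricomiV x 0 (a + 1 + h) h) (RtoC 0) k' ->
  Cexp (a * RtoC (ln x)) * k - bracket a = Cexp ((a + 1) * RtoC (ln x)) * k' - bracket (a + 1).
Proof.
  intros Ha Hk Hk'; assert (Hn : nonpole a) by (apply nonpole_pos; lra).
  apply (is_derive_tricomiV_S x 0 a k' Hx) in Hk'; [| simpl; lra | exact Hn].
  apply (is_derive_tricomiV_n x 1 0 a) in Hk'; [| exact Hx | simpl; lra | simpl; lra].
  rewrite (is_derive_C_unique _ _ _ _ Hk Hk'), (bracket_succ a Hn).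
  replace (Cexp ((a + 1) * RtoC (ln x))) with (Cexp (a * RtoC (ln x)) * RtoC x).
  2: { replace ((a + 1) * RtoC (ln x)) with (a * RtoC (ln x) + RtoC (ln x)) by ring.
       rewrite Cexp_plus, (Cexp_R (ln x)), exp_ln by auto; reflexivity. }
  ring.
Qed.

Lemma ex_derive_tricomiV_q0 (a : C) (n : nat) : (1 < Re a + INR n)%R ->
  exists k : C, is_derive_C (fun h => tricomiV x n (a + h) h) (RtoC 0) k.
Proof.
  intros Ha; destruct (ex_derive_tricomiV x n a 0 Hx Ha) as [k Hk]; exists k.
  refine (is_derive_C_ext_near _ _ _ _ 1 Rlt_0_1 _ Hk).
  intros h _; now rewrite !Cplus_0_l.
Qed.

Lemma bracket_steps (n : nat) (a k : C) : (1 < Re a)%R ->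
  is_derive_C (fun h => tricomiV x 0 (a + h) h) (RtoC 0) k ->
  exists k' : C, is_derive_C (fun h => tricomiV x 0 (a + RtoC (INR n) + h) h) (RtoC 0) k' /\
  Cexp (a * RtoC (ln x)) * k - bracket a =
  Cexp ((a + RtoC (INR n)) * RtoC (ln x)) * k' - bracket (a + RtoC (INR n)).
Proof.
  revert a k; induction n as [| n IH]; intros a k Ha Hk.
  - exists k; simpl INR; now rewrite Cplus_0_r.
  - assert (Ha1 : (1 < Re (a + 1))%R) by (rewrite Re_plus_1; lra).
    destruct (ex_derive_tricomiV_q0 (a + 1) 0 ltac:(change (INR 0) with 0%R; lra)) as [k1 Hk1].
    destruct (IH (a + 1) k1 Ha1 Hk1) as [k' [Hk' E]]; exists k'.
    replace (a + RtoC (INR (S n))) with (a + 1 + RtoC (INR n)) by (rewrite S_INR, RtoC_plus; ring).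
    split; [exact Hk' |]; rewrite <- E; now apply bracket_step.
Qed.

(** The bound 1 / t lowers the exponent by one, so |l| is at most x^(-(X-1)) Gamma (X - 1), while
    |Gamma a| is at least (X - 1) Gamma (X - 1) / 2. *)
Lemma Cmod_log_integral_le (a l : C) : (2 <= Re a)%R -> (4 * Im a ^ 2 <= Re a - 1)%R ->
  IntC (fun t => RtoC (ln (1 + t) - ln t) * kern (a - 1) 0 (RtoC x) t) l ->
  (Cmod (Cexp (a * RtoC (ln x)) * l / Gamma a) <= 2 * x / (Re a - 1))%R.
Proof.
  intros Ha Hy Hl; set (X := Re a) in *.
  assert (Hn : nonpole a) by (apply nonpole_pos; fold X; lra).
  assert (HJ := laplace_int_correct (RtoC (X - 1)) 0 (RtoC x) ltac:(simpl; lra) Hx).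
  rewrite laplace_int_scale, <- Gamma_laplace_int in HJ by (simpl; auto; lra).
  assert (HL : (Cmod l <= Re (Cexp (- RtoC (X - 1) * RtoC (ln x)) * Gamma (RtoC (X - 1))))%R).
  { apply (IntC_Cmod_le _ _ _ _) with (2 := Hl) (3 := HJ); intros t Ht.
    rewrite Cmod_mult, Cmod_R, Cmod_kern, <- RtoC_minus, kern_real.
    change (Rabs (ln (1 + t) - ln t) * weight (Re (a - 1)) 0 x t <= weight (X - 1 - 1) 0 x t)%R.
    replace (weight (Re (a - 1)) 0 x t) with (t * weight (X - 1 - 1) 0 x t)%R.
    2: { unfold weight; rewrite <- (exp_ln t Ht) at 1; rewrite <- exp_plus; f_equal.
         unfold X; destruct a; simpl; ring. }
    assert (Hw : (0 < weight (X - 1 - 1) 0 x t)%R) by apply exp_pos.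
    assert (Hl1 : (ln t < ln (1 + t))%R) by (apply ln_increasing; lra).
    (* The tangent of ln at t, taken at 1 + t, is the bound 1 / t. *)
    assert (Hl2 := ln_le_affine (1 + t) t ltac:(lra) Ht).
    rewrite Rabs_pos_eq by lra; rewrite <- Rmult_assoc.
    rewrite <- (Rmult_1_l (weight _ _ _ _)) at 2; apply Rmult_le_compat_r; [lra |].
    apply (Rmult_le_reg_r (/ t)); [now apply Rinv_0_lt_compat |].
    replace ((ln (1 + t) - ln t) * t * / t)%R with (ln (1 + t) - ln t)%R by (field; lra).
    replace ((1 + t) / t)%R with (/ t + 1)%R in Hl2 by (field; lra); lra. }
  assert (HG : Re (Gamma (RtoC X)) = ((X - 1) * Re (Gamma (RtoC (X - 1))))%R).
  { replace (RtoC X) with (RtoC (X - 1) + 1) by (rewrite <- RtoC_plus; f_equal; ring).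
    rewrite Gamma_succ, Re_RtoC_mult by (apply RtoC_neq_0; lra); reflexivity. }
  assert (HG1 := Re_Gamma_ge_1 X Ha); assert (HGa := Gamma_lower_bound a Ha Hy); fold X in HGa.
  assert (HG0 : (0 < Re (Gamma (RtoC (X - 1))))%R) by nra.
  set (g := Re (Gamma (RtoC (X - 1)))) in *.
  replace (- RtoC (X - 1) * RtoC (ln x)) with (RtoC (- (X - 1) * ln x)) in HL
    by (rewrite RtoC_mult, RtoC_opp; reflexivity).
  rewrite Cexp_R, Re_RtoC_mult in HL; fold g in HL.
  rewrite Cmod_div, Cmod_mult, Cmod_Cexp by now apply Gamma_neq_0.
  replace (Re (a * RtoC (ln x))) with (X * ln x)%R by (unfold X; destruct a; simpl; ring).
  assert (HE : (exp (X * ln x) * (exp (- (X - 1) * ln x) * g) = x * g)%R).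
  { rewrite <- Rmult_assoc, <- exp_plus.
    replace (X * ln x + - (X - 1) * ln x)%R with (ln x) by ring; now rewrite exp_ln. }
  assert (Hnum : (exp (X * ln x) * Cmod l <= x * g)%R).
  { rewrite <- HE; apply Rmult_le_compat_l; [left; apply exp_pos | exact HL]. }
  replace (2 * x / (X - 1))%R with (x * g / ((X - 1) * g / 2))%R by (field; lra).
  rewrite <- HG; apply Rmult_le_compat; try lra.
  - apply Rmult_le_pos; [left; apply exp_pos | apply Cmod_ge_0].
  - left; apply Rinv_0_lt_compat; lra.
  - apply Rinv_le_contravar; lra.
Qed.

Lemma bracket_bound (a k : C) : (2 <= Re a)%R -> (4 * Im a ^ 2 <= Re a - 1)%R ->
  is_derive_C (fun h => tricomiV x 0 (a + h) h) (RtoC 0) k ->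
  (Cmod (Cexp (a * RtoC (ln x)) * k - bracket a + RtoC (ln x)) <= (2 * x + x * exp x + 1) / (Re a - 1))%R.
Proof.
  intros Ha Hy Hk.
  assert (Hn : nonpole a) by (apply nonpole_pos; lra).
  assert (Ha1 : (1 < Re a)%R) by lra.
  assert (R1 : (Rabs 1 <= 1)%R) by (rewrite Rabs_R1; lra).
  assert (R0 : (Rabs 0 <= 1)%R) by (rewrite Rabs_R0; lra).
  assert (Hx1 : (0 < Re (RtoC x))%R) by exact Hx.
  destruct (ex_derive_Gamma a Hn) as [g Hg].
  assert (HG0 := Gamma_neq_0 a Hn).
  assert (Hpsi := digamma_eq a g Hg).
  apply (proj2 (is_derive_C_at_0 Gamma a g)) in Hg.
  assert (HGa : Gamma (a + 0) <> 0) by now rewrite Cplus_0_r.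
  destruct (ex_IntC_log_derivative a 0 (RtoC x) 1 1 0 Ha1 Hx1 R1 R1 R0) as [d1 Hd1].
  destruct (ex_IntC_log_derivative a 0 (RtoC x) 1 0 0 Ha1 Hx1 R1 R0 R0) as [d2 Hd2].
  assert (D1 := is_derive_laplace_int a 0 (RtoC x) 1 1 0 Ha1 Hx1 R1 R1 R0 d1 Hd1).
  assert (D2 := is_derive_laplace_int a 0 (RtoC x) 1 0 0 Ha1 Hx1 R1 R0 R0 d2 Hd2).
  assert (Hscale := laplace_int_scale a x ltac:(lra) Hx); rewrite <- Gamma_laplace_int in Hscale by lra.
  set (w := Cexp (a * RtoC (ln x))); assert (Hw : w <> 0) by apply Cexp_neq_0.
  assert (Hwi : Cexp (- a * RtoC (ln x)) = / w).
  { unfold w; rewrite <- Cexp_opp; f_equal; ring. }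
  rewrite Hwi in Hscale.
  assert (E1 : k = (g * - / (Gamma a * Gamma a)) * (/ w * Gamma a) + / Gamma a * d1).
  { apply (is_derive_C_unique _ _ _ _ Hk).
    apply (is_derive_C_inv (fun h => Gamma (a + h)) 0 g HGa) in Hg.
    assert (HD := is_derive_C_mult _ _ _ _ _ Hg D1); cbv beta in HD.
    rewrite !Cmult_0_r, !Cplus_0_r, Hscale in HD.
    refine (is_derive_C_ext_near _ _ _ _ 1 Rlt_0_1 _ HD).
    intros h Hh; rewrite !Cplus_0_l, tricomiV_0 by (auto; generalize (Re_near a h 1 Hh); lra).
    f_equal; f_equal; ring. }
  (* d2 is the integral of ln t; here it is evaluated by differentiating Gamma (a + h) x^(-a-h), the
     closed form of the same Laplace integral. *)
  assert (E2 : d2 = / w * (g - RtoC (ln x) * Gamma a)).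
  { apply (is_derive_C_unique _ _ _ _ D2).
    assert (HC : is_derive_C (fun h => Cexp (- a * RtoC (ln x) + - RtoC (ln x) * h)) (RtoC 0) (- RtoC (ln x) * / w)).
    { apply is_derive_C_eq with (- RtoC (ln x) * Cexp (- a * RtoC (ln x) + - RtoC (ln x) * RtoC 0)).
      - apply (is_derive_C_comp Cexp (fun h => - a * RtoC (ln x) + - RtoC (ln x) * h));
          [apply is_derive_Cexp_C | apply is_derive_C_affine].
      - now rewrite Cmult_0_r, Cplus_0_r, Hwi. }
    assert (HD := is_derive_C_mult _ _ _ _ _ HC Hg); cbv beta in HD.
    rewrite !Cmult_0_r, !Cplus_0_r, Hwi in HD.
    apply is_derive_C_eq with (- RtoC (ln x) * / w * Gamma a + / w * g); [| ring].
    refine (is_derive_C_ext_near _ _ _ _ 1 Rlt_0_1 _ HD).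
    intros h Hh; rewrite !Cplus_0_l.
    replace (a + RtoC 1 * h) with (a + h) by ring.
    replace (RtoC 0 * h) with (RtoC 0) by ring; rewrite Cplus_0_r.
    assert (Hh' : (0 < Re (a + h))%R) by (generalize (Re_near a h 1 Hh); lra).
    rewrite laplace_int_scale, <- Gamma_laplace_int by auto; f_equal; f_equal; ring. }
  (* d1 carries ln t + ln (1 + t); subtracting 2 ln t leaves the small logarithm ln (1 + t) - ln
     t. *)
  assert (HI := IntC_minus _ _ _ _ Hd1 (IntC_scal (RtoC 2) _ _ Hd2)).
  apply (IntC_ext _ (fun t => RtoC (ln (1 + t) - ln t) * kern (a - 1) 0 (RtoC x) t)) in HI.
  2: { intros t Ht; rewrite !RtoC_minus, !RtoC_plus, !RtoC_mult; ring. }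
  apply (Cmod_log_integral_le a _ Ha Hy) in HI; fold w in HI.
  assert (E : w * k - bracket a + RtoC (ln x) =
    w * (d1 - RtoC 2 * d2) / Gamma a - hyp_series x a - Gamma_upper (1 - a) x * (w * lower_series x a)).
  { unfold bracket; fold w; rewrite E1, E2, Hpsi; field; auto. }
  rewrite E; clear E E1 E2.
  assert (B1 := Cmod_hyp_series_le x Hx a ltac:(lra)).
  assert (B2 := Cmod_Gamma_upper_le a x Hx ltac:(lra)).
  assert (B3 := Cmod_lower_series_le x Hx a ltac:(lra)).
  set (X := Re a) in *.
  assert (HX : (0 < / X <= / (X - 1))%R).
  { split; [apply Rinv_0_lt_compat; lra | apply Rinv_le_contravar; lra]. }
  assert (He := exp_pos x).
  assert (B4 : (Cmod (Gamma_upper (1 - a) x * (w * lower_series x a)) <= / X)%R).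
  { rewrite !Cmod_mult; unfold w; rewrite Cmod_Cexp.
    replace (Re (a * RtoC (ln x))) with (X * ln x)%R by (unfold X; destruct a; simpl; ring).
    apply Rle_trans with ((exp (- X * ln x) * exp (- x)) * (exp (X * ln x) * (/ X * exp x)))%R.
    - apply Rmult_le_compat; [apply Cmod_ge_0 | | exact B2 |].
      + apply Rmult_le_pos; [left; apply exp_pos | apply Cmod_ge_0].
      + apply Rmult_le_compat_l; [left; apply exp_pos | exact B3].
    - right; replace (- X * ln x)%R with (- (X * ln x))%R by ring; rewrite !exp_Ropp.
      field; repeat split; try lra; apply Rgt_not_eq, exp_pos. }
  assert (B5 : (x * (/ X * exp x) <= x * exp x / (X - 1))%R).
  { replace (x * (/ X * exp x))%R with (x * exp x * / X)%R by ring.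
    apply Rmult_le_compat_l; [nra | lra]. }
  eapply Rle_trans; [apply Cmod_minus_le |].
  replace ((2 * x + x * exp x + 1) / (X - 1))%R with (2 * x / (X - 1) + x * exp x / (X - 1) + / (X - 1))%R by (field; lra).
  apply Rplus_le_compat; [| lra].
  eapply Rle_trans; [apply Cmod_minus_le |]; apply Rplus_le_compat; [exact HI | lra].
Qed.

(** For Re a > 1 the error is constant along a + m and tends to 0 there, hence vanishes. The descent
    matches [is_derive_tricomiV_S] with [bracket_succ]. *)
Lemma is_derive_tricomiV_bracket (a : C) (n : nat) : nonpole a -> (0 < Re a + INR n)%R ->
  is_derive_C (fun h => tricomiV x n (a + h) h) (RtoC 0)
    (Cexp (- a * RtoC (ln x)) * (bracket a - RtoC (ln x))).
Proof.
  intros Ha; revert n; revert a Ha; apply (nonpole_ind 1 (fun a => forall n, (0 < Re a + INR n)%R ->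
    is_derive_C (fun h => tricomiV x n (a + h) h) (RtoC 0) (Cexp (- a * RtoC (ln x)) * (bracket a - RtoC (ln x))))).
  - intros a Ha n Hn.
    destruct (ex_derive_tricomiV_q0 a 0 ltac:(simpl; lra)) as [k Hk].
    assert (H0 : Cexp (a * RtoC (ln x)) * k - bracket a + RtoC (ln x) = 0).
    { set (d := Cexp (a * RtoC (ln x)) * k - bracket a + RtoC (ln x)).
      set (K := (2 * x + x * exp x + 1)%R).
      assert (HK : (0 < K)%R) by (unfold K; generalize (exp_pos x); nra).
      apply Cmod_eq_0, Rle_antisym; [| apply Cmod_ge_0]; apply Rnot_lt_le; intros Hd.
      (* The first entry brings a + m into the region of [bracket_bound], the second makes that
         bound smaller than |d|. *)
      destruct (INR_unbounded (Rmax (2 + 4 * Im a ^ 2) (K / Cmod d))) as [m Hm].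
      assert (Hm1 : (2 + 4 * Im a ^ 2 < INR m)%R) by (eapply Rle_lt_trans; [apply Rmax_l | exact Hm]).
      assert (Hm2 : (K / Cmod d < INR m)%R) by (eapply Rle_lt_trans; [apply Rmax_r | exact Hm]).
      destruct (bracket_steps m a k Ha Hk) as [k' [Hk' E]].
      assert (HI : Im (a + RtoC (INR m)) = Im a) by (destruct a; simpl; ring).
      assert (B := bracket_bound (a + RtoC (INR m)) k').
      rewrite Re_plus_R, HI in B.
      assert (Hi2 := pow2_ge_0 (Im a)).
      specialize (B ltac:(lra) ltac:(lra) Hk'); rewrite <- E in B; fold d K in B.
      apply (Rmult_lt_compat_r (Cmod d)) in Hm2; [| exact Hd].
      replace (K / Cmod d * Cmod d)%R with K in Hm2 by (field; lra).
      apply (Rmult_le_compat_r (Re a + INR m - 1)) in B; [| lra].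
      replace (K / (Re a + INR m - 1) * (Re a + INR m - 1))%R with K in B by (field; lra).
      nra. }
    apply (is_derive_tricomiV_n x 0 n a); [exact Hx | simpl; lra | exact Hn |].
    apply (is_derive_C_eq _ _ _ _ Hk).
    replace (- a * RtoC (ln x)) with (- (a * RtoC (ln x))) by ring; rewrite Cexp_opp.
    set (w := Cexp (a * RtoC (ln x))) in *; assert (Hw : w <> 0) by apply Cexp_neq_0.
    replace (bracket a - RtoC (ln x)) with (w * k - (w * k - bracket a + RtoC (ln x))) by ring.
    rewrite H0; field; exact Hw.
  - intros a Ha IH n Hn.
    assert (Hn1 : (0 < Re (a + 1) + INR n)%R) by (rewrite Re_plus_1; lra).
    assert (Hk := is_derive_tricomiV_S x n a _ Hx Hn Ha (IH n Hn1)).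
    apply (is_derive_tricomiV_n x (S n) n a); [exact Hx | rewrite S_INR; lra | exact Hn |].
    apply (is_derive_C_eq _ _ _ _ Hk).
    rewrite (bracket_succ a Ha).
    replace (- (a + 1) * RtoC (ln x)) with (- (a * RtoC (ln x)) + - RtoC (ln x)) by ring.
    replace (- a * RtoC (ln x)) with (- (a * RtoC (ln x))) by ring.
    rewrite Cexp_plus, !Cexp_opp, (Cexp_R (ln x)), exp_ln by auto.
    set (w := Cexp (a * RtoC (ln x))); assert (Hw : w <> 0) by apply Cexp_neq_0.
    field; split; [exact Hw | now apply RtoC_neq_0].
Qed.

End Lower.

(** * The derivative of the Whittaker function *)

Theorem theorem26 :
  forall (mu : C) (x : R),
    (forall n : nat, - (2 * mu) <> RtoC (INR n)) ->
    (0 < x)%R ->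
    is_derive (fun m : C => whittakerW (RtoC (1 / 2) - mu) m x) mu
      (Cpower (RtoC x) (RtoC (1 / 2) - mu) * RtoC (exp (- x / 2)) *
       (RtoC x / (2 * mu)
          * pFq [RtoC 1; RtoC 1] [RtoC 2; 1 + 2 * mu] (RtoC (- x))
        + Cexp (- (2 * RtoC PI * Ci * mu))
          * Gamma_upper (1 - 2 * mu) x * gamma_lower (2 * mu) (RtoC (- x))
        + digamma (2 * mu)
        - RtoC (ln x))).
Proof.
  intros mu x Hmu Hx.
  assert (Ha : nonpole (2 * mu)).
  { intros n H; apply (Hmu n).
    replace (RtoC (INR n)) with (2 * mu + RtoC (INR n) - 2 * mu) by ring; rewrite H; ring. }
  rewrite (pFq_hyp_series x Hx _ Ha), (gamma_lower_series x Hx _ Ha), Cpower_pos by exact Hx.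
  set (a := 2 * mu) in *.
  (* Re a + N > 1 lets the depth N serve every a + h with |h| < 1. *)
  destruct (INR_unbounded (1 - Re a)) as [N HN].
  assert (HD := is_derive_tricomiV_bracket x Hx a N Ha ltac:(lra)).
  (* The factor x^(m + 1/2) contributes + ln x, which cancels the - ln x in the derivative of U and
     leaves [bracket a]. *)
  assert (HW : is_derive_C (fun h => Cexp ((mu + RtoC (1 / 2)) * RtoC (ln x) + RtoC (ln x) * h)) (RtoC 0)
    (RtoC (ln x) * Cexp ((mu + RtoC (1 / 2)) * RtoC (ln x)))).
  { apply is_derive_C_eq with (RtoC (ln x) * Cexp ((mu + RtoC (1 / 2)) * RtoC (ln x) + RtoC (ln x) * RtoC 0)).
    - apply (is_derive_C_comp Cexp (fun h => (mu + RtoC (1 / 2)) * RtoC (ln x) + RtoC (ln x) * h));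
        [apply is_derive_Cexp_C | apply is_derive_C_affine].
    - now rewrite Cmult_0_r, Cplus_0_r. }
  assert (HP := is_derive_C_mult _ _ _ _ _ (is_derive_C_scal (RtoC (exp (- x / 2))) _ _ _ HW) HD).
  cbv beta in HP; rewrite !Cplus_0_r, Cmult_0_r, Cplus_0_r, (tricomiV_q0 x N a Hx) in HP by lra.
  apply (proj1 (is_derive_C_at_0 (fun m => whittakerW (RtoC (1 / 2) - mu) m x) mu _)).
  eapply is_derive_C_eq; [refine (is_derive_C_ext_near _ _ _ _ 1 Rlt_0_1 _ HP) |].
  - intros h Hh; rewrite !Cplus_0_l; unfold whittakerW, tricomiU.
    rewrite Cpower_pos by exact Hx.
    (* With kappa fixed, moving m by h moves a by h and b by 2 h, so the exponent q = b - a - 1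
       equals h. *)
    replace (RtoC (1 / 2) + (mu + h) - (RtoC (1 / 2) - mu)) with (a + h) by (unfold a; ring).
    replace (1 + 2 * (mu + h)) with (a + h + h + 1) by (unfold a; ring).
    fold (tricomiV x (right_shift (a + h)) (a + h) h).
    rewrite (tricomiV_eq x (right_shift (a + h)) N) by
      first [exact Hx | apply right_shift_spec | generalize (Re_near a h 1 Hh); lra].
    f_equal; f_equal; f_equal; ring.
  - unfold bracket.
    replace ((RtoC (1 / 2) - mu) * RtoC (ln x)) with ((mu + RtoC (1 / 2)) * RtoC (ln x) + - a * RtoC (ln x))
      by (unfold a; ring).
    replace (Cexp (- (2 * RtoC PI * Ci * mu)) * Gamma_upper (1 - a) x * (Cexp (a * (ln x, PI)) * lower_series x a)) with
      (Gamma_upper (1 - a) x * (Cexp (a * RtoC (ln x)) * lower_series x a)).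
    + rewrite Cexp_plus; ring.
    (* The phase: a (ln x + i pi) - 2 pi i mu = a ln x, because a = 2 mu. *)
    + replace (a * RtoC (ln x)) with (- (2 * RtoC PI * Ci * mu) + a * (ln x, PI)).
      * rewrite Cexp_plus; ring.
      * unfold a; destruct mu; apply injective_projections; simpl; ring.
Qed.
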